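(* The optimization problem of finding a pair of vertices of a polytope at maximum shortest-path distance on the 1-skeleton of the polytope is APX-hard.
   Context: The polytope is given as input by an explicit system of linear inequalities $\{x\in\mathbb R^d: Ax\le b\}$ with rational data (hardness holds already for fractional matching polytopes $\{x\in\mathbb R^E: \sum_{e\ni v}x_e\le 1\ \forall v\in V,\ x\ge 0\}$ of simple graphs $G=(V,E)$). The 1-skeleton of a polytope is the graph whose nodes are its vertices and whose edges are its 1-dimensional faces; a feasible solution is a pair of vertices, and its value is their shortest-path distance in the 1-skeleton, to be maximized. APX-hard means that every problem in APX reduces to it via an approximation-preserving (e.g. L-) reduction; in particular, unless P=NP, it admits no polynomial-time approximation scheme. *)

(* Defs.v *)
From HB Require Import structures.
From mathcomp Require Import all_boot all_order all_algebra.
From mathcomp Require Import boolp classical_sets reals.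

Set Implicit Arguments.
Unset Strict Implicit.
Unset Printing Implicit Defensive.

Import Order.TTheory GRing.Theory Num.Theory.
Local Open Scope ring_scope.

(** * Deterministic multi-tape Turing machines *)

Definition bits := seq bool.

(* [None] is the blank, [Some (inl b)] an input/output bit, and
   [Some (inr s)] a work symbol. *)
Definition cell (S : finType) : finType := option (bool + S)%type.

Inductive move := MoveL | MoveR | MoveN.

(* The cells left of the head (nearest first), the scanned cell, and the cells
   right of the head (nearest first); all further cells are blank. *)
Record tape (S : finType) := Tape {
  tape_left : seq (cell S);
  tape_head : cell S;
  tape_right : seq (cell S) }.

Definition tape_write (S : finType) (c : cell S) (t : tape S) : tape S :=
  Tape (tape_left t) c (tape_right t).

Definition tape_move (S : finType) (m : move) (t : tape S) : tape S :=
  match m with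
  | MoveL => Tape (behead (tape_left t)) (head None (tape_left t))
                  (tape_head t :: tape_right t)
  | MoveR => Tape (tape_head t :: tape_left t) (head None (tape_right t))
                  (behead (tape_right t))
  | MoveN => t
  end.

Definition tape_init (S : finType) (w : bits) : tape S :=
  let cs : seq (cell S) := [seq Some (inl b) | b <- w] in
  Tape [::] (head None cs) (behead cs).

Fixpoint leading_bits (S : finType) (cs : seq (cell S)) : bits :=
  if cs is Some (inl b) :: cs' then b :: leading_bits cs' else [::].

Definition tape_output (S : finType) (t : tape S) : bits :=
  leading_bits (tape_head t :: tape_right t).

(* [tm_tapes.+1] tapes; a [None] transition means that the machine halts. *)
Record tm := TM {
  tm_tapes : nat;
  tm_state : finType;
  tm_symbol : finType;
  tm_start : tm_state;
  tm_trans : tm_state -> {ffun 'I_tm_tapes.+1 -> cell tm_symbol} ->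
    option (tm_state * ('I_tm_tapes.+1 -> cell tm_symbol * move)) }.

Record config (M : tm) := Config {
  cfg_state : tm_state M;
  cfg_tape : 'I_(tm_tapes M).+1 -> tape (tm_symbol M) }.

Definition tm_step (M : tm) (c : config M) : option (config M) :=
  if tm_trans (cfg_state c) [ffun i => tape_head (cfg_tape c i)] is Some (q, a)
  then Some (Config q
         (fun i => tape_move (a i).2 (tape_write (a i).1 (cfg_tape c i))))
  else None.

Definition tm_run (M : tm) (t : nat) (c : config M) : config M :=
  iter t (fun c => odflt c (tm_step c)) c.

(* The j-th input string is written on the j-th tape. *)
Definition tm_init (M : tm) (ws : seq bits) : config M :=
  Config (tm_start M) (fun i => tape_init _ (nth [::] ws i)).

(* The output is read on the first tape, from the head to the right. *)
Definition tm_computes_in (M : tm) (t : nat) (ws : seq bits) (out : bits) : Prop :=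
  let c := tm_run t (tm_init M ws) in
  tm_step c = None /\ tape_output (cfg_tape c ord0) = out.

Definition poly_bound (k n : nat) : nat := (k * n ^ k + k)%N.

Definition tm_computes_poly (M : tm) (k : nat) (ws : seq bits) (out : bits) : Prop :=
  tm_computes_in M (poly_bound k (sumn [seq size w | w <- ws])) ws out.

(** * Binary encodings *)

Fixpoint enc_pos (p : BinNums.positive) : bits :=
  match p with
  | BinNums.xH => [:: true]
  | BinNums.xO p => false :: enc_pos p
  | BinNums.xI p => true :: enc_pos p
  end.

Definition enc_nat (n : nat) : bits :=
  if bin_of_nat n is BinNums.Npos p then enc_pos p else [::].

Definition enc_int (z : int) : bits :=
  match z with Posz n => false :: enc_nat n | Negz n => true :: enc_nat n end.

(* Self-delimiting form of a string: each bit b becomes 1b, and 0 ends it. *)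
Fixpoint delimit (w : bits) : bits :=
  if w is b :: w' then [:: true, b & delimit w'] else [:: false].

Definition enc_seq (T : Type) (enc : T -> bits) (s : seq T) : bits :=
  flatten [seq delimit (enc x) | x <- s].

Definition enc_rat (q : rat) : bits := enc_seq enc_int [:: numq q; denq q].

Definition enc_mx (m n : nat) (A : 'M[rat]_(m, n)) : bits :=
  enc_seq (enc_seq enc_rat) [seq [seq A i j | j <- enum 'I_n] | i <- enum 'I_m].

Lemma enc_pos_nil p : enc_pos p <> [::].
Proof. by case: p. Qed.

Lemma enc_pos_inj : injective enc_pos.
Proof.
elim=> [p IH|p IH|] [q|q|] //= [].
- by move/IH ->.
- by move/enc_pos_nil.
- by move/IH ->.
- by move/esym/enc_pos_nil.
Qed.

Lemma enc_nat_inj : injective enc_nat.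
Proof.
move=> m n; rewrite /enc_nat => e; apply: (can_inj bin_of_natK).
case: (bin_of_nat m) (bin_of_nat n) e => [|p] [|q] //.
- by move/esym/enc_pos_nil.
- by move/enc_pos_nil.
- by move/enc_pos_inj ->.
Qed.

Lemma enc_int_inj : injective enc_int.
Proof. by move=> [m|m] [n|n] // [] /enc_nat_inj ->. Qed.

Lemma delimit_cat_inj u v s t :
  delimit u ++ s = delimit v ++ t -> u = v /\ s = t.
Proof.
elim: u v => [|a u IH] [|b v] //= []; first by move=> ->.
by move=> -> /IH[-> ->].
Qed.

Lemma enc_seq_inj (T : Type) (enc : T -> bits) :
  injective enc -> injective (enc_seq enc).
Proof.
move=> enc_inj; elim=> [|x s IH] [|y t] //=; rewrite /enc_seq /=.
- by case: (enc y).
- by case: (enc x).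
- by move/delimit_cat_inj => [/enc_inj -> /IH ->].
Qed.

Lemma enc_rat_inj : injective enc_rat.
Proof.
move=> p q /(enc_seq_inj enc_int_inj) [en ed].
by rewrite -[p]divq_num_den -[q]divq_num_den en ed.
Qed.

Lemma enc_mx_inj m n : injective (@enc_mx m n).
Proof.
move=> A B /(enc_seq_inj (enc_seq_inj enc_rat_inj)) /eq_in_map eAB.
apply/matrixP => i j.
have /eq_in_map -> // : [seq A i j | j <- enum 'I_n] = [seq B i j | j <- enum 'I_n].
  by apply: eAB; rewrite mem_enum.
by rewrite mem_enum.
Qed.

(** * Optimization problems *)

Inductive goal := Minimize | Maximize.

(* [sol x] is the type of feasible solutions of the instance [x]. *)
Record opt_problem := OptProblem {
  opt_goal : goal;
  inst : Type;
  sol : inst -> Type;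
  value : forall x : inst, sol x -> nat;
  enc_inst : inst -> bits;
  enc_sol : forall x : inst, sol x -> bits;
  enc_inst_inj : injective enc_inst;
  enc_sol_inj : forall x : inst, injective (enc_sol (x := x)) }.

Definition is_opt (A : opt_problem) (x : inst A) (n : nat) : Prop :=
  (exists y : sol x, value y = n) /\
  (forall y : sol x, match opt_goal A with
                     | Minimize => (n <= value y)%N
                     | Maximize => (value y <= n)%N
                     end).

(* The performance ratio max(value y / opt, opt / value y) is at most r,
   with 0 / 0 read as 1 and n / 0 as infinity for n > 0. *)
Definition ratio_le (A : opt_problem) (r : rat) (x : inst A) (y : sol x) : Prop :=
  exists2 n, is_opt x n &
    n%:R <= r * (value y)%:R /\ (value y)%:R <= r * n%:R.

(* Instances are recognizable in polynomial time, solutions have polynomial size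
   and are recognizable in polynomial time, and values are computable in
   polynomial time. *)
Definition NPO (A : opt_problem) : Prop :=
  [/\ exists M k, forall w : bits,
        tm_computes_poly M k [:: w] [:: `[< exists x : inst A, w = enc_inst x >]],
      exists k, forall (x : inst A) (y : sol x),
        (size (enc_sol y) <= poly_bound k (size (enc_inst x)))%N,
      exists M k, forall (x : inst A) (w : bits),
        tm_computes_poly M k [:: enc_inst x; w]
          [:: `[< exists y : sol x, w = enc_sol y >]] &
      exists M k, forall (x : inst A) (y : sol x),
        tm_computes_poly M k [:: enc_inst x; enc_sol y] (enc_nat (value y))].

Definition APX (A : opt_problem) : Prop :=
  NPO A /\
  exists (r : rat) (M : tm) (k : nat), 1 < r /\
    forall x : inst A, inhabited (sol x) ->
      exists2 y : sol x, ratio_le r y &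
        tm_computes_poly M k [:: enc_inst x] (enc_sol y).

(* Approximation-preserving (AP-) reduction in the sense of Crescenzi, Kann,
   Silvestri and Trevisan: f and g also receive the ratio r, and run in time
   polynomial for each fixed r. *)
Definition AP_reducible (A B : opt_problem) : Prop :=
  exists (alpha : rat) (f : rat -> inst A -> inst B)
         (g : forall (r : rat) (x : inst A), sol (f r x) -> sol x),
  [/\ 1 <= alpha,
      exists M, forall r, 1 < r -> exists k, forall x : inst A,
        tm_computes_poly M k [:: enc_inst x; enc_rat r] (enc_inst (f r x)),
      exists M, forall r, 1 < r -> exists k, forall (x : inst A) (y : sol (f r x)),
        tm_computes_poly M k [:: enc_inst x; enc_sol y; enc_rat r]
          (enc_sol (g r x y)),
      forall r x, 1 < r -> inhabited (sol x) -> inhabited (sol (f r x)) &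
      forall r x (y : sol (f r x)), 1 < r ->
        ratio_le r y -> ratio_le (1 + alpha * (r - 1)) (g r x y)].

Definition APX_hard (B : opt_problem) : Prop :=
  forall A : opt_problem, APX A -> AP_reducible A B.

(** * Polytopes and their 1-skeleton *)

Local Open Scope classical_set_scope.

Section Polytopes.
Variables (R : realType) (d : nat).
Implicit Types (P F : set 'cV[R]_d) (u v : 'cV[R]_d).

Definition polyhedron (m : nat) (A : 'M[R]_(m, d)) (b : 'cV[R]_m) : set 'cV[R]_d :=
  [set x | forall i, (A *m x) i 0 <= b i 0].

Definition bounded P : Prop :=
  exists C : R, forall x, P x -> forall i, `|x i 0| <= C.

Definition is_face P F : Prop :=
  exists (c : 'rV[R]_d) (delta : R),
    (forall x, P x -> (c *m x) 0 0 <= delta) /\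
    F = P `&` [set x | (c *m x) 0 0 = delta].

(* p and the points p + (row i V)^T form an affine basis, contained in F, of
   the affine hull of F. *)
Definition affine_dim F (k : nat) : Prop :=
  exists (p : 'cV[R]_d) (V : 'M[R]_(k, d)),
    [/\ row_free V, F p, forall i, F (p + (row i V)^T) &
        forall x, F x -> ((x - p)^T <= V)%MS].

Definition is_vertex P v : Prop := is_face P [set v].

Definition adjacent P u v : Prop :=
  [/\ is_vertex P u, is_vertex P v, u <> v &
      exists F, [/\ is_face P F, affine_dim F 1, F u & F v]].

Fixpoint walk P (n : nat) u v : Prop :=
  if n is n'.+1 then exists w, adjacent P u w /\ walk P n' w v else u = v.

(* The default 0 is never used for vertices of a polytope, as the 1-skeleton of
   a polytope is connected. *)
Definition skeleton_dist P u v : nat :=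
  xget 0%N [set n | walk P n u v /\ forall m, walk P m u v -> (n <= m)%N].

End Polytopes.

Definition rat_polyhedron (R : realType) (m d : nat) (A : 'M[rat]_(m, d))
    (b : 'cV[rat]_m) : set 'cV[R]_d :=
  polyhedron (map_mx ratr A) (map_mx ratr b).
Arguments rat_polyhedron R {m d} A b.

Record polytope (R : realType) := Polytope {
  pt_ineqs : nat;
  pt_dim : nat;
  pt_A : 'M[rat]_(pt_ineqs, pt_dim);
  pt_b : 'cV[rat]_pt_ineqs;
  pt_bounded : bounded (rat_polyhedron R pt_A pt_b) }.

Definition pt_set (R : realType) (P : polytope R) : set 'cV[R]_(pt_dim P) :=
  rat_polyhedron R (pt_A P) (pt_b P).
Arguments pt_set {R} P.

Definition enc_polytope (R : realType) (P : polytope R) : bits :=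
  enc_seq id [:: enc_nat (pt_ineqs P); enc_nat (pt_dim P);
                 enc_mx (pt_A P); enc_mx (pt_b P)].

Lemma enc_polytope_inj (R : realType) : injective (@enc_polytope R).
Proof.
move=> [m d A b hP] [m' d' A' b' hP'] /(enc_seq_inj (@inj_id bits)) /= [].
move=> /enc_nat_inj em /enc_nat_inj ed; subst m' d'.
move=> /enc_mx_inj eA /enc_mx_inj eb; subst A' b'.
by rewrite (Prop_irrelevance hP hP').
Qed.

(* The vertices of a polytope given by rational data are rational, so every pair
   of vertices is of this form. *)
Record vertex_pair (R : realType) (P : polytope R) := VertexPair {
  vp_fst : 'cV[rat]_(pt_dim P);
  vp_snd : 'cV[rat]_(pt_dim P);
  vp_fstP : is_vertex (pt_set P) (map_mx ratr vp_fst);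
  vp_sndP : is_vertex (pt_set P) (map_mx ratr vp_snd) }.

Definition vp_dist (R : realType) (P : polytope R) (y : vertex_pair P) : nat :=
  skeleton_dist (pt_set P) (map_mx ratr (vp_fst y)) (map_mx ratr (vp_snd y)).

Definition enc_vertex_pair (R : realType) (P : polytope R) (y : vertex_pair P) : bits :=
  enc_seq (@enc_mx _ _) [:: vp_fst y; vp_snd y].

Lemma enc_vertex_pair_inj (R : realType) (P : polytope R) :
  injective (@enc_vertex_pair R P).
Proof.
move=> [u v hu hv] [u' v' hu' hv'] /(enc_seq_inj (@enc_mx_inj _ _)) /= [eu ev].
subst u' v'; by rewrite (Prop_irrelevance hu hu') (Prop_irrelevance hv hv').
Qed.

Definition polytope_diameter (R : realType) : opt_problem :=
  OptProblem Maximize (@vp_dist R) (@enc_polytope_inj R) (@enc_vertex_pair_inj R).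

(* Main.v *)
Require Import Defs.
From HB Require Import structures.
From mathcomp Require Import all_boot all_order all_algebra.
From mathcomp Require Import boolp classical_sets reals.
From mathcomp Require Import zify ring lra.

(** For a CNF formula [phi] let [Q phi] be the polytope in the variables [lam], [z]
    and [x_v] given by [0 <= x_v <= lam], [|z| + lam <= 1] and [|z| <= S_c] for every
    clause [c], where [S_c] is the sum of the literals of [c] and a negated variable
    counts [lam - x_v].  A vertex is good if [lam = 1] and every [S_c] is positive;
    good vertices are the satisfying assignments.  At a vertex with [lam = 1] and
    [S_c = 0] the coordinate [z] is blocked, so that it is adjacent to the apex [0];
    a good vertex is at distance exactly 2 from the apex.  With four dummy variables,
    two good vertices that differ in all of them are at distance 4.  Hence the diameter
    of [Q phi] is 4 if [phi] is satisfiable and 2 otherwise, and a pair of vertices at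
    distance more than 2 exhibits a satisfying assignment.

    Let [A] be in APX, and let [v0] be the value of the solution of [x] found by the
    approximation algorithm of [A].  The reduction maps [x] to the product of the
    polytopes [Q phi_l], where [phi_l] says that [x] has a solution whose value is
    better than the [l]-th of finitely many equally spaced thresholds covering the
    range of the optimum determined by [v0]; distances in a product add up.  The
    solution [g] recovered from a pair of vertices is the best one among the given one
    and those read off from the good blocks.  A pair of vertices of ratio [r] misses at
    most a fraction [2 (r - 1)] of the thresholds, and the number of missed thresholds
    between the value of [g] and the optimum bounds their difference.

    The formula [phi_l] is the tableau of a stack program that runs the verifier and
    the value machine of [A]; both maps of the reduction are stack programs as well,
    and stack programs are compiled to Turing machines. *)

Set Implicit Arguments.
Unset Strict Implicit.
Unset Printing Implicit Defensive.

Import Order.TTheory GRing.Theory Num.Theory.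

Local Open Scope ring_scope.

(** * Minimal faces of polyhedra *)

(** Hardness for all of APX requires a loss linear in [r - 1], whereas one formula yields only the
    gap between 2 and 4. The product turns this gap into a scale: its diameter is at most [4 L], so
    a ratio [r] can hide at most [2 L (r - 1)] satisfiable blocks. Let [E] be 2 to the bit length of
    [v0], so that [E <= 2 v0] for [v0 > 0], let [Q] be 2 to the length of the code of [r], and let
    [rho] be a power of two bounding the ratio of the approximation algorithm. The thresholds are
    the floors of [(l + 1) E / Q] for [l < L = rho Q]. As [Q (r - 1) >= 1], missing [c] of them
    costs at most [(c + 1) E / Q <= E (r - 1) (1 + 2 rho)], which is linear relative to the optimum.
    Powers of two turn the arithmetic into shifts; [L] is exponential in the length of [r], which is
    harmless because time is measured for each fixed [r]. The other obstacle is that a machine must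
    print the inequality system. Therefore clauses are local in time and depth, and a matrix entry
    is a function of finitely many flags about the positions of its row and column. *)

Lemma exists_pos_le (R : realFieldType) (T : eqType) (s : seq T) (g : T -> R) :
  (forall i, i \in s -> 0 < g i) -> exists2 e, 0 < e & forall i, i \in s -> e <= g i.
Proof.
elim: s => [|a s IH] h; first by exists 1.
have [|e e0 he] := IH; first by move=> i si; apply: h; rewrite inE si orbT.
exists (Num.min e (g a)); first by rewrite lt_min e0 h // mem_head.
by move=> i; rewrite inE => /orP[/eqP->|/he]; rewrite ge_min ?lexx ?orbT // => ->.
Qed.

Lemma mulmx_comb (R : comPzRingType) m d (c : 'M[R]_(m, d)) (x y : 'cV[R]_d) a e i :
  (c *m (a *: y + e *: x)) i 0 = a * (c *m y) i 0 + e * (c *m x) i 0.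
Proof. by rewrite mulmxDr -!scalemxAr mxE [X in X + _]mxE [X in _ + X]mxE. Qed.

Section MinimalFaces.
Variables (R : realType) (d m : nat) (A : 'M[R]_(m, d)) (b : 'cV[R]_m).
Local Notation P := (polyhedron A b).
Implicit Types (u v x y : 'cV[R]_d).

(* [x] lies in the smallest face of [P] through [p]: the segment from [x] to [p]
   extends inside [P] beyond [p]. *)
Definition beyond p x := exists y e, [/\ P y, 0 < e & (1 + e) *: p = y + e *: x].

(** At [p] the functional is a weighted mean of its values at [x] and [y]; being maximal there, it
    is maximal at both points. *)
Lemma face_beyond (F : set 'cV[R]_d) p x : is_face P F -> F p -> P x -> beyond p x -> F x.
Proof.
move=> [c [delta [cP ->]]] [Pp /= cp] Px [y [e [Py e0 h]]].
split=> //=; apply/eqP; rewrite eq_le cP //=.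
move/(congr1 (fun z => (c *m (1 *: z)) 0 0)): h.
rewrite !scale1r -[(1 + e) *: p]addr0 -(scale0r 0) mulmx_comb cp mul0r addr0.
rewrite -[y]scale1r mulmx_comb mul1r.
have := cP _ Py; nra.
Qed.

(** The supporting functional is the sum of the rows tight at [p]. From a point that is tight for
    these rows the segment extends beyond [p], since all other rows have positive slack at [p]. *)
Lemma beyond_face p : P p -> is_face P (fun x => P x /\ beyond p x).
Proof.
move=> Pp.
pose I := [pred i | (A *m p) i 0 == b i 0].
pose c := \sum_(i | I i) row i A.
pose delta := \sum_(i | I i) b i 0.
have cE x : (c *m x) 0 0 = \sum_(i | I i) (A *m x) i 0.
  by rewrite mulmx_suml summxE; apply: eq_bigr => i _; rewrite -row_mul mxE.
have cP x : P x -> (c *m x) 0 0 <= delta by move=> Px; rewrite cE ler_sum.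
have cp : (c *m p) 0 0 = delta by rewrite cE; apply: eq_bigr => i /eqP.
exists c, delta; split=> //; apply/seteqP; split=> x /=.
  move=> [Px [y [e [Py e0 h]]]]; split=> //; apply/eqP; rewrite eq_le cP //=.
  move/(congr1 (fun z => (c *m (1 *: z)) 0 0)): h.
  rewrite !scale1r -[(1 + e) *: p]addr0 -(scale0r 0) mulmx_comb cp mul0r addr0.
  rewrite -[y]scale1r mulmx_comb mul1r.
  have := cP _ Py; nra.
move=> [Px /= cx]; split=> //.
have tight i : I i -> (A *m x) i 0 = b i 0.
  move=> Ii; apply/eqP; rewrite eq_sym -subr_eq0; apply/eqP.
  have hs : \sum_(i | I i) (b i 0 - (A *m x) i 0) = 0 by rewrite sumrB -cE cx subrr.
  by apply: (psumr_eq0P _ hs) => // j _; rewrite subr_ge0.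
(* [g i] is a step length that cannot use up the slack of row [i]; the added 1 keeps the denominator
   positive. *)
pose g i := if I i then 1 else
  (b i 0 - (A *m p) i 0) / (1 + `|(A *m p) i 0 - (A *m x) i 0|).
have [i _|e e0 he] := @exists_pos_le R _ (enum 'I_m) g.
  rewrite /g; case: ifPn => // nI; apply: divr_gt0.
    by rewrite subr_gt0 lt_neqAle nI Pp.
  by apply: (lt_le_trans ltr01); rewrite lerDl.
exists ((1 + e) *: p - e *: x), e; split=> //; last by rewrite subrK.
move=> i; rewrite mulmxBr -!scalemxAr.
have -> : ((1 + e) *: (A *m p) - e *: (A *m x)) i 0 =
  (1 + e) * (A *m p) i 0 - e * (A *m x) i 0 by rewrite !mxE.
have := he i; rewrite mem_enum => /(_ isT); rewrite /g; case: ifPn => Ii.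
  by rewrite tight // (eqP Ii) => _; lra.
have a0 : 0 <= `|(A *m p) i 0 - (A *m x) i 0| by [].
have a1 := ler_norm ((A *m p) i 0 - (A *m x) i 0).
rewrite ler_pdivlMr; last by lra.
nra.
Qed.

Lemma is_vertexP v : is_vertex P v <-> P v /\ (forall x, P x -> beyond v x -> x = v).
Proof.
split=> [vV|[Pv h]].
  have Pv : P v.
    have [c [delta [_ E]]] := vV.
    have : [set v]%classic v by [].
    by rewrite E => -[].
  by split=> // x Px bx; apply: (face_beyond vV (erefl v) Px bx).
rewrite /is_vertex.
suff -> : [set v]%classic = (fun x => P x /\ beyond v x) by apply: beyond_face.
apply/seteqP; split=> x /=; last by move=> [Px /h]; exact.
move=> ->; split=> //; exists v, 1; split=> //.
by rewrite scalerDl scale1r.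
Qed.

(** The face witnessing adjacency can be taken to be the smallest one through the midpoint, so
    adjacency means that this face lies on the line through [u] and [v]. *)
Lemma adjacentP u v : adjacent P u v <->
  [/\ is_vertex P u, is_vertex P v, u <> v &
     forall x, P x -> beyond (2^-1 *: (u + v)) x -> exists s, x = u + s *: (v - u)].
Proof.
have h2 : (1 + 1 : R) *: (2^-1 *: (u + v)) = u + v.
  rewrite scalerA; have -> : (1 + 1 : R) * 2^-1 = 1 by lra.
  by rewrite scale1r.
split=> [[uV vV uv [F [Ff [p [V [Vf Fp _ FV]]] Fu Fv]]]|[uV vV uv h]].
  split=> // x Px bx.
  have Pu : P u by have [] := iffLR (is_vertexP u) uV.
  have Pv : P v by have [] := iffLR (is_vertexP v) vV.
  have Fm : F (2^-1 *: (u + v)).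
    have [c [delta [cP EF]]] := Ff.
    move: Fu Fv; rewrite EF => -[_ /= cu] [_ /= cv]; split=> /=.
      move=> i; rewrite -scalemxAr mulmxDr.
      have -> : (2^-1 *: (A *m u + A *m v)) i 0 = 2^-1 * ((A *m u) i 0 + (A *m v) i 0).
        by rewrite !mxE.
      by have := Pu i; have := Pv i; lra.
    rewrite -scalemxAr mulmxDr mxE mxE cu cv; lra.
  have Fx : F x by apply: (face_beyond Ff Fm).
  have su w : F w -> ((w - u)^T <= V)%MS.
    move=> Fw; have -> : (w - u)^T = (w - p)^T - (u - p)^T.
      by rewrite -linearB /= opprB addrA subrK.
    by rewrite addmx_sub ?eqmx_opp ?FV.
  have /sub_rVP[a ha] := su _ Fv; have /sub_rVP[c hc] := su _ Fx.
  have a0 : a != 0.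
    apply/eqP => a0; apply: uv; move: ha; rewrite a0 scale0r => /(congr1 trmx).
    by rewrite trmxK trmx0 => /eqP; rewrite subr_eq0 => /eqP.
  exists (c / a); apply/eqP; rewrite addrC -subr_eq; apply/eqP/trmx_inj.
  by rewrite linearZ /= ha hc scalerA mulfVK.
split=> //.
have Pu : P u by have [] := iffLR (is_vertexP u) uV.
have Pv : P v by have [] := iffLR (is_vertexP v) vV.
have Pm : P (2^-1 *: (u + v)).
  move=> i; rewrite -scalemxAr mulmxDr.
  have -> : (2^-1 *: (A *m u + A *m v)) i 0 = 2^-1 * ((A *m u) i 0 + (A *m v) i 0).
    by rewrite !mxE.
  by have := Pu i; have := Pv i; lra.
exists (fun x => P x /\ beyond (2^-1 *: (u + v)) x).
have bu : beyond (2^-1 *: (u + v)) u by exists v, 1; split; rewrite // h2 scale1r addrC.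
have bv : beyond (2^-1 *: (u + v)) v by exists u, 1; split; rewrite // h2 scale1r.
split=> //; first exact: beyond_face.
exists u, ((v - u)^T); split=> //.
- suff nz : (v - u)^T != 0 by rewrite /row_free rank_rV nz.
  apply/eqP => /(congr1 trmx).
  by rewrite trmxK trmx0 => /eqP; rewrite subr_eq0 => /eqP /esym /uv.
- by move=> i; rewrite (ord1 i) row_id trmxK addrC subrK.
- move=> x [Px /(h _ Px)[s ->]]; rewrite addrC addKr linearZ /=.
  exact: scalemx_sub.
Qed.

End MinimalFaces.

(** * Extreme points and edges in coordinates *)

Section Extremal.
Variables (R : realType) (W : Type).
Implicit Types (Q : (W -> R) -> Prop) (u v x y : W -> R).

(** [is_vertexP] without matrices: points are functions on an index type, so that a product of
    polytopes is a predicate on functions of pairs. [edge] does the same for [adjacentP]. *)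
Definition extremal Q v := Q v /\ forall x y e, Q x -> Q y -> 0 < e ->
  (forall i, (1 + e) * v i = y i + e * x i) -> x = v.

Definition edge Q u v := [/\ extremal Q u, extremal Q v, u <> v &
  forall x y e, Q x -> Q y -> 0 < e ->
    (forall i, (1 + e) * (2^-1 * (u i + v i)) = y i + e * x i) ->
    exists s, forall i, x i = u i + s * (v i - u i)].

Lemma extremal_shift Q v w : extremal Q v ->
  Q (fun i => v i + w i) -> Q (fun i => v i - w i) -> forall i, w i = 0.
Proof.
move=> [_ h] Qp Qm i.
have := h _ _ 1 Qp Qm ltr01 (fun i => _).
move=> /(_ _)/(congr1 (fun g => g i)) => E.
suff : v i + w i = v i by lra.
by apply: E => j; lra.
Qed.

Lemma edge_shift Q u v w : edge Q u v ->
  Q (fun i => 2^-1 * (u i + v i) + w i) -> Q (fun i => 2^-1 * (u i + v i) - w i) ->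
  exists s, forall i, w i = s * (v i - u i).
Proof.
move=> [_ _ _ h] Qp Qm; have [|s hs] := h _ _ 1 Qp Qm ltr01; first by move=> j; lra.
by exists (s - 2^-1) => i; have := hs i; lra.
Qed.

Lemma edge_sym Q u v : edge Q u v -> edge Q v u.
Proof.
move=> [hu hv uv h]; split=> // [/esym //|x y e Qx Qy e0 E].
have [i|s hs] := h x y e Qx Qy e0; first by rewrite -E; congr (_ * (_ * _)); rewrite addrC.
by exists (1 - s) => i; rewrite hs; lra.
Qed.

End Extremal.

Section Coordinates.
Variables (R : realType) (T : finType) (m : nat) (A : 'M[R]_(m, #|T|)) (b : 'cV[R]_m).
Local Notation P := (polyhedron A b).

Definition coords (x : 'cV[R]_#|T|) : T -> R := fun t => x (enum_rank t) 0.
Definition vec (f : T -> R) : 'cV[R]_#|T| := \col_j f (enum_val j).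

Lemma coordK : cancel coords vec.
Proof. by move=> x; apply/matrixP => i j; rewrite mxE /coords enum_valK (ord1 j). Qed.

Lemma vecK : cancel vec coords.
Proof. by move=> f; apply: funext => t; rewrite /coords mxE enum_rankK. Qed.

Lemma coord_beyond (p x y : 'cV[R]_#|T|) e :
  (1 + e) *: p = y + e *: x <->
  forall t, (1 + e) * coords p t = coords y t + e * coords x t.
Proof.
split=> [E t|E].
  by move/(congr1 (fun z : 'cV_ _ => z (enum_rank t) 0)): E; rewrite !mxE.
apply/matrixP => i j; rewrite (ord1 j); have := E (enum_val i).
by rewrite /coords enum_valK !mxE.
Qed.

Lemma vertex_coord v :
  is_vertex P v <-> extremal (fun f => P (vec f)) (coords v).
Proof.
split=> [/is_vertexP[Pv h]|[]].
  split; first by rewrite coordK.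
  move=> x y e Px Py e0 E; rewrite -[x]vecK; congr coords; apply: h => //.
  by exists (vec y), e; split=> //; apply/coord_beyond => t; rewrite !vecK.
rewrite coordK => Pv h; apply/is_vertexP; split=> // x Px [y [e [Py e0 /coord_beyond E]]].
by apply: (can_inj coordK); apply: (h _ (coords y) e); rewrite ?coordK.
Qed.

Lemma adjacent_coord u v :
  adjacent P u v <-> edge (fun f => P (vec f)) (coords u) (coords v).
Proof.
split=> [/adjacentP[/vertex_coord uV /vertex_coord vV uv h]|[uV vV uv h]].
  split=> //; first by move/(can_inj coordK).
  move=> x y e Px Py e0 E; have [|s hs] := h _ Px.
    exists (vec y), e; split=> //; apply/coord_beyond => t; rewrite !vecK -E /coords.
    by rewrite !mxE.
  by exists s => t; rewrite -[x]vecK hs /coords !mxE.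
apply/adjacentP; split; try exact/vertex_coord; first by move=> E; apply: uv; rewrite E.
move=> x Px [y [e [Py e0 /coord_beyond E]]].
have [||//|t|s hs] := h (coords x) (coords y) e; rewrite ?coordK //.
  by rewrite -E /coords !mxE.
exists s; apply/matrixP => i j; rewrite (ord1 j); have := hs (enum_val i).
by rewrite /coords enum_valK !mxE.
Qed.

End Coordinates.

(** * Products *)

Section Products.
Variables (R : realType) (I : eqType) (W : Type) (Q : I -> (W -> R) -> Prop).
Definition prodQ (f : I * W -> R) := forall l, Q l (fun w => f (l, w)).
Definition setblock (u : I * W -> R) (l : I) (p : W -> R) : I * W -> R :=
  fun iw => if iw.1 == l then p iw.2 else u iw.

Lemma setblock_same u l p : (fun w => setblock u l p (l, w)) = p.
Proof. by apply: funext => w; rewrite /setblock eqxx. Qed.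

Lemma setblock_other u l p l' : l' != l ->
  (fun w => setblock u l p (l', w)) = (fun w => u (l', w)).
Proof. by move=> h; apply: funext => w; rewrite /setblock (negbTE h). Qed.

Lemma prodQ_setblock u l p : prodQ u -> Q l p -> prodQ (setblock u l p).
Proof.
move=> Qu Qp l'; have [->|h] := eqVneq l' l; first by rewrite setblock_same.
by rewrite setblock_other.
Qed.

Lemma extremal_prod u : extremal prodQ u <-> forall l, extremal (Q l) (fun w => u (l, w)).
Proof.
split=> [[Qu h] l|h].
  split=> // x y e Qx Qy e0 E.
  rewrite -(setblock_same u l x).
  rewrite (h (setblock u l x) (setblock u l y) e) //; try exact: prodQ_setblock.
  by move=> [l' w]; rewrite /setblock /=; case: eqP => [->|_]; [exact: E | lra].
split=> [l|x y e Qx Qy e0 E]; first by have [] := h l.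
apply: funext => -[l w]; have [_ hl] := h l.
by apply: (congr1 (fun g => g w) (hl _ _ e (Qx l) (Qy l) e0 _)) => i; exact: E.
Qed.

(** The other blocks are extreme, hence constant on the smallest face through the midpoint. *)
Lemma edge_setblock u l p : (forall l, extremal (Q l) (fun w => u (l, w))) ->
  edge (Q l) (fun w => u (l, w)) p -> edge prodQ u (setblock u l p).
Proof.
move=> uV [ul pV up h]; split.
- exact/extremal_prod.
- apply/extremal_prod => l'; have [->|n] := eqVneq l' l; first by rewrite setblock_same.
  by rewrite setblock_other.
- by move=> E; apply: up; rewrite [in LHS]E setblock_same.
- move=> x y e Qx Qy e0 E.
  have [|s hs] := h _ _ e (Qx l) (Qy l) e0.
    by move=> w; rewrite -E /setblock /= eqxx.
  exists s => -[l' w]; rewrite /setblock /=; case: eqP => [->|/eqP n]; first exact: hs.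
  have [_ hl] := uV l'.
  have := hl _ _ e (Qx l') (Qy l') e0 (fun w => _).
  move=> /(_ _) /(congr1 (fun g => g w)) /= ->; first by lra.
  move=> w'; rewrite -E /setblock /= (negbTE n); lra.
Qed.

(** Exchanging block [l] between [u] and [v] keeps the midpoint, so the exchanged point is on the
    line through [u] and [v]. It agrees with [v] in block [l], where [u] and [v] differ; hence it is
    [v], and the other blocks of [u] and [v] coincide. *)
Lemma edge_prod u v : edge prodQ u v -> exists l,
  edge (Q l) (fun w => u (l, w)) (fun w => v (l, w)) /\
  forall l', l' != l -> forall w, u (l', w) = v (l', w).
Proof.
move=> [/extremal_prod uV /extremal_prod vV uv h].
have [l ul] : exists l, (fun w => u (l, w)) <> (fun w => v (l, w)).
  apply/existsNP => E; apply: uv; apply: funext => -[l w].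
  exact: (congr1 (fun g => g w) (E l)).
have Qu : prodQ u by move=> l'; have [] := uV l'.
have Qv : prodQ v by move=> l'; have [] := vV l'.
have same l' : l' != l -> forall w, u (l', w) = v (l', w).
  move=> n w0.
  have [|||iw|s hs] := h (setblock u l (fun w => v (l, w))) (setblock v l (fun w => u (l, w))) 1.
  - exact: prodQ_setblock.
  - exact: prodQ_setblock.
  - exact: ltr01.
  - by case: iw => l2 w2; rewrite /setblock /=; case: eqP => [->|_]; lra.
  have s1 : s = 1.
    have [w hw] : exists w, u (l, w) <> v (l, w).
      by apply/existsNP => E; apply: ul; apply: funext.
    have := hs (l, w); rewrite /setblock /= eqxx => E.
    have : (1 - s) * (v (l, w) - u (l, w)) = 0 by lra.
    move/eqP; rewrite mulf_eq0 !subr_eq0 => /orP[/eqP //|/eqP /esym //].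
  by have := hs (l', w0); rewrite /setblock /= (negbTE n) s1; lra.
exists l; split=> //; split=> // x y e Qx Qy e0 E.
have [||//|iw|s hs] := h (setblock u l x) (setblock u l y) e.
- exact: prodQ_setblock.
- exact: prodQ_setblock.
- by case: iw => l' w; rewrite /setblock /=; case: eqP => [->|/eqP /same <-]; [exact: E | lra].
by exists s => w; have := hs (l, w); rewrite /setblock /= eqxx.
Qed.

End Products.

(** * The polytope of a formula *)

Section Block.
Variables (R : realType) (W : eqType) (lam z : W).
Variable cls : seq (seq (bool * W)).
Hypothesis lamz : lam != z.
Hypothesis cls_var : forall c, c \in cls -> forall l, l \in c -> (l.2 != lam) && (l.2 != z).
Hypothesis cls_nil : cls != [::].
Implicit Types f p q u v : W -> R.

Definition lit_val f (l : bool * W) : R := if l.1 then f lam - f l.2 else f l.2.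
Definition cls_val f (c : seq (bool * W)) : R := \sum_(l <- c) lit_val f l.

(* A negative literal [(true, w)] has the value [f lam - f w]. *)
Definition blockQ f : Prop :=
  [/\ forall w, w != lam -> w != z -> 0 <= f w <= f lam,
      f z + f lam <= 1, - f z + f lam <= 1 &
      forall c, c \in cls -> f z <= cls_val f c /\ - f z <= cls_val f c].

Definition apex : W -> R := fun _ => 0.

Definition good f : Prop := f lam = 1 /\ forall c, c \in cls -> 0 < cls_val f c.

Lemma cls_val_ext f g c : (forall w, w != z -> f w = g w) ->
  c \in cls -> cls_val f c = cls_val g c.
Proof.
move=> fg cc; apply: eq_big_seq => l /(cls_var cc) /andP[_ lz].
by rewrite /lit_val !fg.
Qed.

Lemma cls_val_comb (a e : R) f g c :
  cls_val (fun w => a * f w + e * g w) c = a * cls_val f c + e * cls_val g c.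
Proof.
rewrite /cls_val !mulr_sumr -big_split; apply: eq_bigr => l _ /=.
by rewrite /lit_val; case: ifP => _; ring.
Qed.

Lemma cls_val_scale (a : R) f c : cls_val (fun w => a * f w) c = a * cls_val f c.
Proof.
have := cls_val_comb a 0 f f c; rewrite mul0r addr0 => <-.
by congr cls_val; apply: funext => w; rewrite mul0r addr0.
Qed.

Lemma blockQ_lam f : blockQ f -> f lam <= 1.
Proof. by move=> [_ h1 h2 _]; lra. Qed.

Lemma blockQ_apex : blockQ apex.
Proof.
split=> [w _ _|||c _]; rewrite /apex ?oppr0 ?addr0 ?lexx ?ler01 //.
by rewrite /cls_val big1 // => l _; rewrite /lit_val; case: ifP; rewrite ?subr0.
Qed.

(** * Vertices and edges of a single block *)

Section NonTrivial.
Variable w0 : W.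
Hypotheses (w0lam : w0 != lam) (w0z : w0 != z).

Lemma blockQ_lam_ge0 f : blockQ f -> 0 <= f lam.
Proof. by move=> [h _ _ _]; have := h _ w0lam w0z; lra. Qed.

(** The box constraints annihilate the variables, and any clause then annihilates [z]; [cls_nil]
    provides one. *)
Lemma blockQ_lam0 f : blockQ f -> f lam = 0 -> f = apex.
Proof.
move=> Qf f0; have [h h1 h2 hc] := Qf.
have hw w : w != z -> f w = 0.
  move=> wz; have [->//|wl] := eqVneq w lam; by have := h _ wl wz; rewrite f0; lra.
apply: funext => w; have [->|/hw //] := eqVneq w z.
case: cls cls_nil hc cls_val_ext => // c s _ hc ext.
have [] := hc c (mem_head _ _).
rewrite (@ext f apex) ?mem_head // /cls_val big1; first by rewrite /apex; lra.
by move=> l _; rewrite /lit_val; case: ifP; rewrite ?subr0.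
Qed.

Lemma blockQ_scale f (a : R) : blockQ f -> 0 <= a ->
  a * (f z + f lam) <= 1 -> a * (- f z + f lam) <= 1 -> blockQ (fun w => a * f w).
Proof.
move=> [h h1 h2 hc] a0 k1 k2; split; try lra.
  by move=> w wl wz; have := h _ wl wz; nra.
by move=> c cc; rewrite cls_val_scale; have := hc _ cc; nra.
Qed.

Lemma extremal_apex : extremal blockQ apex.
Proof.
split; first exact: blockQ_apex.
move=> x y e Qx Qy e0 E; apply: blockQ_lam0 => //.
have := E lam; rewrite /apex; have := blockQ_lam_ge0 Qx; have := blockQ_lam_ge0 Qy.
nra.
Qed.

(* Scaling towards and away from the apex stays in the block unless
   [|f z| + f lam = 1]. *)
Lemma extremal_norm f : extremal blockQ f -> f lam != 0 -> `|f z| + f lam = 1.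
Proof.
move=> [Qf h] f0; have [_ h1 h2 _] := Qf.
have l0 : 0 < f lam by rewrite lt_def f0 blockQ_lam_ge0.
have [//|lt1] := eqVneq (`|f z| + f lam) 1.
have zle : `|f z| + f lam < 1.
  by rewrite lt_neqAle lt1; case: (ger0P (f z)) => _; lra.
pose e := (1 - (`|f z| + f lam)) / 2.
have e0 : 0 < e by rewrite /e; lra.
have n1 := ler_norm (f z); have n2 := ler_norm (- f z); rewrite normrN in n2.
have a0 : 0 <= `|f z| by [].
have Qp : blockQ (fun w => (1 + e) * f w) by apply: blockQ_scale => //; rewrite /e; nra.
have Qm : blockQ (fun w => (1 - e) * f w) by apply: blockQ_scale => //; rewrite /e; nra.
have /(congr1 (fun g => g lam)) : (fun w => (1 + e) * f w) = f.
  by apply: (h _ _ 1 Qp Qm ltr01) => i; lra.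
nra.
Qed.

(** The point [f + t x] is projected radially from the apex to [|z| + lam = 1]. The bound on [t]
    preserves the sign of the [z]-coordinate, so the norm of the sum is the affine expression
    [nrm]. *)
Lemma blockQ_mix f (sg t : R) : blockQ f -> `|sg| = 1 -> sg * f z = `|f z| ->
  `|f z| + f lam = 1 -> 0 < t -> t <= `|f z| / 2 -> forall x, blockQ x ->
  let nrm := 1 + t * (sg * x z + x lam) in
  0 < nrm /\ blockQ (fun w => nrm^-1 * (f w + t * x w)).
Proof.
move=> Qf sg1 sgz nz t0 tle x Qx nrm.
have xle1 := blockQ_lam Qx; have xge0 := blockQ_lam_ge0 Qx.
have fge0 := blockQ_lam_ge0 Qf.
have [h h1 h2 hc] := Qf; have [hx hx1 hx2 hxc] := Qx.
have : `|sg * x z| <= 1 - x lam by rewrite normrM sg1 mul1r ler_norml; lra.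
rewrite ler_norml => /andP[xz1 xz2].
have nrm0 : 0 < nrm by rewrite /nrm; nra.
split=> //; have ni : 0 < nrm^-1 by rewrite invr_gt0.
pose mz := f z + t * x z.
have zz : 0 <= sg * mz by rewrite /mz mulrDr sgz; nra.
have zabs : `|mz| <= sg * mz by rewrite -[X in X <= _]mul1r -sg1 -normrM ger0_norm.
have za := ler_norm mz; have zb := ler_norm (- mz); rewrite normrN in zb.
have nE : nrm = sg * mz + (f lam + t * x lam) by rewrite /nrm /mz; lra.
split.
- move=> w wl wz; have := h _ wl wz; have := hx _ wl wz => k1 k2.
  by rewrite pmulr_rge0 // ler_pM2l //; apply/andP; split; nra.
- by rewrite -mulrDr mulrC ler_pdivrMr // mul1r -/mz nE; lra.
- by rewrite -mulrN -mulrDr mulrC ler_pdivrMr // mul1r -/mz nE; lra.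
- move=> c cc; rewrite -mulrN cls_val_scale !ler_pM2l //.
  have := cls_val_comb 1 t f x c; rewrite mul1r.
  have -> : (fun w => 1 * f w + t * x w) = (fun w => f w + t * x w).
    by apply: funext => w; rewrite mul1r.
  by move=> ->; have := hc _ cc; have := hxc _ cc; nra.
Qed.

(** Let the midpoint of [f] and the apex be a weighted mean of [x] and [y]. Mixing both with [f] and
    projecting radially yields two points of the block with weighted mean [f]. As [f] is extreme,
    both are [f], so [x] lies on the line through [f] and the apex. *)
Lemma extremal_lt1_edge f : extremal blockQ f -> f lam != 0 -> f lam < 1 ->
  edge blockQ f apex.
Proof.
move=> fV f0 f1; have [Qf hf] := fV; split=> //; first exact: extremal_apex.
  by move/(congr1 (fun g => g lam)) => /eqP; rewrite (negbTE f0).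
have nz := extremal_norm fV f0.
have znz : 0 < `|f z| by lra.
move=> x y e Qx Qy e0 E.
pose sg : R := Num.sg (f z).
have sgz : sg * f z = `|f z| by rewrite /sg -normrEsg.
have sg1 : `|sg| = 1 by rewrite /sg normr_sg -normr_gt0 znz.
pose t : R := `|f z| / 2.
have t0 : 0 < t by rewrite /t; lra.
have [nx0 Qx'] := blockQ_mix Qf sg1 sgz nz t0 (lexx _) Qx.
have [ny0 Qy'] := blockQ_mix Qf sg1 sgz nz t0 (lexx _) Qy.
move: nx0 Qx' ny0 Qy'; set nx := 1 + _; set ny := 1 + _ => nx0 Qx' ny0 Qy'.
have Ef w : f w = 2 / (1 + e) * (y w + e * x w).
  by rewrite -E /apex; field; lra.
have xf : (fun w => nx^-1 * (f w + t * x w)) = f.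
  apply: (hf _ _ (e * nx / ny) Qx' Qy'); first by rewrite divr_gt0 ?mulr_gt0.
  (* The weights are 1 and [e * nx / ny]; the sum is known because the norm is affine and equals 1/2
     at the midpoint. *)
  have nn : ny + e * nx = (1 + e) * (1 + t / 2).
    have -> : ny + e * nx = 1 + e + t * (sg * (y z + e * x z) + (y lam + e * x lam)).
      by rewrite /nx /ny; ring.
    have := E z; have := E lam; rewrite /apex !addr0 => <- <-.
    have -> : f lam = 1 - sg * f z by rewrite sgz; lra.
    by field.
  move=> w.
  have -> : ny^-1 * (f w + t * y w) + e * nx / ny * (nx^-1 * (f w + t * x w)) =
            ny^-1 * ((1 + e) * f w + t * (y w + e * x w)).
    by field; rewrite !gt_eqF.
  have -> : y w + e * x w = (1 + e) * (f w / 2) by rewrite Ef; field; lra.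
  have -> : 1 + e * nx / ny = ny^-1 * (ny + e * nx) by field; rewrite gt_eqF.
  by rewrite nn; field; rewrite gt_eqF.
exists (1 - (nx - 1) / t) => w.
have := congr1 (fun g => g w) xf => /= xw.
have : f w + t * x w = nx * f w by rewrite -[in RHS]xw mulrA mulfV ?gt_eqF // mul1r.
move=> h; have -> : x w = (nx * f w - f w) / t by rewrite -h; field; rewrite gt_eqF.
by rewrite /apex; field; rewrite gt_eqF.
Qed.

(* The vertices with [f lam = 1] are the 0-1 assignments. *)
Lemma extremal_lam1 f : extremal blockQ f -> f lam = 1 ->
  f z = 0 /\ forall w, w != z -> f w = 0 \/ f w = 1.
Proof.
move=> fV f1; have [Qf hf] := fV; have [h h1 h2 hc] := Qf.
have fz : f z = 0 by lra.
split=> // w wz; have [->|wl] := eqVneq w lam; first by right.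
have [?|n0] := eqVneq (f w) 0; first by left.
have [?|n1] := eqVneq (f w) 1; first by right.
have /andP[w0' w1'] := h _ wl wz; rewrite f1 in w1'.
have w_gt0 : 0 < f w by rewrite lt_def n0.
have w_lt1 : f w < 1 by rewrite lt_neqAle n1.
pose e : R := Num.min (f w) (1 - f w).
have e0 : 0 < e by rewrite lt_min w_gt0 subr_gt0 w_lt1.
have [e1 e2] : e <= f w /\ e <= 1 - f w by rewrite !ge_min !lexx orbT.
pose dd (s : R) := fun w' => if w' == w then s * e else 0.
have Qd s : `|s| = 1 -> blockQ (fun i => f i + dd s i).
  move=> s1.
  have /andP[s2 s3] : - e <= s * e <= e.
    by rewrite -ler_norml normrM s1 mul1r gtr0_norm.
  have dl : dd s lam = 0 by rewrite /dd eq_sym (negbTE wl).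
  have dz : dd s z = 0 by rewrite /dd eq_sym (negbTE wz).
  have Qlit w' : w' != lam -> w' != z -> 0 <= f w' + dd s w' <= f lam.
    move=> l' z'; rewrite /dd; case: eqP => [->|_]; first by rewrite f1; lra.
    by rewrite addr0 h.
  split; rewrite ?dl ?dz ?addr0 // => c cc; rewrite fz oppr0.
  suff : 0 <= cls_val (fun i => f i + dd s i) c by [].
  rewrite /cls_val big_seq; apply: sumr_ge0 => l lc.
  have /andP[l1 l2] := cls_var cc lc; have := Qlit _ l1 l2.
  by rewrite /lit_val dl; case: ifP => _; lra.
have n1' : `|-1 : R| = 1 by rewrite normrN1.
have := extremal_shift fV (Qd 1 (normr1 _)).
have -> : (fun i => f i - dd 1 i) = (fun i => f i + dd (-1) i).
  by apply: funext => i; rewrite /dd; case: ifP => _; lra.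
by move=> /(_ (Qd _ n1') w); rewrite /dd eqxx; lra.
Qed.

Lemma cls_val_prop f x c : f lam = 1 -> (forall w, w != z -> x w = x lam * f w) ->
  c \in cls -> cls_val x c = x lam * cls_val f c.
Proof. by move=> f1 E cc; rewrite -cls_val_scale; apply: cls_val_ext. Qed.

(* Constraints tight at an assignment [f] are tight on its whole minimal face. *)
Lemma segment_prop f (a e : R) x y : (forall w, w != z -> f w = 0 \/ f w = 1) -> f lam = 1 ->
  blockQ x -> blockQ y -> 0 < e ->
  (forall w, w != z -> a * f w = y w + e * x w) ->
  forall w, w != z -> x w = x lam * f w.
Proof.
move=> f01 f1 Qx Qy e0 E w wz; have [->|wl] := eqVneq w lam; first by rewrite f1 mulr1.
have [hx _ _ _] := Qx; have [hy _ _ _] := Qy.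
have := hx _ wl wz; have := hy _ wl wz; have := E _ wz; have := E _ lamz; rewrite f1.
by case: (f01 _ wz) => ->; nra.
Qed.

(** On the smallest face through the midpoint everything off [z] is a multiple of [f], so the value
    of [c] is nonpositive there and forces [z = 0]; only the scaling remains free. *)
Lemma unsat_edge f c : extremal blockQ f -> f lam = 1 -> c \in cls -> cls_val f c <= 0 ->
  edge blockQ f apex.
Proof.
move=> fV f1 cc c0; have [fz f01] := extremal_lam1 fV f1; split=> //.
- exact: extremal_apex.
- by move/(congr1 (fun g => g lam)); rewrite f1 /apex => /eqP; rewrite oner_eq0.
move=> x y e Qx Qy e0 E.
have xE : forall w, w != z -> x w = x lam * f w.
  apply: (@segment_prop f ((1 + e) / 2) e _ y) => // w _.
  by rewrite -E /apex; lra.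
have [_ _ _ hc] := Qx.
have xz : x z = 0.
  by have := hc _ cc; rewrite (cls_val_prop f1 xE cc); have := blockQ_lam_ge0 Qx; nra.
exists (1 - x lam) => w; rewrite /apex.
by have [->|wz] := eqVneq w z; [rewrite xz fz; lra | rewrite xE //; lra].
Qed.

(** For [f z = 0] this is [f] with [z] raised by [s], rescaled to [z + lam = 1]. When [s] is the
    least clause value of [f], the corresponding clause becomes tight. *)
Definition roof f (s : R) : W -> R :=
  fun w => if w == z then s / (1 + s) else f w / (1 + s).

(** From [f] to the roof point, [z + lam] stays 1 and everything off [z] stays proportional to [f],
    which leaves one dimension. The roof point has [lam < 1], so [extremal_lt1_edge] supplies the
    second edge. *)
Lemma good_path f : extremal blockQ f -> good f ->
  exists2 g, edge blockQ f g & edge blockQ g apex.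
Proof.
move=> fV [f1 hpos]; have [Qf hf] := fV; have [fz f01] := extremal_lam1 fV f1.
have [h h1 h2 hc] := Qf.
have [s s0 [sle [c0 c0c sc0]]] : exists2 s, 0 < s &
    (forall c, c \in cls -> s <= cls_val f c) /\ exists2 c, c \in cls & s = cls_val f c.
  move: (cls_nil) hpos; elim: (cls) => [//|c t IH] _ hpos.
  have [->|tn] := eqVneq t [::].
    exists (cls_val f c); first by apply: hpos; rewrite mem_head.
    by split=> [c'|]; [rewrite inE => /eqP -> | exists c; rewrite ?mem_head].
  have [|s s0 [sle [c0 c0t sc0]]] := IH tn; first by move=> c' h'; apply: hpos; rewrite inE h' orbT.
  have c1 : 0 < cls_val f c by apply: hpos; rewrite mem_head.
  have [le|lt] := lerP s (cls_val f c).
    exists s => //; split; first by move=> c'; rewrite inE => /orP[/eqP ->//|/sle].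
    by exists c0; rewrite // inE c0t orbT.
  exists (cls_val f c) => //; split; last by exists c; rewrite ?mem_head.
  by move=> c'; rewrite inE => /orP[/eqP ->//|/sle]; apply: le_trans; apply: ltW.
have s1 : 0 < 1 + s by lra.
have i0 : 0 < (1 + s)^-1 by rewrite invr_gt0.
pose g := roof f s.
have gE w : w != z -> g w = f w / (1 + s) by rewrite /g /roof => /negbTE ->.
have gz : g z = s / (1 + s) by rewrite /g /roof eqxx.
have gl : g lam = (1 + s)^-1 by rewrite gE // f1 mul1r.
have gc c : c \in cls -> cls_val g c = (1 + s)^-1 * cls_val f c.
  by move=> cc; rewrite -cls_val_scale; apply: cls_val_ext => // w /gE ->; rewrite mulrC.
have gsum : g z + g lam = 1 by rewrite gz gl; field; rewrite gt_eqF.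
have Qg : blockQ g.
  split.
  - move=> w wl wz; rewrite gE // gl; have := h _ wl wz; rewrite f1 => /andP[k1 k2].
    by rewrite divr_ge0 ?(ltW s1) //= ler_pdivrMr // mulVf ?gt_eqF.
  - by rewrite gsum.
  - have : 0 < g z by rewrite gz divr_gt0.
    by lra.
  - move=> c cc; rewrite gc // gz mulrC -mulrN !ler_pM2l //.
    by have := sle _ cc; lra.
have gmul w : w != z -> f w = (1 + s) * g w.
  by move=> wz; rewrite gE //; field; rewrite gt_eqF.
have tightz x y (a e : R) : blockQ x -> blockQ y -> 0 < e ->
    a = y z + y lam + e * (x z + x lam) -> a = 1 + e -> x z + x lam = 1.
  by move=> [_ ? _ _] [_ ? _ _] e0; nra.
(* Off [z] both points are multiples of [f]; the tight clause [c0] fixes the ratio of [z] to [lam],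
   and [z + lam = 1] fixes the scale. *)
have gV : extremal blockQ g.
  split=> // x y e Qx Qy e0 E.
  have xE : forall w, w != z -> x w = x lam * f w.
    by apply: (@segment_prop f ((1 + e) / (1 + s)) e _ y) => // w wz; rewrite -E gE //; ring.
  have yE : forall w, w != z -> y w = y lam * f w.
    apply: (@segment_prop f ((1 + e) / (1 + s) / e) e^-1 _ x) => //; first by rewrite invr_gt0.
    move=> w wz; have := E w; rewrite gE // => E'.
    have -> : y w = (1 + e) * (f w / (1 + s)) - e * x w by rewrite E'; ring.
    by field; rewrite !gt_eqF.
  have xs : x z + x lam = 1.
    by apply: (tightz x y (1 + e) e) => //; have := E z; have := E lam; have := gsum; nra.
  have [_ _ _ hxc] := Qx; have [_ _ _ hyc] := Qy.
  have [k1 _] := hxc _ c0c; have [k2 _] := hyc _ c0c.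
  rewrite (cls_val_prop f1 xE c0c) -sc0 in k1; rewrite (cls_val_prop f1 yE c0c) -sc0 in k2.
  have xlz : x z = x lam * s.
    have := E z; have := E lam; rewrite gz gl => El Ez.
    have : (1 + e) * (s / (1 + s)) = s * ((1 + e) * (1 + s)^-1) by ring.
    by rewrite Ez El; nra.
  have xl : x lam = (1 + s)^-1.
    by apply: (mulIf (lt0r_neq0 s1)); rewrite mulVf ?gt_eqF //; lra.
  apply: funext => w; have [->|wz] := eqVneq w z; first by rewrite xlz gz xl mulrC.
  by rewrite xE // xl gE // mulrC.
have gl0 : g lam != 0 by rewrite gl gt_eqF.
have gl1 : g lam < 1 by rewrite gl invf_lt1; lra.
exists g; last exact: extremal_lt1_edge.
split=> //.
  by move/(congr1 (fun k => k z)); rewrite fz gz => /esym /eqP; rewrite gt_eqF // divr_gt0.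
move=> x y e Qx Qy e0 E.
have xE : forall w, w != z -> x w = x lam * f w.
  apply: (@segment_prop f ((1 + e) * (2^-1 * (1 + (1 + s)^-1))) e _ y) => // w wz.
  by rewrite -E gE //; ring.
have xs : x z + x lam = 1.
  apply: (tightz x y (1 + e) e) => //; have := E z; have := E lam; have := gsum.
  by rewrite fz f1; nra.
exists ((1 - x lam) * (1 + s) / s) => w.
have sn : s != 0 by rewrite gt_eqF.
have s1n : 1 + s != 0 by rewrite gt_eqF.
have [->|wz] := eqVneq w z.
  rewrite gz fz; have -> : x z = 1 - x lam by lra.
  by field; rewrite sn s1n.
by rewrite xE // gE //; field; rewrite sn s1n.
Qed.

(** At the midpoint of [f] and the apex [lam] is 1/2 and all clause values are positive, so [z] can
    move both ways, transversally to the segment. *)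
Lemma good_not_edge f : good f -> ~ edge blockQ f apex.
Proof.
move=> [f1 hpos] fe; have [fV _ _ _] := fe.
have [fz f01] := extremal_lam1 fV f1; have [Qf _] := fV; have [h h1 h2 hc] := Qf.
have [c cc|e' e'0 e'le] := @exists_pos_le R _ cls (cls_val f); first exact: hpos.
pose e : R := Num.min (e' / 2) (2^-1).
have e0 : 0 < e by rewrite lt_min; apply/andP; split; lra.
have [e1 e2] : e <= e' / 2 /\ e <= 2^-1 by rewrite !ge_min !lexx orbT.
pose dd (s : R) := fun w' => if w' == z then s * e else 0.
have Qd s : `|s| = 1 -> blockQ (fun i => 2^-1 * (f i + apex i) + dd s i).
  move=> s1.
  have /andP[s2 s3] : - e <= s * e <= e.
    by rewrite -ler_norml normrM s1 mul1r gtr0_norm.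
  have E w : w != z -> 2^-1 * (f w + apex w) + dd s w = 2^-1 * f w.
    by move=> wz; rewrite /dd (negbTE wz) /apex; lra.
  have Ez : 2^-1 * (f z + apex z) + dd s z = s * e by rewrite /dd eqxx fz /apex; lra.
  split; rewrite ?Ez ?E ?f1 //; try lra.
    by move=> w wl wz; rewrite !E // ; have := h _ wl wz; lra.
  move=> c cc; rewrite (@cls_val_ext _ (fun w => 2^-1 * f w)) // cls_val_scale.
  by have := e'le _ cc; lra.
have n1' : `|-1 : R| = 1 by rewrite normrN1.
have := edge_shift fe (Qd 1 (normr1 _)).
have -> : (fun i => 2^-1 * (f i + apex i) - dd 1 i) =
  (fun i => 2^-1 * (f i + apex i) + dd (-1) i).
  by apply: funext => i; rewrite /dd; case: ifP => _; lra.
move=> /(_ (Qd _ n1')) [s /(_ z)]; rewrite /dd eqxx fz /apex; lra.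
Qed.

Definition assign (a : W -> bool) : W -> R :=
  fun w => if w == z then 0 else if w == lam then 1 else (a w)%:R.

Lemma lit_val_assign a l : l.2 != lam -> l.2 != z ->
  lit_val (assign a) l = (l.1 != a l.2)%:R.
Proof.
move=> l1 l2; rewrite /lit_val /assign (negbTE l1) (negbTE l2) (negbTE lamz) eqxx.
by case: (l.1); case: (a _) => /=; lra.
Qed.

Lemma extremal_assign a : extremal blockQ (assign a).
Proof.
have fz : assign a z = 0 by rewrite /assign eqxx.
have f1 : assign a lam = 1 by rewrite /assign (negbTE lamz) eqxx.
have f01 w : w != z -> assign a w = 0 \/ assign a w = 1.
  move=> wz; rewrite /assign (negbTE wz); case: ifP => _; first by right.
  by case: (a w); [right | left].
split.
  split; rewrite ?fz ?f1; try lra.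
    by move=> w _ /f01 [] ->; rewrite lexx ler01.
  move=> c cc; rewrite oppr0; suff : 0 <= cls_val (assign a) c by [].
  rewrite /cls_val big_seq; apply: sumr_ge0 => l lc.
  by have /andP[l1 l2] := cls_var cc lc; rewrite lit_val_assign.
move=> x y e Qx Qy e0 E.
have xE : forall w, w != z -> x w = x lam * assign a w.
  by apply: (@segment_prop _ (1 + e) e _ y) => // w wz; rewrite -E.
have xl : x lam = 1.
  by have := E lam; have := blockQ_lam Qx; have := blockQ_lam Qy; rewrite f1; nra.
have xz : x z = 0 by have [_ ? ? _] := Qx; lra.
apply: funext => w; have [->|wz] := eqVneq w z; first by rewrite xz fz.
by rewrite xE // xl mul1r.
Qed.

Lemma good_assign a : (forall c, c \in cls -> has (fun l => l.1 != a l.2) c) ->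
  good (assign a).
Proof.
move=> h; split; first by rewrite /assign (negbTE lamz) eqxx.
move=> c cc; have /hasP[l lc la] := h _ cc.
rewrite /cls_val (big_rem l) //=.
have /andP[l1 l2] := cls_var cc lc.
rewrite lit_val_assign // la ltr_pwDl ?ltr01 // big_seq; apply: sumr_ge0 => k kc.
have /andP[k1 k2] := cls_var cc (mem_rem kc).
by rewrite lit_val_assign.
Qed.

Lemma good_sat f : extremal blockQ f -> good f ->
  forall c, c \in cls -> has (fun l => l.1 != (0 < f l.2)) c.
Proof.
move=> fV [f1 hp] c cc; have [fz f01] := extremal_lam1 fV f1.
apply/negPn/negP => /hasPn hn; have := hp _ cc.
suff -> : cls_val f c = 0 by rewrite ltxx.
apply: big1_seq => l /= lc; have /andP[l1 l2] := cls_var cc lc.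
have := hn _ lc; rewrite negbK => /eqP; rewrite /lit_val => ->.
by case: (f01 _ l2) => ->; rewrite ?ltxx ?ltr01 ?f1 ?subrr.
Qed.

(** * A potential bounding distances from below *)

Section Potential.
Variable dm : 'I_4 -> W.
Hypothesis dm_inj : injective dm.
Hypothesis dm_lam : forall j, dm j != lam.
Hypothesis dm_z : forall j, dm j != z.
Hypothesis dm_cls : forall c, c \in cls -> forall l, l \in c -> forall j, l.2 != dm j.

Definition dcount f : nat := #|[pred j | f (dm j) == f lam]|.

(** Changes by at most 1 along each edge: the apex has 2, and the vertices that may be adjacent to
    it are clamped to the range from 1 to 3. Good vertices are not adjacent to the apex and keep the
    full range from 0 to 4. *)
Definition psi f : nat :=
  if f lam == 0 then 2%N else if `[< good f >] then dcount f
  else minn 3 (maxn 1 (dcount f)).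

Lemma blockQ_shift_dm p (s e : R) j : blockQ p -> 0 <= p (dm j) + s * e ->
  p (dm j) + s * e <= p lam ->
  blockQ (fun i => p i + (if i == dm j then s * e else 0)).
Proof.
move=> [h h1 h2 hc] k1 k2; have ql : (lam == dm j) = false by rewrite eq_sym (negbTE (dm_lam j)).
have qz : (z == dm j) = false by rewrite eq_sym (negbTE (dm_z j)).
split; rewrite ?ql ?qz ?addr0 //.
  move=> w wl wz; case: eqP => [->|_]; first by rewrite k1 k2.
  by rewrite addr0 h.
move=> c cc; suff -> : cls_val (fun i => p i + (if i == dm j then s * e else 0)) c = cls_val p c.
  exact: hc.
apply: eq_big_seq => l lc; rewrite /lit_val ql addr0 (negbTE (dm_cls cc lc j)) addr0.
by [].
Qed.

Lemma extremal_dm p j : extremal blockQ p -> p (dm j) = 0 \/ p (dm j) = p lam.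
Proof.
move=> pV; have [Qp _] := pV; have [h _ _ _] := Qp.
have /andP[k1 k2] := h _ (dm_lam j) (dm_z j).
have [?|n0] := eqVneq (p (dm j)) 0; first by left.
have [?|n1] := eqVneq (p (dm j)) (p lam); first by right.
have w0' : 0 < p (dm j) by rewrite lt_def n0.
have w1' : p (dm j) < p lam by rewrite lt_neqAle n1.
pose e : R := Num.min (p (dm j)) (p lam - p (dm j)).
have e0 : 0 < e by rewrite lt_min w0' subr_gt0 w1'.
have [e1 e2] : e <= p (dm j) /\ e <= p lam - p (dm j) by rewrite !ge_min !lexx orbT.
have Qa : blockQ (fun i => p i + (if i == dm j then 1 * e else 0)).
  by apply: blockQ_shift_dm => //; lra.
have Qb : blockQ (fun i => p i + (if i == dm j then -1 * e else 0)).
  by apply: blockQ_shift_dm => //; lra.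
have := extremal_shift pV Qa.
have -> : (fun i => p i - (if i == dm j then 1 * e else 0)) =
  (fun i => p i + (if i == dm j then -1 * e else 0)).
  by apply: funext => i; case: ifP => _; lra.
by move=> /(_ Qb (dm j)); rewrite eqxx; lra.
Qed.

(** At the midpoint of an edge that changes the status of dummy [j], this dummy is strictly between
    its bounds and can move alone. Hence the edge is parallel to that coordinate, and neither [lam]
    nor another dummy changes. *)
Lemma edge_dm p q j k : edge blockQ p q -> p lam != 0 -> q lam != 0 -> j != k ->
  (p (dm j) == p lam) != (q (dm j) == q lam) ->
  (p (dm k) == p lam) = (q (dm k) == q lam).
Proof.
move=> pq pl ql jk nj; have [pV qV _ _] := pq.
have [Qp _] := pV; have [Qq _] := qV.
have pl0 : 0 < p lam by rewrite lt_def pl blockQ_lam_ge0.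
have ql0 : 0 < q lam by rewrite lt_def ql blockQ_lam_ge0.
pose m := fun i => 2^-1 * (p i + q i).
have Qm : blockQ m.
  have [h h1 h2 hc] := Qp; have [h' h1' h2' hc'] := Qq; split; rewrite /m; try lra.
    by move=> w wl wz; have := h _ wl wz; have := h' _ wl wz; lra.
  move=> c cc; have -> : (fun i => 2^-1 * (p i + q i)) = (fun i => 2^-1 * p i + 2^-1 * q i).
    by apply: funext => i; lra.
  by rewrite cls_val_comb; have := hc _ cc; have := hc' _ cc; lra.
have [m1 m2] : 0 < m (dm j) /\ m (dm j) < m lam.
  move: nj; rewrite /m; case: (extremal_dm j pV) => ->; case: (extremal_dm j qV) => ->;
    rewrite ?eqxx ?(eq_sym 0) ?(negbTE pl) ?(negbTE ql) //= => _; lra.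
pose e : R := Num.min (m (dm j)) (m lam - m (dm j)).
have e0 : 0 < e by rewrite lt_min m1 subr_gt0 m2.
have [e1 e2] : e <= m (dm j) /\ e <= m lam - m (dm j) by rewrite !ge_min !lexx orbT.
have Qa : blockQ (fun i => m i + (if i == dm j then 1 * e else 0)).
  by apply: blockQ_shift_dm => //; lra.
have Qb : blockQ (fun i => m i + (if i == dm j then -1 * e else 0)).
  by apply: blockQ_shift_dm => //; lra.
have := edge_shift pq Qa.
have -> : (fun i => 2^-1 * (p i + q i) - (if i == dm j then 1 * e else 0)) =
  (fun i => m i + (if i == dm j then -1 * e else 0)).
  by apply: funext => i; rewrite /m; case: ifP => _; lra.
move=> /(_ Qb) [s hs].
have /eqP := hs (dm k); rewrite (inj_eq dm_inj) (eq_sym k) (negbTE jk) eq_sym mulf_eq0.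
have s0 : s != 0.
  by apply/eqP => s0; have := hs (dm j); rewrite eqxx s0; lra.
have lk := hs lam; rewrite eq_sym (negbTE (dm_lam j)) in lk.
move/esym/eqP: lk; rewrite mulf_eq0 !(negbTE s0) /= !subr_eq0.
by move=> /eqP -> /eqP ->.
Qed.

Lemma dcount_edge p q : edge blockQ p q -> p lam != 0 -> q lam != 0 ->
  (dcount q <= (dcount p).+1)%N.
Proof.
move=> pq pl ql; rewrite /dcount.
have [E|] := boolP [forall j, (p (dm j) == p lam) == (q (dm j) == q lam)].
  apply: leqW; apply: subset_leq_card; apply/fintype.subsetP => j; rewrite !inE.
  by have /eqP -> := forallP E j.
rewrite negb_forall => /existsP [j nj].
have same k : k != j -> (p (dm k) == p lam) = (q (dm k) == q lam).
  by move=> kj; apply: (edge_dm pq pl ql _ nj); rewrite eq_sym.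
have := cardUI [pred k | p (dm k) == p lam] (pred1 j); rewrite card1 addn1 => <-.
apply: leq_trans (leq_addr _ _); apply: subset_leq_card; apply/fintype.subsetP => k.
rewrite !inE; have [//|kj] := eqVneq k j; first by rewrite orbT.
by rewrite same // => ->.
Qed.

Lemma psi_edge p q : edge blockQ p q -> (psi q <= (psi p).+1)%N.
Proof.
move=> pq; rewrite /psi.
have [q0|q0] := eqVneq (q lam) 0.
  have [p0|p0] := eqVneq (p lam) 0 => //.
  have [Qq _] : extremal blockQ q by case: pq.
  case: asboolP => [gp|_]; last by lia.
  by case: (good_not_edge gp); rewrite -(blockQ_lam0 Qq q0).
have [p0|p0] := eqVneq (p lam) 0.
  have [Qp _] : extremal blockQ p by case: pq.
  case: asboolP => [gq|_]; last by lia.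
  by case: (good_not_edge gq); rewrite -(blockQ_lam0 Qp p0); exact: edge_sym.
have h1 := dcount_edge pq p0 q0; have h2 := dcount_edge (edge_sym pq) q0 p0.
have b f : (dcount f <= 4)%N by rewrite /dcount (leq_trans (max_card _)) ?card_ord.
have bp := b p; have bq := b q.
by case: asboolP => _; case: asboolP => _; lia.
Qed.

Lemma psi_assign (a : W -> bool) (v : bool) : (forall j, a (dm j) = v) ->
  dcount (assign a) = if v then 4%N else 0%N.
Proof.
move=> av; rewrite /dcount.
have E j : (assign a (dm j) == assign a lam) = v.
  rewrite /assign (negbTE (dm_z j)) (negbTE (dm_lam j)) (negbTE lamz) eqxx av.
  by case: (v); rewrite ?eqxx // eq_sym oner_eq0.
rewrite (eq_card (_ : _ =i [pred _ : 'I_4 | v])); last by move=> j; rewrite !inE E.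
by case: (v); rewrite ?card0 // (eq_card (_ : _ =i 'I_4)) ?card_ord.
Qed.

End Potential.
End NonTrivial.
End Block.

(** * Distances in products of blocks *)

Section Walks.
Variables (R : realType) (d : nat) (P : set 'cV[R]_d).
Implicit Types u v w : 'cV[R]_d.

Lemma walk_cat n m u v w : walk P n u v -> walk P m v w -> walk P (n + m) u w.
Proof.
elim: n u => [|n IH] u /=; first by move->.
by move=> [x [ux xv]] vw; exists x; split=> //; apply: IH.
Qed.

Lemma adjacent_sym u v : adjacent P u v -> adjacent P v u.
Proof.
move=> [hu hv uv [F [h1 h2 h3 h4]]]; split=> //; first by move/esym.
by exists F.
Qed.

Lemma walk_rev n u v : walk P n u v -> walk P n v u.
Proof.
elim: n u => [|n IH] u /=; first by move->.
move=> [x [ux /IH xv]]; have := @walk_cat n 1 v x u xv; rewrite addn1; apply=> /=.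
by exists u; split=> //; apply: adjacent_sym.
Qed.

Lemma skeleton_dist_le n u v : walk P n u v -> (skeleton_dist P u v <= n)%N.
Proof.
move=> w; rewrite /skeleton_dist; case: xgetP => [k -> [_ h]|_ //]; exact: h.
Qed.

(** A walk has to be supplied because [skeleton_dist] is 0 by default. *)
Lemma skeleton_dist_ge m n u v : walk P n u v ->
  (forall k, walk P k u v -> (m <= k)%N) -> (m <= skeleton_dist P u v)%N.
Proof.
move=> w h; rewrite /skeleton_dist; case: xgetP => [k -> [/h //]|no].
have ex : exists k, `[< walk P k u v >] by exists n; apply/asboolP.
case: (ex_minnP ex) => k /asboolP wk kmin; case: (no k); split=> // j wj.
by apply: kmin; apply/asboolP.
Qed.

End Walks.

Definition prod_ft (I W : finType) : finType := (I * W)%type.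

Section BlockProduct.
Variables (R : realType) (I W : finType) (lam z w0 : W) (dm : 'I_4 -> W).
Variable cls : I -> seq (seq (bool * W)).
Local Notation IW := (prod_ft I W).
Local Notation vecIW := (@vec R IW).
Local Notation coordIW := (@coords R IW).
Hypotheses (lamz : lam != z) (w0lam : w0 != lam) (w0z : w0 != z).
Hypothesis cls_var : forall l c, c \in cls l -> forall k, k \in c -> (k.2 != lam) && (k.2 != z).
Hypothesis cls_nil : forall l, cls l != [::].
Hypothesis dm_inj : injective dm.
Hypothesis dm_lam : forall j, dm j != lam.
Hypothesis dm_z : forall j, dm j != z.
Hypothesis dm_cls : forall l c, c \in cls l -> forall k, k \in c -> forall j, k.2 != dm j.

Local Notation Q l := (@blockQ R W lam z (cls l)).
Variables (m : nat) (A : 'M[R]_(m, #|IW|)) (b : 'cV[R]_m).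
Local Notation P := (polyhedron A b).
Hypothesis PE : forall f, P (vecIW f) <-> prodQ (fun l => Q l) f.

Let setPE : (fun f => P (vecIW f)) = prodQ (fun l => Q l).
Proof. by apply: funext => f; apply: propext. Qed.

Definition block (u : 'cV[R]_#|IW|) (l : I) : W -> R := fun w => coordIW u (l, w).

Lemma vertex_blocks u : is_vertex P u <-> forall l, extremal (Q l) (block u l).
Proof. by rewrite vertex_coord setPE extremal_prod. Qed.

Lemma adjacent_block u l p : (forall l, extremal (Q l) (block u l)) ->
  edge (Q l) (block u l) p -> adjacent P u (vecIW (setblock (coordIW u) l p)).
Proof. by move=> uV h; apply/adjacent_coord; rewrite setPE vecK; apply: edge_setblock. Qed.

Lemma walk_to_apex u : is_vertex P u -> exists2 n,
  (n <= \sum_l (1 + `[< good lam (cls l) (block u l) >]))%N & walk P n u 0.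
Proof.
move=> uV.
(* Blocks are moved to the apex one at a time; [s] lists those still to be moved and [u'] is the
   current vertex. *)
suff H (s : seq I) u' : uniq s -> is_vertex P u' ->
    (forall l, l \notin s -> block u' l = @apex R W) ->
    (forall l, l \in s -> block u' l = block u l) -> exists2 n,
    (n <= \sum_(l <- s) (1 + `[< good lam (cls l) (block u l) >]))%N & walk P n u' 0.
  have [||n hn wn] := H (enum I) u (enum_uniq _) uV.
  - by move=> l; rewrite mem_enum.
  - by [].
  by exists n; rewrite // -big_enum.
elim: s u' => [|l s IH] u' /=.
  move=> _ _ h _; exists 0%N; rewrite ?big_nil //=.
  apply: (can_inj (@coordK R IW)); apply: funext => -[l w].
  by have /(congr1 (fun g => g w)) := h l isT; rewrite /block /apex => ->; rewrite /coordIW mxE.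
move=> /andP[ls us] u'V h1 h2.
have uE := iffLR (vertex_blocks u') u'V.
have ul : block u' l = block u l by apply: h2; rewrite mem_head.
pose u2 := vecIW (setblock (coordIW u') l (@apex R W)).
have u2b k : block u2 k = if k == l then @apex R W else block u' k.
  apply: funext => w; rewrite /block /u2 vecK /setblock /=; by case: eqP.
have u2V : is_vertex P u2.
  apply/vertex_blocks => k; rewrite u2b; case: eqP => [->|_]; last exact: uE.
  exact: (extremal_apex R lamz (@cls_var l) (cls_nil l) w0lam w0z).
have [||n hn wn] := IH u2 us u2V.
- move=> k ks; rewrite u2b; case: eqP => // /eqP kl; apply: h1.
  by rewrite inE negb_or kl.
- move=> k ks; rewrite u2b; case: eqP => [E|_]; first by rewrite -E ks in ls.
  by apply: h2; rewrite inE ks orbT.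
have [k hk wk] : exists2 k, (k <= 1 + `[< good lam (cls l) (block u l) >])%N & walk P k u' u2.
  rewrite -ul; have [Qu _] := uE l.
  have [l0|l0] := eqVneq (block u' l lam) 0.
    exists 0%N => //=; apply: (can_inj (@coordK R IW)); apply: funext => -[k w].
    have /(congr1 (fun g => g w)) := u2b k; rewrite /block => ->; case: eqP => // ->.
    by have := blockQ_lam0 lamz (@cls_var l) (cls_nil l) Qu l0; rewrite /block => /(congr1 (fun g => g w)).
  have one : edge (Q l) (block u' l) (@apex R W) -> exists2 k,
      (k <= 1 + `[< good lam (cls l) (block u' l) >])%N & walk P k u' u2.
    move=> e; exists 1%N; first by rewrite leq_addr.
    by exists u2; split=> //; apply: adjacent_block.
  have [l1|l1] := eqVneq (block u' l lam) 1; last first.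
    apply: one; apply: (extremal_lt1_edge lamz (@cls_var l) (cls_nil l) w0lam w0z) => //.
    by rewrite lt_neqAle l1 (blockQ_lam Qu).
  have [g|ng] := asboolP (good lam (cls l) (block u' l)).
    have [p e1 e2] := good_path lamz (@cls_var l) (cls_nil l) w0lam w0z (uE l) g.
    exists 2%N => //=.
    pose u1 := vecIW (setblock (coordIW u') l p).
    have u1b k : block u1 k = if k == l then p else block u' k.
      by apply: funext => w; rewrite /block /u1 vecK /setblock /=; case: eqP.
    exists u1; split; first exact: adjacent_block.
    exists u2; split=> //.
    have -> : u2 = vecIW (setblock (coordIW u1) l (@apex R W)).
      by congr vecIW; apply: funext => -[k w]; rewrite /u1 vecK /setblock /=; case: eqP.
    apply: adjacent_block; last by rewrite u1b eqxx.
    by move=> k; rewrite u1b; case: eqP => // ->; case: e2.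
  have [c cc hc] : exists2 c, c \in cls l & block u' l lam = 1 /\ cls_val lam (block u' l) c <= 0.
    apply: contrapT => H; apply: ng; split=> // c cc; rewrite ltNge; apply/negP => le.
    by apply: H; exists c.
  have [_ c0] := hc.
  by have := one (unsat_edge lamz (@cls_var l) (cls_nil l) w0lam w0z (uE l) l1 cc c0); rewrite asboolF.
exists (k + n)%N; first by rewrite big_cons leq_add.
exact: walk_cat wk wn.
Qed.

Lemma dist_le_good u v : is_vertex P u -> is_vertex P v ->
  (skeleton_dist P u v <= \sum_l (2 + 2 *
    `[< good lam (cls l) (block u l) \/ good lam (cls l) (block v l) >]))%N.
Proof.
move=> uV vV; have [n hn wn] := walk_to_apex uV; have [k hk wk] := walk_to_apex vV.
apply: (leq_trans (skeleton_dist_le (walk_cat wn (walk_rev wk)))).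
apply: (leq_trans (leq_add hn hk)); rewrite -big_split; apply: leq_sum => l _ /=.
by rewrite asbool_or; case: `[< _ >]; case: `[< _ >].
Qed.

Definition assign_vec (a : I -> W -> bool) : 'cV[R]_#|IW| :=
  vecIW (fun lw => assign R lam z (a lw.1) lw.2).

Lemma block_assign a l : block (assign_vec a) l = assign R lam z (a l).
Proof. by apply: funext => w; rewrite /block /assign_vec vecK. Qed.

Lemma vertex_assign a : is_vertex P (assign_vec a).
Proof.
by apply/vertex_blocks => l; rewrite block_assign; apply: (extremal_assign R lamz (@cls_var l)).
Qed.

Definition Psi u : nat := (\sum_l psi lam (cls l) dm (block u l))%N.

Lemma Psi_adjacent u v : adjacent P u v -> (Psi v <= (Psi u).+1)%N.
Proof.
move=> /adjacent_coord; rewrite setPE => /edge_prod [l [e same]].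
rewrite /Psi (bigD1 l) //= [in X in (_ <= X.+1)%N](bigD1 l) //= -addSn leq_add //.
  exact: (psi_edge lamz (@cls_var l) (cls_nil l) w0lam w0z dm_inj dm_lam dm_z (@dm_cls l) e).
by apply: eq_leq; apply: eq_bigr => k kl; congr psi; apply: funext => w; rewrite /block same.
Qed.

Lemma Psi_walk n u v : walk P n u v -> (Psi v <= Psi u + n)%N.
Proof.
elim: n u => [|n IH] u /=; first by move->; rewrite addn0.
move=> [w [/Psi_adjacent h /IH]]; lia.
Qed.

(** The potential of a block rises from 0 to 4 if both of its vertices are good, and by at least 2
    otherwise because clamping gives at most 1 at the start and 3 at the end. *)
Lemma dist_ge_assign (a0 a1 : I -> W -> bool) :
  (forall l j, a0 l (dm j) = false) -> (forall l j, a1 l (dm j) = true) ->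
  (\sum_l (2 + 2 * `[< good lam (cls l) (assign R lam z (a0 l)) /\
                      good lam (cls l) (assign R lam z (a1 l)) >])
    <= skeleton_dist P (assign_vec a0) (assign_vec a1))%N.
Proof.
move=> h0 h1; have [n hn wn] := walk_to_apex (vertex_assign a0).
have [k hk wk] := walk_to_apex (vertex_assign a1).
apply: (skeleton_dist_ge (walk_cat wn (walk_rev wk))) => j /Psi_walk.
suff : (Psi (assign_vec a0) + \sum_l (2 + 2 * `[< good lam (cls l) (assign R lam z (a0 l)) /\
    good lam (cls l) (assign R lam z (a1 l)) >]) <= Psi (assign_vec a1))%N by lia.
rewrite /Psi -big_split; apply: leq_sum => l _ /=; rewrite !block_assign /psi.
have f1 a : assign R lam z a lam == 0 = false.
  by rewrite /assign (negbTE lamz) eqxx oner_eq0.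
rewrite !f1 (psi_assign R lamz dm_lam dm_z (h0 l)) (psi_assign R lamz dm_lam dm_z (h1 l)).
by rewrite asbool_and; case: `[< _ >]; case: `[< _ >].
Qed.

End BlockProduct.

Local Close Scope ring_scope.

(** * Stack programs *)

Section StackPrograms.
Variables Reg G : finType.

Definition stacks := Reg -> seq G.
Definition tops_t := {ffun Reg -> option G}.

Inductive op := Keep | Pop | Push of G | Rep of G.

Definition apply_op (o : op) (s : seq G) : seq G :=
  match o with
  | Keep => s | Pop => behead s | Push a => a :: s | Rep a => a :: behead s
  end.

Definition tops (s : stacks) : tops_t := [ffun r => ohead (s r)].
Definition do_ops (o : Reg -> op) (s : stacks) : stacks := fun r => apply_op (o r) (s r).

(** A step changes all stacks at once and depends only on their tops. This locality allows the same
    program to be turned into clauses and into a Turing machine. *)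
Inductive prog :=
  | Do of (tops_t -> Reg -> op)
  | Seq of prog & prog
  | If of (tops_t -> bool) & prog & prog
  | While of (tops_t -> bool) & prog.

Fixpoint pc (p : prog) : finType :=
  match p with
  | Do _ => unit
  | Seq p q => (pc p + pc q)%type
  | If _ p q => option (pc p + pc q)%type
  | While _ p => option (pc p)
  end.

Fixpoint start (p : prog) : pc p :=
  match p return pc p with
  | Do _ => tt
  | Seq p q => inl (start p)
  | If _ p q => None
  | While _ p => None
  end.

Fixpoint next (p : prog) : pc p -> tops_t -> option (pc p) * (Reg -> op) :=
  match p return pc p -> tops_t -> option (pc p) * (Reg -> op) with
  | Do a => fun _ t => (None, a t)
  | Seq p q => fun s t =>
      match s with
      | inl s => (Some (if (next s t).1 is Some s' then inl s' else inr (start q)), (next s t).2)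
      | inr s => (omap inr (next s t).1, (next s t).2)
      end
  | If c p q => fun s t =>
      match s with
      | None => (Some (Some (if c t then inl (start p) else inr (start q))), fun _ => Keep)
      | Some (inl s) => (omap (fun s' => Some (inl s')) (next s t).1, (next s t).2)
      | Some (inr s) => (omap (fun s' => Some (inr s')) (next s t).1, (next s t).2)
      end
  | While c p => fun s t =>
      match s with
      | None => (if c t then Some (Some (start p)) else None, fun _ => Keep)
      | Some s => (Some (next s t).1, (next s t).2)
      end
  end.

(* A halted configuration has program counter [None]. *)
Definition mstep (p : prog) (c : option (pc p) * stacks) : option (pc p) * stacks :=
  if c.1 is Some q then ((next q (tops c.2)).1, do_ops (next q (tops c.2)).2 c.2) else c.

Definition mrun (p : prog) (k : nat) (c : option (pc p) * stacks) := iter k (@mstep p) c.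

Lemma mrunD p a b c : @mrun p (a + b) c = mrun b (mrun a c).
Proof. by rewrite /mrun addnC iterD. Qed.

Lemma mrunS p k c : @mrun p k.+1 c = mrun k (mstep c).
Proof. exact: iterSr. Qed.

Lemma mrun_halt p k s : @mrun p k (None, s) = (None, s).
Proof. by elim: k => // k IH; rewrite mrunS. Qed.

Fixpoint loopn (c : tops_t -> bool) (R : stacks -> stacks -> Prop) (k : nat) s s' : Prop :=
  if k is k'.+1 then c (tops s) /\ exists t, R s t /\ loopn c R k' t s'
  else ~~ c (tops s) /\ s' = s.

(* [big B p s s']: [p] leads from [s] to [s'], and no loop iterates more than [B] times. *)
Fixpoint big (B : nat) (p : prog) (s s' : stacks) : Prop :=
  match p with
  | Do a => s' = do_ops (a (tops s)) s
  | Seq p q => exists t, big B p s t /\ big B q t s'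
  | If c p q => if c (tops s) then big B p s s' else big B q s s'
  | While c p => exists2 k, k <= B & loopn c (big B p) k s s'
  end.

(** A loop pays one extra step per iteration for its test, and one more for the test that fails. *)
Fixpoint cost (B : nat) (p : prog) : nat :=
  match p with
  | Do _ => 1
  | Seq p q => cost B p + cost B q
  | If _ p q => (maxn (cost B p) (cost B q)).+1
  | While _ p => (B * (cost B p).+1).+1
  end.

(** Embeds a run of [p] into a program containing it: [e] relabels the counters and [x] is where
    control goes when [p] halts. The bound [k' <= k] discards the idle steps after halting. *)
Lemma lift_run p p' (e : pc p -> pc p') (x : option (pc p')) :
  (forall q t, next (e q) t =
    (if (next q t).1 is Some q1 then Some (e q1) else x, (next q t).2)) ->
  forall k q s s', mrun k (Some q, s) = (None, s') ->
  exists2 k', k' <= k & mrun k' (Some (e q), s) = (x, s').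
Proof.
move=> he; elim=> [|k IH] q s s' //; rewrite mrunS /mstep /=.
have := he q (tops s); case: (next q (tops s)) => [[q1|] o] /= E.
  by move=> /IH [k' kk h]; exists k'.+1 => //; rewrite mrunS /mstep /= E.
rewrite mrun_halt => -[<-]; exists 1 => //.
by rewrite /mrun /= /mstep /= E.
Qed.

Lemma big_run B p s s' : big B p s s' ->
  exists2 k, k <= cost B p & mrun k (Some (start p), s) = (None, s').
Proof.
elim: p s s' => [a|p IHp q IHq|c p IHp q IHq|c p IH] s s' /=.
- by move=> ->; exists 1.
- move=> [t [/IHp [k1 h1 r1] /IHq [k2 h2 r2]]].
  have [q' t'|k1' g1 e1] := @lift_run p (Seq p q) inl (Some (inr (start q))) _ k1 _ _ _ r1.
    by rewrite /=; case: (next q' t').1.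
  have [q' t'|k2' g2 e2] := @lift_run q (Seq p q) inr None _ k2 _ _ _ r2.
    by rewrite /=; case: (next q' t').1.
  exists (k1' + k2'); first by lia.
  by rewrite mrunD e1.
- case: ifP => h => [/IHp|/IHq] [k hk r].
  + have [q' t'|k' g e] := @lift_run p (If c p q) (fun x => Some (inl x)) None _ k _ _ _ r.
      by rewrite /=; case: (next q' t').1.
    exists k'.+1; first by lia.
    by rewrite mrunS /mstep /= h.
  + have [q' t'|k' g e] := @lift_run q (If c p q) (fun x => Some (inr x)) None _ k _ _ _ r.
      by rewrite /=; case: (next q' t').1.
    exists k'.+1; first by lia.
    by rewrite mrunS /mstep /= h.
- move=> [k kB]; suff : loopn c (big B p) k s s' -> exists2 k', k' <= (k * (cost B p).+1).+1 &
      @mrun (While c p) k' (Some None, s) = (None, s').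
    move=> H /H [k' hk r]; exists k' => //.
    by apply: (leq_trans hk); rewrite ltnS leq_mul2r kB orbT.
  elim: k {kB} s => [|k IHk] s /=.
    by move=> [/negbTE h ->]; exists 1 => //; rewrite /mrun /= /mstep /= h.
  move=> [h [t [/IH [k1 h1 r1] /IHk [k2 h2 r2]]]].
  have [q' t'|k1' g1 e1] := @lift_run p (While c p) Some (Some None) _ k1 _ _ _ r1.
    by rewrite /=; case: (next q' t').1.
  exists (k1' + k2).+1; first by lia.
  by rewrite mrunS /mstep /= h mrunD e1.
Qed.

(** Each loop raises the degree by one. *)
Lemma cost_poly p : exists C h, forall B, cost B p <= C * B.+1 ^ h.
Proof.
have mono a b B : a <= b -> B.+1 ^ a <= B.+1 ^ b by move=> ab; rewrite leq_pexp2l.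
elim: p => [a|p [C1 [h1 H1]] q [C2 [h2 H2]]|c p [C1 [h1 H1]] q [C2 [h2 H2]]|c p [C [h H]]] /=.
- by exists 1, 0 => B; rewrite expn0.
- exists (C1 + C2), (h1 + h2) => B; rewrite mulnDl leq_add //.
    by apply: (leq_trans (H1 B)); rewrite leq_mul2l mono ?leq_addr ?orbT.
  by apply: (leq_trans (H2 B)); rewrite leq_mul2l mono ?leq_addl ?orbT.
- exists (C1 + C2).+1, (h1 + h2) => B.
  have e0 : 0 < B.+1 ^ (h1 + h2) by rewrite expn_gt0.
  have k1 : cost B p <= C1 * B.+1 ^ (h1 + h2).
    by apply: (leq_trans (H1 B)); rewrite leq_mul2l mono ?leq_addr ?orbT.
  have k2 : cost B q <= C2 * B.+1 ^ (h1 + h2).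
    by apply: (leq_trans (H2 B)); rewrite leq_mul2l mono ?leq_addl ?orbT.
  rewrite mulSn mulnDl; lia.
- exists C.+2, h.+1 => B.
  have e0 : 0 < B.+1 ^ h by rewrite expn_gt0.
  have := H B; rewrite expnS; nia.
Qed.

End StackPrograms.

Arguments Keep {G}.
Arguments Pop {G}.

(** * Compilation to Turing machines *)

Section Compile.
Variables (Reg S : finType) (K : nat) (ix : Reg -> 'I_K.+1) (rx : 'I_K.+1 -> Reg).
Hypotheses (ixK : cancel ix rx) (rxK : cancel rx ix).
Local Notation G := ((bool + S)%type : finType).
Variable p : prog Reg G.

(** [None] is the halted state, the left summand holds the loading and unloading phases, and the
    right one pairs a program counter with the symbols that pending pushes still have to write. *)
Definition ctl : finType :=
  option (bool + (option (pc p) * option {ffun Reg -> option G}))%type.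

Definition c_load : ctl := Some (inl true).
Definition c_unload : ctl := Some (inl false).
Definition c_main q : ctl := Some (inr (q, None)).

(* A stack operation takes two steps: a push first moves the head, then writes. *)
Definition c_trans (q : ctl) (h : {ffun 'I_K.+1 -> cell S}) :
    option (ctl * ('I_K.+1 -> cell S * move)) :=
  match q with
  | None => None
  | Some (inl true) =>
      if [exists i, h i != None]
      then Some (c_load, fun i => (h i, if h i == None then MoveN else MoveR))
      else Some (c_main (Some (start p)), fun i => (h i, MoveL))
  | Some (inl false) =>
      if h ord0 == None
      then Some (None, fun i => (h i, if i == ord0 then MoveR else MoveN))
      else Some (c_unload, fun i => (h i, if i == ord0 then MoveL else MoveN))
  | Some (inr (Some s, None)) =>
      let n := next s [ffun r => h (ix r)] in
      Some (Some (inr (n.1, Some [ffun r => if n.2 r is Push a then Some a else None])),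
        fun i => match n.2 (rx i) with
                 | Keep => (h i, MoveN) | Pop => (None, MoveL)
                 | Push _ => (h i, MoveR) | Rep a => (Some a, MoveN) end)
  | Some (inr (s, Some pd)) =>
      Some (c_main s, fun i => (if pd (rx i) is Some a then Some a else h i, MoveN))
  | Some (inr (None, None)) => Some (c_unload, fun i => (h i, MoveN))
  end.

Definition compile : tm := @TM K ctl S c_load c_trans.

(* The stack grows to the right: its top is under the head, and the part of the
   tape right of the head is blank. *)
Definition rep (t : tape S) (s : seq G) :=
  (forall k, nth None (tape_head t :: tape_left t) k = nth None (map Some s) k) /\
  (forall k, nth None (tape_right t) k = None).

Lemma rep_head t s : rep t s -> tape_head t = ohead s.
Proof. by move=> [/(_ 0) /= -> _]; case: s. Qed.

Lemma nth_head_behead (T : Type) (x0 : T) l k :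
  nth x0 (head x0 l :: behead l) k = nth x0 l k.
Proof. by case: l => //=; case: k => [|[]]. Qed.

Lemma rep_pop t s : rep t s -> rep (tape_move MoveL (tape_write None t)) (behead s).
Proof.
move=> [h1 h2]; split=> /= k; last by case: k.
rewrite nth_head_behead; have /= -> := h1 k.+1.
by case: s {h1} => //=; rewrite nth_nil.
Qed.

Lemma rep_push t s a : rep t s ->
  rep (tape_write (Some a) (tape_move MoveR (tape_write (tape_head t) t))) (a :: s).
Proof.
move=> [h1 h2]; split=> /= k; first by case: k => //= k; rewrite h1.
by rewrite nth_behead h2.
Qed.

Lemma rep_rep t s a : rep t s -> rep (tape_write (Some a) t) (a :: behead s).
Proof.
move=> [h1 h2]; split=> //= k; case: k => //= k; have /= -> := h1 k.+1.
by case: s {h1} => //=; rewrite nth_nil.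
Qed.

Lemma tape_write_id (t : tape S) : tape_write (tape_head t) t = t.
Proof. by case: t. Qed.

Lemma tm_runD (M : tm) a b c : tm_run (a + b) c = tm_run b (@tm_run M a c).
Proof. by rewrite /tm_run addnC iterD. Qed.

Lemma tm_runS (M : tm) k c : tm_run k.+1 c = tm_run k (odflt c (@tm_step M c)).
Proof. exact: iterSr. Qed.

Lemma compile_mstep (c : config compile) q (s : stacks Reg G) :
  cfg_state c = c_main (Some q) -> (forall r, rep (cfg_tape c (ix r)) (s r)) ->
  let c' := tm_run 2 c in
  cfg_state c' = c_main (mstep (Some q, s)).1 /\
  forall r, rep (cfg_tape c' (ix r)) ((mstep (Some q, s)).2 r).
Proof.
move=> cq hr.
have E : [ffun r => [ffun i => tape_head (cfg_tape c i)] (ix r)] = tops s.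
  by apply/ffunP => r; rewrite !ffunE (rep_head (hr r)).
rewrite tm_runS /tm_step cq /= E.
rewrite /mstep /=; case: (next q (tops s)) => [q' o] /=.
case: q' => [q'|] /=; split=> // r; rewrite !ffunE ixK /do_ops.
all: case: (o r) => [||a|a] /=; rewrite ?tape_write_id //.
all: by [apply: rep_pop | apply: rep_push | exact: (rep_rep a (hr r))].
Qed.

Lemma compile_mrun k (c : config compile) q (s : stacks Reg G) s' :
  cfg_state c = c_main (Some q) -> (forall r, rep (cfg_tape c (ix r)) (s r)) ->
  mrun k (Some q, s) = (None, s') ->
  exists2 k', k' <= 2 * k & let c' := tm_run k' c in
  cfg_state c' = c_main None /\ forall r, rep (cfg_tape c' (ix r)) (s' r).
Proof.
elim: k c q s => [|k IH] c q s // cq hr; rewrite mrunS.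
have [e1 e2] := compile_mstep cq hr.
case E : (mstep (Some q, s)) e1 e2 => [[q1|] s1] /= e1 e2.
  by move=> /(IH _ _ _ e1 e2) [k' kk h]; exists (2 + k'); [lia | rewrite tm_runD].
rewrite mrun_halt => -[<-]; exists 2 => //; lia.
Qed.

Lemma leading_bits_nth (l : seq (cell S)) (out : bits) :
  (forall k, nth None l k = nth None [seq Some (inl b) | b <- out] k) ->
  leading_bits l = out.
Proof.
elim: out l => [|b out IH] [|x l] h //=; have := h 0 => /= E; rewrite ?E //.
by congr cons; apply: IH => k; have := h k.+1.
Qed.

(** The head walks left from the top of the stack to a blank and then one cell right, so the output
    is the stack read from the bottom. *)
Lemma unload_run (c : config compile) (s : seq G) : forall (r : seq G),
  cfg_state c = c_unload ->
  (forall k, nth None (tape_head (cfg_tape c ord0) :: tape_left (cfg_tape c ord0)) k =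
             nth None (map Some s) k) ->
  (forall k, nth None (tape_right (cfg_tape c ord0)) k = nth None (map Some r) k) ->
  let c' := tm_run (size s).+1 c in
  cfg_state c' = None /\ forall k,
    nth None (tape_head (cfg_tape c' ord0) :: tape_right (cfg_tape c' ord0)) k =
    nth None (map Some (catrev s r)) k.
Proof.
elim: s c => [|a s IH] c r cq h1 h2.
  have h0 := h1 0; rewrite /= in h0.
  rewrite /tm_run /= /tm_step cq /= ffunE h0 /=; split=> // k.
  by rewrite nth_head_behead h2.
have h0 : tape_head (cfg_tape c ord0) = Some a := h1 0.
pose c1 := Config (M := compile) c_unload (fun i =>
  tape_move (if i == ord0 then MoveL else MoveN) (cfg_tape c i)).
have E1 : tm_step c = Some c1.
  rewrite /tm_step cq /= ffunE h0 /=; congr (Some (Config _ _)).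
  by apply: funext => i; rewrite ffunE tape_write_id.
have -> : (size (a :: s)).+1 = (size s).+1.+1 by [].
rewrite tm_runS E1; apply: (IH c1 (a :: r)) => // k.
  by rewrite /= nth_head_behead; have := h1 k.+1.
by case: k => [|k] //=.
Qed.

(** All heads move right in parallel; a head that has passed its input waits on the blank until the
    longest input is passed. *)
Lemma load_run (ws : seq bits) j : (forall i, i < j -> [exists k : 'I_K.+1, i < size (nth [::] ws k)]) ->
  let c := tm_run j (tm_init compile ws) in
  cfg_state c = c_load /\ forall i : 'I_K.+1,
  let cs := [seq Some (inl b) | b <- nth [::] ws i] : seq (cell S) in
  cfg_tape c i = Tape (rev (take j cs)) (nth None cs j) (drop j.+1 cs).
Proof.
elim: j => [|j IH] h.
  by split=> // i cs; rewrite take0 drop1 nth0.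
rewrite /tm_run iterS -/(tm_run j _); have [|e1 e2] := IH; first by move=> i ij; apply: h; lia.
set c := tm_run j _ in e1 e2 *.
have hx : [exists i, [ffun i => tape_head (cfg_tape c i)] i != None].
  have /existsP[k hk] := h j (ltnSn j); apply/existsP; exists k; rewrite ffunE e2 /=.
  by rewrite (nth_map false).
rewrite /tm_step e1 /= hx /=; split=> // i; rewrite ffunE e2 /= /tape_write /=.
set cs := [seq _ | _ <- _]; have [le|lt] := leqP (size cs) j.
  by rewrite nth_default // eqxx /= !take_oversize ?drop_oversize ?nth_default //; lia.
have -> /= : (nth None cs j == None) = false.
  by rewrite (nth_map false) //; rewrite size_map in lt.
rewrite (take_nth None lt) rev_rcons; congr Tape.
  by rewrite -nth0 nth_drop addn0.
by rewrite -drop1 drop_drop add1n.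
Qed.

Lemma tm_computes_mono (M : tm) t t' ws out :
  tm_computes_in M t ws out -> t <= t' -> tm_computes_in M t' ws out.
Proof.
move=> [h1 h2] tt; rewrite /tm_computes_in -(subnK tt) addnC tm_runD.
set c := tm_run t _ in h1 h2 *; have -> : tm_run (t' - t) c = c.
  by elim: (t' - t) => // k IH; rewrite tm_runS h1.
by [].
Qed.

(** Reversed because loading leaves each head at the end of its input. *)
Definition input_stacks (ws : seq bits) : stacks Reg G :=
  fun r => [seq inl b | b <- rev (nth [::] ws (ix r))].

Theorem compile_correct B ws s' out : size ws <= K.+1 ->
  big B p (input_stacks ws) s' -> s' (rx ord0) = [seq inl b | b <- rev out] ->
  tm_computes_in compile (2 * cost B p + sumn [seq size w | w <- ws] + size out + 4) ws out.
Proof.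
move=> szw /big_run [k kc hrun] hout.
pose J := \max_(i < K.+1) size (nth [::] ws i).
have Jle : J <= sumn [seq size w | w <- ws].
  apply/bigmax_leqP => i _; have [le|lt] := leqP (size ws) i; first by rewrite nth_default.
  elim: (ws) (nat_of_ord i) lt => // w ws' IH [|i'] /=; first by rewrite leq_addr.
  by move=> /IH; lia.
have [|e1 e2] := @load_run ws J.
  move=> i iJ; apply/existsP; apply: contrapT => /forallNP H; move: iJ; rewrite ltnNge => /negP; apply.
  by apply/bigmax_leqP => k' _; rewrite leqNgt; apply/negP; exact: H.
set c := tm_run J _ in e1 e2.
have eT (i : 'I_K.+1) : let cs := [seq Some (inl b) | b <- nth [::] ws i] : seq (cell S) in
    cfg_tape c i = Tape (rev cs) None [::].
  have le : size (nth [::] ws i) <= J by exact: (leq_bigmax i).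
  move=> cs; have szc : size cs <= J by rewrite size_map.
  by rewrite e2 -/cs take_oversize // (@nth_default _ None cs) // drop_oversize // leqW.
pose c1 := tm_run 1 c.
have c1E : c1 = Config (M := compile) (c_main (Some (start p)))
    (fun i => tape_move MoveL (tape_write None (cfg_tape c i))).
  rewrite /c1 /tm_run /= /tm_step e1 /=.
  have -> : [exists i, [ffun i => tape_head (cfg_tape c i)] i != None] = false.
    by apply/negbTE/existsPn => i; rewrite ffunE eT.
  by congr Config; apply: funext => i; rewrite ffunE eT.
have hrep r : rep (cfg_tape c1 (ix r)) (input_stacks ws r).
  rewrite c1E /= eT /input_stacks; split=> /= j; last by case: j => [|[]].
  by rewrite nth_head_behead -map_rev -!map_comp.
have c1s : cfg_state c1 = c_main (Some (start p)) by rewrite c1E.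
have [k' kk [f1 f2]] := compile_mrun c1s hrep hrun.
set c2 := tm_run k' c1 in f1 f2.
pose c3 := tm_run 1 c2.
have c3E : c3 = Config (M := compile) c_unload (cfg_tape c2).
  rewrite /c3 /tm_run /= /tm_step f1 /=; congr Config; apply: funext => i.
  by rewrite ffunE tape_write_id.
have [g1 g2] := f2 (rx ord0); rewrite rxK hout in g1 g2.
have [|||h1 h2] := @unload_run c3 [seq inl b | b <- rev out] [::].
- by rewrite c3E.
- by rewrite c3E.
- by move=> j; rewrite c3E /= nth_nil; exact: g2.
set sz := (size _).+1 in h1 h2; set c4 := tm_run sz c3 in h1 h2.
have -> : 2 * cost B p + sumn [seq size w | w <- ws] + size out + 4 =
  (J + (1 + (k' + (1 + sz)))) + (2 * cost B p + sumn [seq size w | w <- ws] + size out + 4 -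
  (J + (1 + (k' + (1 + sz))))).
  by rewrite /sz size_map size_rev subnKC //; lia.
apply: (@tm_computes_mono _ (J + (1 + (k' + (1 + sz))))); last exact: leq_addr.
rewrite /tm_computes_in !tm_runD -/c -/c1 -/c2 -/c3 -/c4; split.
  by rewrite /tm_step h1.
apply: leading_bits_nth => j; rewrite h2 catrevE cats0 -map_rev revK -map_comp.
by [].
Qed.

End Compile.

(** * The computation tableau of a stack program *)

Lemma onth_behead (T : Type) (s : seq T) i : onth (behead s) i = onth s i.+1.
Proof. by case: s => //; case: i. Qed.

Lemma onth_lt (T : Type) (x0 : T) (s : seq T) i : i < size s -> onth s i = Some (nth x0 s i).
Proof. by elim: s i => [|a s IH] [|i] //=; apply: IH. Qed.

Lemma onth_nil (T : Type) i : onth (@nil T) i = None.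
Proof. by case: i. Qed.

Lemma ohead_onth (T : Type) (s : seq T) : ohead s = onth s 0.
Proof. by case: s. Qed.

(* [P0], [Pe], [Ps]: depth zero, the depth of the row, and its successor. *)
Definition psel : eqType := option bool.
Notation P0 := None (only parsing).
Notation Pe := (Some false) (only parsing).
Notation Ps := (Some true) (only parsing).

(* Data of a row index: is it first, is it last, the bits of the instance and of
   the threshold at this depth, and whether the guessed word may extend to it. *)
Definition relem : finType := (bool * bool * option bool * option bool * bool)%type.
Definition r_first (e : relem) := e.1.1.1.1.
Definition r_last (e : relem) := e.1.1.1.2.
Definition r_x (e : relem) := e.1.1.2.
Definition r_th (e : relem) := e.1.2.
Definition r_w (e : relem) := e.2.

Section Tableau.
Variables (Reg G : finType) (p : prog Reg G) (rX rW rT rV : Reg) (bit : bool -> G) (bad : G).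
Hypotheses (XW : rX != rW) (XT : rX != rT) (WT : rW != rT).

Definition kd : finType := ((option (pc p) + Reg * option G) + ('I_4 + bool))%type.
Definition KPc (q : option (pc p)) : kd := inl (inl q).
Definition KU (r : Reg) (a : option G) : kd := inl (inr (r, a)).
Definition KD (j : 'I_4) : kd := inr (inl j).
Definition KLam : kd := inr (inr true).
Definition KZ : kd := inr (inr false).

Definition ctx : finType := (option (pc p) * tops_t Reg G)%type.
(** In order: initial stack contents; the three special clauses (start counter, no gap in the
    guessed word, verdict not [bad]); next counter; symbol newly written on top; symbols copied or
    shifted by a step. *)
Definition ctype : finType :=
  ((Reg + 'I_3) + (ctx + (ctx * Reg + ctx * Reg * option G)))%type.

(* Negated?, at the next time?, depth, kind. *)
Definition rlit := (bool * bool * psel * kd)%type.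

Definition delta (c : ctx) : option (pc p) * (Reg -> op G) :=
  if c.1 is Some q then next q c.2 else (None, fun _ => Keep).

(** The negated context: prefixed to a literal, it makes the clause an implication from the current
    counter and tops. *)
Definition prem (c : ctx) : seq rlit :=
  (true, false, P0, KPc c.1) :: [seq (true, false, P0, KU r (c.2 r)) | r <- enum Reg].

(** Each clause involves only the times [t], [t + 1] and the depths 0, [i], [i + 1], and its shape
    depends only on the flags [te] and [pe]; this keeps the matrix printable. [None] means that
    there is no clause of this type at this place. *)
Definition lits (c : ctype) (te pe : relem) : option (seq rlit) :=
  match c with
  | inl (inl r) =>
      if ~~ r_first te then None else
      if r == rW then
        Some (if r_w pe then [:: (false, false, Pe, KU rW (Some (bit false)));
                                 (false, false, Pe, KU rW (Some (bit true)));
                                 (false, false, Pe, KU rW None)]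
              else [:: (false, false, Pe, KU rW None)])
      else if r == rX then Some [:: (false, false, Pe, KU rX (omap bit (r_x pe)))]
      else if r == rT then Some [:: (false, false, Pe, KU rT (omap bit (r_th pe)))]
      else Some [:: (false, false, Pe, KU r None)]
  | inl (inr j) =>
      if j == 0 :> nat then
        if r_first te && r_first pe then Some [:: (false, false, P0, KPc (Some (start p)))]
        else None
      else if j == 1 :> nat then
        if r_first te && ~~ r_last pe
        then Some [:: (true, false, Pe, KU rW None); (false, false, Ps, KU rW None)] else None
      else
        if r_last te && r_first pe then Some [:: (true, false, P0, KU rV (Some bad))] else None
  | inr (inl c) =>
      if ~~ r_last te && r_first pe
      then Some (rcons (prem c) (false, true, P0, KPc (delta c).1)) else None
  | inr (inr (inl (c, r))) =>
      if ~~ r_last te && r_first pe then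
        match (delta c).2 r with
        | Push b | Rep b => Some (rcons (prem c) (false, true, P0, KU r (Some b)))
        | _ => None
        end
      else None
  | inr (inr (inr (c, r, a))) =>
      if r_last te then None else
      match (delta c).2 r with
      | Keep => Some (prem c ++ [:: (true, false, Pe, KU r a); (false, true, Pe, KU r a)])
      | Pop => if r_last pe then None else
          Some (prem c ++ [:: (true, false, Ps, KU r a); (false, true, Pe, KU r a)])
      | Push _ => if r_last pe then None else
          Some (prem c ++ [:: (true, false, Pe, KU r a); (false, true, Ps, KU r a)])
      | Rep _ => if r_first pe then None else
          Some (prem c ++ [:: (true, false, Pe, KU r a); (false, true, Pe, KU r a)])
      end
  end.

(** The first two conditions keep [inord] from falling back to 0 beyond the last row; the third
    keeps the dummies, [lam] and [z] out of all clauses. *)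
Lemma lits_range c te pe ls : lits c te pe = Some ls ->
  all (fun l : rlit => [&& (l.1.1.2 ==> ~~ r_last te),
    (if l.1.2 is Ps then ~~ r_last pe else true) & (if l.2 is inl _ then true else false)]) ls.
Proof.
pose ok : pred rlit := fun l => [&& (l.1.1.2 ==> ~~ r_last te),
    (if l.1.2 is Ps then ~~ r_last pe else true) & (if l.2 is inl _ then true else false)].
rewrite -/ok.
have hp cx s : all ok s -> all ok (prem cx ++ s).
  by move=> h; rewrite all_cat h andbT /= all_map; apply/allP.
rewrite /lits; case: c => [[r|j]|[c|[[c r]|[[c r] a]]]].
- do 4?[case: ifP => // _]; by move=> [<-] //=; case: ifP.
- by case: (_ == 0); [|case: (_ == 1)]; case: ifP => // /andP[h1 h2] [<-] /=; rewrite /ok /= ?h2.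
- by case: ifP => // /andP[h1 h2] [<-]; rewrite -cats1 hp //= /ok /= h1.
- case: ifP => // /andP[h1 h2]; by case: ((delta c).2 r) => // [a|a] [<-]; rewrite -cats1 hp //= /ok /= h1.
- case: ifP => // /negbT h1.
  by case: ((delta c).2 r) => [||b|b]; [|case: ifP => // /negbT h2..]; move=> [<-];
    rewrite hp //= /ok /= ?h1 ?h2.
Qed.

Section Grid.
Variables (N nw : nat) (x th : bits).
Local Notation n := N.+1.

Definition var : finType := ('I_n * ('I_n * kd))%type.

Definition telem (i : nat) : relem := (i == 0, i == N, None, None, false).
Definition pelem (i : nat) : relem := (i == 0, i == N, onth x i, onth th i, i < nw).

Definition res (t i : 'I_n) (l : rlit) : bool * var :=
  (l.1.1.1, (inord (t + l.1.1.2), (match l.1.2 with P0 => ord0 | Pe => i | Ps => inord i.+1 end, l.2))).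

Definition clauses : seq (seq (bool * var)) :=
  pmap (fun tic : 'I_n * ('I_n * ctype) =>
    omap (map (res tic.1 tic.2.1)) (lits tic.2.2 (telem tic.1) (pelem tic.2.1)))
  (enum {: 'I_n * ('I_n * ctype)}).

Lemma clausesP c : reflect
  (exists (t i : 'I_n) ct ls, lits ct (telem t) (pelem i) = Some ls /\ c = map (res t i) ls)
  (c \in clauses).
Proof.
rewrite /clauses mem_pmap; apply: (iffP mapP).
  move=> [[t [i ct]] _ /=]; case E : (lits _ _ _) => [ls|] //= [->].
  by exists t, i, ct, ls.
by move=> [t [i [ct [ls [E ->]]]]]; exists (t, (i, ct)); rewrite ?mem_enum //= E.
Qed.

Definition lamv : var := (ord0, (ord0, KLam)).
Definition zv : var := (ord0, (ord0, KZ)).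
Definition dummyv (j : 'I_4) : var := (ord0, (ord0, KD j)).

Lemma clause_kind c l : c \in clauses -> l \in c -> exists k, l.2.2.2 = inl k.
Proof.
move=> /clausesP[t [i [ct [ls [E ->]]]]] /mapP[rl rls ->] /=.
have /allP /(_ _ rls) /and3P[_ _] := lits_range E.
by case: (rl.2) => [k _|//]; exists k.
Qed.

Lemma clauses_nil : clauses != [::].
Proof.
have : [:: (false, (ord0, (ord0, KPc (Some (start p)))) : var)] \in clauses.
  apply/clausesP; exists ord0, ord0, (inl (inr ord0)); eexists; split; first by rewrite /= /r_first /=.
  by rewrite /= /res /= addn0; congr [:: (_, (_, _))]; apply: val_inj; rewrite /= inordK.
by case: clauses.
Qed.

Definition holds (a : var -> bool) (l : bool * var) := l.1 != a l.2.

(** The word ends at the first depth marked empty. A cell is read as 1 when its variable for 1 is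
    true, even if the one for 0 is true as well, so clauses excluding double marks can be
    avoided. *)
Definition guess (a : nat -> option bool -> bool) : bits :=
  [seq a i (Some true) | i <- iota 0 (find (fun i => a i None) (iota 0 n))].

Definition guessv (a : var -> bool) (i : nat) (c : option bool) : bool :=
  a (ord0, (inord i, KU rW (omap bit c))).

Definition init_st (w : bits) : stacks Reg G := fun r =>
  if r == rX then map bit x else if r == rW then map bit w
  else if r == rT then map bit th else [::].

Lemma init_stW w : init_st w rW = map bit w.
Proof. by rewrite /init_st eq_sym (negbTE XW) eqxx. Qed.

Lemma init_stT w : init_st w rT = map bit th.
Proof. by rewrite /init_st (eq_sym rT rX) (negbTE XT) (eq_sym rT rW) (negbTE WT) eqxx. Qed.

Definition conf (w : bits) (t : nat) := mrun t (Some (start p), init_st w).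

Lemma confS w t : conf w t.+1 = mstep (conf w t).
Proof. exact: iterS. Qed.

Lemma conf_delta w t : let c := ((conf w t).1, tops (conf w t).2) : ctx in
  conf w t.+1 = ((delta c).1, do_ops (delta c).2 (conf w t).2).
Proof.
by move=> c; rewrite confS /mstep /delta /c; case: (conf w t) => [[q|] s].
Qed.

(** Clauses only propagate truth: each variable describing the actual computation on the guessed
    word is true, whatever else may be. The last special clause then refutes the verdict [bad]. *)
Lemma tableau_sound a : (forall c, c \in clauses -> has (holds a) c) ->
  let w := guess (guessv a) in
  (size w <= nw) && (ohead ((conf w N).2 rV) != Some bad).
Proof.
move=> sat /=; set w := guess _.
have cl (t i : 'I_n) ct ls : lits ct (telem t) (pelem i) = Some ls ->
    has (fun l => holds a (res t i l)) ls.
  move=> E; rewrite -(has_map (res t i)); apply: sat; apply/clausesP.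
  by exists t, i, ct, ls.
have inz : inord 0 = ord0 :> 'I_n by apply: val_inj; rewrite /= inordK.
have ino (i : 'I_n) : inord i = i by apply: val_inj; rewrite /= inordK.
have te0 : r_first (telem (ord0 : 'I_n)) = true by [].
have in0 (i : 'I_n) : inord (i + false) = i by rewrite addn0 ino.
have wnone i : nw <= i < n -> guessv a i None.
  move=> /andP[h1 h2].
  have := @cl ord0 (Ordinal h2) (inl (inl rW)) [:: (false, false, Pe, KU rW None)].
  rewrite /lits te0 eqxx /r_w /pelem /= ltnNge h1 /= => /(_ erefl).
  by rewrite orbF /holds /res /= inz /guessv -(ino (Ordinal h2)) /=; case: (a _).
have szw : size w = find (fun i => guessv a i None) (iota 0 n) by rewrite size_map size_iota.
have fle : size w <= n by rewrite szw (leq_trans (find_size _ _)) ?size_iota.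
have wfind i : i < size w -> guessv a i None = false.
  move=> h; rewrite szw in h; have := before_find 0 h.
  by rewrite nth_iota ?add0n // (leq_trans h) // -szw.
(* Emptiness is inherited by the next depth through the second special clause. *)
have wnone' i : size w <= i < n -> guessv a i None.
  move=> /andP[]; elim: i => [|i IH] h1 h2.
    have : has (fun i => guessv a i None) (iota 0 n).
      by rewrite has_find size_iota -szw; lia.
    by move=> /(nth_find 0); rewrite -szw; have -> : size w = 0 by lia.
  have [e|lt] := eqVneq (size w) i.+1.
    have : has (fun i => guessv a i None) (iota 0 n).
      by rewrite has_find size_iota -szw; lia.
    move=> /(nth_find 0); rewrite -szw e nth_iota //.
  have /IH : size w <= i by lia.
  move=> /(_ _) g; have {}g : guessv a i None by apply: g; lia.
  have h3 : i < n by lia.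
  have := @cl ord0 (Ordinal h3) (inl (inr (inord 1)))
    [:: (true, false, Pe, KU rW None); (false, false, Ps, KU rW None)].
  have lst : r_last (pelem (Ordinal h3)) = false by rewrite /r_last /pelem /=; lia.
  rewrite /lits te0 lst inordK //= => /(_ erefl).
  rewrite /holds /res /= orbF inz; move: g; rewrite /guessv -(ino (Ordinal h3)) /= => ->.
  by case: (a _).
have wle : size w <= nw.
  have [h|h] := leqP n nw; first exact: leq_trans fle h.
  rewrite leqNgt; apply/negP => lt; have := wfind _ lt.
  by rewrite wnone // leqnn h.
rewrite wle /=.
(* A pop moves depth [i + 1] to depth [i], and nothing is known below depth [N], so the known part
   shrinks by one row per step. At time [N] depth 0 is left, which is where the verdict stands. *)
have inv t : t < n -> (forall t' : 'I_n, t' = t :> nat -> a (t', (ord0, KPc (conf w t).1))) /\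
    forall (t' : 'I_n) r (i : 'I_n), t' = t :> nat -> i + t < n ->
      a (t', (i, KU r (onth ((conf w t).2 r) i))).
  elim: t => [|t IH] tn.
    split=> [t' e|t' r i e _]; have {e}-> : t' = ord0 by apply: val_inj.
      have := @cl ord0 ord0 (inl (inr ord0)) _ erefl.
      by rewrite /= /holds /res /= orbF inz; case: (a _).
    rewrite /conf /= /init_st; have [->|rX'] := eqVneq r rX.
      have := @cl ord0 i (inl (inl rX)) [:: (false, false, Pe, KU rX (omap bit (onth x i)))].
      rewrite /lits te0 (negbTE XW) eqxx => /(_ erefl) /=.
      by rewrite /holds /res /= orbF inz onth_map; case: (a _).
    have [->|rW'] := eqVneq r rW.
      rewrite onth_map; have [le|lt] := leqP (size w) i.
        have : guessv a i None by apply: wnone'; rewrite le ltn_ord.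
        by rewrite /guessv ino /= onth_default.
      have ilt : i < nw by apply: leq_trans wle.
      have := @cl ord0 i (inl (inl rW)) _.
      rewrite /lits te0 eqxx /r_w /pelem /= ilt => /(_ _ erefl) /=.
      rewrite /holds /res /= orbF inz.
      have := wfind _ lt; rewrite /guessv ino /= => ->.
      rewrite (onth_lt false) //=.
      rewrite /w /guess (nth_map 0) ?size_iota -?szw // nth_iota -?szw // add0n /guessv ino /=.
      by case E : (a (ord0, (i, KU rW (Some (bit true))))); rewrite ?E //; case: (a _).
    have [->|rT'] := eqVneq r rT.
      have := @cl ord0 i (inl (inl rT)) [:: (false, false, Pe, KU rT (omap bit (onth th i)))].
      rewrite /lits te0 (eq_sym rT) (negbTE WT) (eq_sym rT) (negbTE XT) eqxx => /(_ erefl) /=.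
      by rewrite /holds /res /= orbF inz onth_map; case: (a _).
    have := @cl ord0 i (inl (inl r)) [:: (false, false, Pe, KU r None)].
    rewrite /lits te0 (negbTE rW') (negbTE rX') (negbTE rT') => /(_ erefl) /=.
    by rewrite /holds /res /= orbF inz onth_nil; case: (a _).
  have tn' : t < n by lia.
  have [h1 h2] := IH tn'.
  have [to toE] : exists to : 'I_n, to = t :> nat by exists (Ordinal tn').
  pose c : ctx := ((conf w t).1, tops (conf w t).2).
  have lt : r_last (telem to) = false by rewrite /r_last /telem /= toE; lia.
  have nsuc (t' : 'I_n) : t' = t.+1 :> nat -> inord (to + true) = t'.
    by move=> e; apply: val_inj; rewrite /= inordK addn1 toE.
  have hprem (i : 'I_n) : has (fun l => holds a (res to i l)) (prem c) = false.
    apply/negbTE; rewrite /= negb_or; apply/andP; split.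
      by rewrite /holds /res /= negbK in0 h1.
    rewrite has_map; apply/hasPn => r _; rewrite /= /holds /res /= negbK in0.
    have -> : c.2 r = onth ((conf w t).2 r) (ord0 : 'I_n) by rewrite ffunE ohead_onth.
    by rewrite h2.
  rewrite conf_delta -/c; split=> [t' e|t' r i e ile] /=.
    have := @cl to ord0 (inr (inl c)) _; rewrite /lits lt => /(_ _ erefl).
    rewrite has_rcons hprem orbF.
    by rewrite /holds /res (nsuc _ e) /=; case: (a _).
  have keep (j j' : 'I_n) ps ps' b : (match ps with P0 => ord0 | Pe => i | Ps => inord i.+1 end) = j ->
     (match ps' with P0 => ord0 | Pe => i | Ps => inord i.+1 end) = j' ->
     has (fun l => holds a (res to i l)) (prem c ++ [:: (true, false, ps, KU r b);
        (false, true, ps', KU r b)]) ->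
     a (to, (j, KU r b)) -> a (t', (j', KU r b)).
    move=> e1 e2; rewrite has_cat hprem /= orbF /holds /res /= in0 e1 e2 (nsuc _ e).
    by case: (a (to, _)); case: (a (t', _)).
  have first : i = 0 :> nat -> forall b, (delta c).2 r = Push b \/ (delta c).2 r = Rep b ->
      a (t', (i, KU r (Some b))).
    move=> i0 b H; have -> : i = ord0 by apply: val_inj.
    have hl : lits (inr (inr (inl (c, r)))) (telem to) (pelem (ord0 : 'I_n)) =
        Some (rcons (prem c) (false, true, P0, KU r (Some b))).
      by rewrite /lits lt; case: H => ->.
    by have := cl _ _ _ _ hl; rewrite has_rcons hprem orbF /holds /res (nsuc _ e) /=; case: (a _).
  rewrite /do_ops; case E : ((delta c).2 r) => [||b|b] /=.
  - have := @cl to i (inr (inr (inr (c, r, onth ((conf w t).2 r) i)))) _.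
    rewrite /lits lt E => /(_ _ erefl) /keep; apply=> //; apply: h2 => //; lia.
  - have li : r_last (pelem i) = false by rewrite /r_last /pelem /=; lia.
    have := @cl to i (inr (inr (inr (c, r, onth ((conf w t).2 r) i.+1)))) _.
    rewrite /lits lt E li => /(_ _ erefl) /keep; rewrite onth_behead; apply=> //.
    have -> : i.+1 = (inord i.+1 : 'I_n) by rewrite inordK //; lia.
    by rewrite ino; apply: h2; rewrite ?inordK //; lia.
  - have [i0|i0] := posnP i; first by rewrite i0; apply: first => //; left.
    pose j : 'I_n := inord i.-1; have ji : i.-1 = j by rewrite inordK //; have := ltn_ord i; lia.
    have lj : r_last (pelem j) = false by rewrite /r_last /pelem /= -ji; have := ltn_ord i; lia.
    have := @cl to j (inr (inr (inr (c, r, onth ((conf w t).2 r) j)))) _.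
    rewrite /lits lt E lj => /(_ _ erefl).
    rewrite has_cat hprem /= orbF /holds /res /= in0 (nsuc _ e) h2 //; last by lia.
    have -> : (inord j.+1 : 'I_n) = i.
      by apply: val_inj; rewrite /= inordK -ji; have := ltn_ord i; lia.
    have -> : onth (b :: (conf w t).2 r) i = onth ((conf w t).2 r) j by rewrite -ji -{1}(prednK i0).
    by case: (a _).
  - have [i0|i0] := posnP i; first by rewrite i0; apply: first => //; right.
    have fi : r_first (pelem i) = false by rewrite /r_first /pelem /=; lia.
    have := @cl to i (inr (inr (inr (c, r, onth ((conf w t).2 r) i)))) _.
    rewrite /lits lt E fi => /(_ _ erefl) /keep.
    have -> : onth (b :: behead ((conf w t).2 r)) i = onth ((conf w t).2 r) i.
      by rewrite -{1}(prednK i0) /= onth_behead prednK.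
    by apply=> //; apply: h2 => //; lia.
have [_ h] := inv N (ltnSn N).
have hb : a (ord_max, (ord0, KU rV (onth ((conf w N).2 rV) 0))) := h ord_max rV ord0 erefl (ltnSn N).
apply/eqP; rewrite ohead_onth => E; rewrite E in hb.
have lt : r_last (telem (ord_max : 'I_n)) by rewrite /r_last /telem /= eqxx.
have := @cl ord_max ord0 (inl (inr (inord 2))) [:: (true, false, P0, KU rV (Some bad))].
rewrite /lits lt inordK //= => /(_ erefl).
by rewrite orbF /holds /res in0 /= hb.
Qed.

(** [dv] is the common value of the dummies, free because no clause mentions them. *)
Definition tableau (w : bits) (dv : bool) : var -> bool := fun v =>
  match v.2.2 with
  | inl (inl q) => (conf w v.1).1 == q
  | inl (inr (r, c)) => onth ((conf w v.1).2 r) v.2.1 == c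
  | inr _ => dv
  end.

Lemma tableau_complete w dv : size w <= nw -> nw <= N ->
  ohead ((conf w N).2 rV) != Some bad ->
  forall c, c \in clauses -> has (holds (tableau w dv)) c.
Proof.
move=> szw nwN fin c /clausesP[t [i [ct [ls [E ->]]]]].
rewrite has_map.
have ino (j : 'I_n) : inord j = j by apply: val_inj; rewrite /= inordK.
have in0 (j : 'I_n) : inord (j + false) = j by rewrite addn0 ino.
have v0 (j : 'I_n) : r_first (telem j) -> j = 0 :> nat by rewrite /r_first /telem /= => /eqP.
have p0 (j : 'I_n) : r_first (pelem j) -> j = 0 :> nat by rewrite /r_first /pelem /= => /eqP.
have tl : r_last (telem t) = false -> (inord (t + true) : 'I_n) = t.+1 :> nat.
  by rewrite /r_last /telem /= addn1 => h; rewrite inordK //; have := ltn_ord t; lia.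
have pl : r_last (pelem i) = false -> (inord i.+1 : 'I_n) = i.+1 :> nat.
  by rewrite /r_last /pelem /= => h; rewrite inordK //; have := ltn_ord i; lia.
set H := (preim _ _).
(* If [c0] is not the actual context, one of the negated premises is true. *)
have hprem (c0 : ctx) rest : (c0 = ((conf w t).1, tops (conf w t).2) -> has H rest) ->
    has H (prem c0 ++ rest).
  case: c0 => q c0 hr; rewrite has_cat; apply/orP.
  have [eq|nq] := eqVneq (conf w t).1 q; last first.
    by left; apply/orP; left; rewrite /H /= /holds /res /tableau /= in0 eq_sym eqb_id (negbTE nq).
  have [/eqP ec|nc] := boolP (c0 == tops (conf w t).2); first by right; apply: hr; rewrite eq ec.
  left; rewrite /= has_map; apply/orP; right.
  have [r hr'] : exists r, c0 r != ohead ((conf w t).2 r).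
    apply: contrapT => /forallNP h; case/negP: nc; apply/eqP/ffunP => r; rewrite ffunE.
    by apply/eqP; rewrite -[_ == _]negbK; apply/negP; exact: h.
  apply/hasP; exists r; first by rewrite mem_enum.
  rewrite /= /H /= /holds /res /= in0.
  have -> : tableau w dv (t, (ord0, KU r (c0 r))) = (ohead ((conf w t).2 r) == c0 r).
    by rewrite /tableau /= ohead_onth.
  by rewrite (eq_sym (ohead _)) (negbTE hr').
move: E; rewrite /lits; case: ct => [[r|j]|[c0|[[c0 r]|[[c0 r] b]]]].
- case: ifP => // /negbFE /v0 t0.
  have e0 : conf w t = conf w 0 by rewrite t0.
  have [_|rW'] := eqVneq r rW.
    move=> [<-]; rewrite /r_w /pelem /=; case: ifP => iw /=;
      rewrite /H /= /holds /res /tableau /= in0 e0 /conf /= init_stW !onth_map.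
      have [lt|le] := ltnP i (size w); last by rewrite onth_default // !orbT.
      by rewrite (onth_lt false) //=; case: (nth _ _ _); rewrite eqxx ?orbT.
    by rewrite onth_default //=; lia.
  have [_|rX'] := eqVneq r rX.
    by move=> [<-] /=; rewrite /H /= /holds /res /tableau /= in0 e0 /conf /= /init_st eqxx onth_map eqxx.
  have [_|rT'] := eqVneq r rT.
    move=> [<-] /=; rewrite /H /= /holds /res /tableau /= in0 e0 /conf /=.
    by rewrite init_stT onth_map eqxx.
  move=> [<-] /=; rewrite /H /= /holds /res /tableau /= in0 e0 /conf /= /init_st.
  by rewrite (negbTE rW') (negbTE rX') (negbTE rT') onth_nil.
- case: ifP => _.
    case: ifP => // /andP[/v0 t0 _] [<-] /=; rewrite /H /= /holds /res /tableau /= in0.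
    by rewrite t0 /conf /= eqxx.
  case: ifP => _.
    case: ifP => // /andP[/v0 t0 /negbTE /pl hi] [<-] /=; rewrite /H /= /holds /res /tableau /= in0.
    rewrite t0 /conf /= init_stW hi !onth_map.
    have [lt|le] := ltnP i (size w); first by rewrite (onth_lt false).
    by rewrite !onth_default //; lia.
  case: ifP => // /andP[lt /p0 i0] [<-] /=; rewrite /H /= /holds /res /tableau /= in0.
  have -> : t = N :> nat by apply/eqP; exact: lt.
  by rewrite ohead_onth in fin; rewrite (negbTE fin).
- case: ifP => // /andP[/negbTE /tl ht _] [<-]; rewrite -cats1; apply: hprem => ->.
  by rewrite /= /H /= /holds /res /tableau /= ht conf_delta eqxx.
- case: ifP => // /andP[/negbTE /tl ht _]; case E : ((delta c0).2 r) => [||a|a] // [<-];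
    rewrite -cats1; apply: hprem => e;
    by rewrite /= /H /= /holds /res /tableau /= ht conf_delta -e /= /do_ops E eqxx.
- case: ifP => // /tl ht; case E : ((delta c0).2 r) => [||a|a].
  + move=> [<-]; apply: hprem => e; rewrite /= /H /= /holds /res /tableau /= in0 ht conf_delta -e /=.
    by rewrite /do_ops E /=; case: (_ == b).
  + case: ifP => // /pl hi [<-]; apply: hprem => e.
    rewrite /= /H /= /holds /res /tableau /= in0 ht hi conf_delta -e /=.
    by rewrite /do_ops E /= onth_behead; case: (_ == b).
  + case: ifP => // /pl hi [<-]; apply: hprem => e.
    rewrite /= /H /= /holds /res /tableau /= in0 ht hi conf_delta -e /=.
    by rewrite /do_ops E /=; case: (_ == b).
  + case: ifP => // hi [<-]; apply: hprem => e.
    rewrite /= /H /= /holds /res /tableau /= in0 ht conf_delta -e /= /do_ops E /=.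
    have i0 : 0 < i by move: hi; rewrite /r_first /pelem /=; lia.
    by rewrite -{2}(prednK i0) /= onth_behead prednK //; case: (_ == b).
Qed.

End Grid.
End Tableau.

Local Open Scope ring_scope.

(** * The inequality system of a family of tableaux *)

(* Data of a column index relative to a row index: is it zero, is it equal to the
   row index, is it its successor. *)
Definition celem : finType := (bool * bool * bool)%type.

Definition csel (e : celem) (ps : option bool) : bool :=
  match ps with P0 => e.1.1 | Pe => e.1.2 | Ps => e.2 end.

Definition colelem (i j : nat) : celem := (j == 0, j == i, j == i.+1)%N.

Definition sel N (i : 'I_N.+1) (ps : option bool) : 'I_N.+1 :=
  match ps with P0 => ord0 | Pe => i | Ps => inord i.+1 end.

Lemma csel_sel N (i j : 'I_N.+1) ps : (ps = Ps -> i != N :> nat) ->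
  csel (colelem i j) ps = (j == sel i ps).
Proof.
case: ps => [[]|] h /=; [|by [] | by []].
by rewrite -val_eqE /= inordK //; have := h erefl; have := ltn_ord i; lia.
Qed.

Lemma sum_pred1 (V : finType) (R : pzRingType) (v0 : V) (c : R) (f : V -> R) :
  \sum_v (if v == v0 then c else 0) * f v = c * f v0.
Proof.
rewrite (bigD1 v0) //= eqxx big1 ?addr0 // => v /negbTE ->.
by rewrite mul0r.
Qed.

Section System.
Variables (Reg G : finType) (p : prog Reg G) (rX rW rT rV : Reg) (bit : bool -> G) (bad : G).
Local Notation kd := (kd p).
Local Notation ctype := (ctype p).
Local Notation lits := (@lits _ _ p rX rW rT rV bit bad).

Definition rho : finType := ((bool * kd) + (bool * ctype))%type.

(* coefficient, time, depth, kind *)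
Definition term := (int * option bool * option bool * kd)%type.

(** Rows of kind [k] bound the variable from below or above. As [lam] needs no such bounds, its rows
    at the origin carry the two inequalities of [|z| + lam <= 1], and those of [z] are empty. In a
    clause row the count of negated literals collects their contributions [lam]. *)
Definition terms (ro : rho) (te pe : relem) : seq term :=
  match ro with
  | inl (lo, k) =>
      if [&& r_first te, r_first pe & k == KLam p] then
        [:: ((if lo then 1 else -1), P0, P0, KZ p); (1, P0, P0, KLam p)]
      else if [&& r_first te, r_first pe & k == KZ p] then [::]
      else if lo then [:: (-1, Pe, Pe, k)] else [:: (1, Pe, Pe, k); (-1, P0, P0, KLam p)]
  | inr (sg, c) =>
      if lits c te pe is Some ls then
        ((if sg then 1 else -1), P0, P0, KZ p) ::
        (- (count (fun l : rlit p => l.1.1.1) ls)%:Z, P0, P0, KLam p) ::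
        [seq ((if l.1.1.1 then 1 else -1), (if l.1.1.2 then Ps else Pe), l.1.2, l.2)
          | l : rlit p <- ls]
      else [::]
  end.

(** Everything is computed from flags of finite type, so a program can obtain the entry by table
    lookup. The sum is needed because several terms of a row may hit the same column. *)
Definition entry (ro : rho) (te pe : relem) (el et ep : celem) (k : kd) : int :=
  if csel el Pe then
    \sum_(tm <- terms ro te pe)
      (if [&& csel et tm.1.1.2, csel ep tm.1.2 & k == tm.2] then tm.1.1.1 else 0)
  else 0.

Definition rhs (ro : rho) (te pe : relem) : int :=
  if ro is inl (_, k) then ([&& r_first te, r_first pe & k == KLam p] : nat)%:Z else 0.

Section Family.
Variables (N nw L : nat) (x : bits) (th : 'I_L -> bits).
Local Notation n := N.+1.
Local Notation telem := (telem N).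
Local Notation pelem l := (pelem N nw x (th l)).
Local Notation var := (var p N).

Definition vart : finType := prod_ft 'I_L var.
Definition rowt : finType := ('I_L * ('I_n * ('I_n * rho)))%type.

Definition coef (r : rowt) (v : vart) : int :=
  entry r.2.2.2 (telem r.2.1) (pelem r.1 r.2.2.1)
    (colelem r.1 v.1) (colelem r.2.1 v.2.1) (colelem r.2.2.1 v.2.2.1) v.2.2.2.

Definition bound (r : rowt) : int := rhs r.2.2.2 (telem r.2.1) (pelem r.1 r.2.2.1).

Definition sysA : 'M[rat]_(#|rowt|, #|vart|) :=
  \matrix_(i, j) (coef (enum_val i) (enum_val j))%:~R.
Definition sysb : 'cV[rat]_#|rowt| := \col_i (bound (enum_val i))%:~R.

(** Guarantees that [sel] takes successors within the range only, where [inord] is faithful. *)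
Lemma terms_range ro l (t i : 'I_n) tm : tm \in terms ro (telem t) (pelem l i) ->
  (tm.1.1.2 = Ps -> t != N :> nat) /\ (tm.1.2 = Ps -> i != N :> nat).
Proof.
case: ro => [[lo k]|[sg c]] /=.
  case: ifP => _; first by rewrite !inE => /orP[] /eqP ->.
  case: ifP => _ //; case: ifP => _; rewrite !inE; first by move/eqP ->.
  by move=> /orP[] /eqP ->.
case E : lits => [ls|] //; rewrite !inE => /or3P[/eqP -> //|/eqP -> //|/mapP[rl rls -> /=]].
have /allP /(_ _ rls) /and3P[h1 h2 _] := lits_range E; split.
  by case: (rl.1.1.2) h1 => //=.
by move=> e; move: h2; rewrite e.
Qed.

Variable R : realType.

Definition rowval (f : vart -> R) (r : rowt) : R :=
  \sum_(tm <- terms r.2.2.2 (telem r.2.1) (pelem r.1 r.2.2.1))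
    tm.1.1.1%:~R * f (r.1, (sel r.2.1 tm.1.1.2, (sel r.2.2.1 tm.1.2, tm.2))).

Lemma coef_sum f r : \sum_v (coef r v)%:~R * f v = rowval f r.
Proof.
case: r => l [t [i ro]]; rewrite /rowval /coef /entry /=.
transitivity (\sum_(tm <- terms ro (telem t) (pelem l i))
    \sum_v (if v == (l, (sel t tm.1.1.2, (sel i tm.1.2, tm.2))) :> vart
             then tm.1.1.1%:~R else 0) * f v); last by apply: eq_bigr => tm _; rewrite sum_pred1.
rewrite exchange_big /=; apply: eq_bigr => -[l' [t' [i' k]]] _ /=.
rewrite -mulr_suml; congr (_ * _).
case: (boolP (l' == l :> nat)) => hl.
  rewrite rmorph_sum /=; apply: eq_big_seq => tm htm.
  have [h1 h2] := terms_range htm.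
  rewrite !csel_sel //; have -> : ((l', (t', (i', k))) == (l, (sel t tm.1.1.2, (sel i tm.1.2, tm.2))) :> vart) =
     [&& t' == sel t tm.1.1.2, i' == sel i tm.1.2 & k == tm.2].
    by rewrite !xpair_eqE -!val_eqE /= hl.
  by case: ifP.
by rewrite mulr0z big1 // => tm _; rewrite !xpair_eqE -val_eqE /= (negbTE hl).
Qed.

Lemma row_sysA f i : (map_mx ratr sysA *m @vec R vart f) i 0 = rowval f (enum_val i).
Proof.
rewrite -coef_sum mxE (reindex (@enum_rank vart)); last exact: onW_bij (enum_rank_bij _).
by apply: eq_bigr => v _; rewrite !mxE ratr_int enum_rankK.
Qed.

Local Notation lam := (lamv p N).
Local Notation z := (zv p N).
Local Notation cls l := (clauses p rX rW rT rV bit bad N nw x (th l)).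

Lemma res_sel (t i : 'I_n) (l : rlit p) :
  res t i l = (l.1.1.1, (sel t (if l.1.1.2 then Ps else Pe), (sel i l.1.2, l.2))).
Proof.
rewrite /res /sel; congr (_, (_, _)); case: (l.1.1.2); rewrite ?addn1 ?addn0 //.
by apply: val_inj; rewrite /= inordK.
Qed.

Lemma rowval_clause f l (t i : 'I_n) sg c ls : lits c (telem t) (pelem l i) = Some ls ->
  rowval f (l, (t, (i, inr (sg, c)))) =
  (if sg then 1 else -1) * f (l, z) - cls_val lam (fun w => f (l, w)) (map (res t i) ls).
Proof.
move=> E; rewrite /rowval /= E !big_cons /= big_map /cls_val big_map.
have -> : ((if sg then 1 else -1 : int)%:~R : R) = if sg then 1 else -1 by case: sg.
congr (_ + _).
elim: ls {E} => [|a ls IH]; first by rewrite !big_nil /= oppr0 mul0r addr0 oppr0.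
rewrite !big_cons opprD -IH /lit_val !res_sel /=.
case: (a.1.1.1) => /=; rewrite ?add1n ?add0n; last by rewrite mulrN1z; ring.
by rewrite intS opprD rmorphD /=; ring.
Qed.

Lemma sysP f : polyhedron (map_mx ratr sysA) (map_mx ratr sysb) (@vec R vart f) <->
  prodQ (fun l => @blockQ R _ lam z (cls l)) f.
Proof.
have lb i : (map_mx ratr sysb : 'cV[R]_#|rowt|) i 0 = (bound (enum_val i))%:~R.
  by rewrite !mxE ratr_int.
have zl : lam != z by [].
split=> [H l|H i].
  have rw r : rowval f r <= (bound r)%:~R.
    by have := H (enum_rank r); rewrite row_sysA lb enum_rankK.
  have h1 := rw (l, (ord0, (ord0, inl (true, KLam p)))).
  have h2 := rw (l, (ord0, (ord0, inl (false, KLam p)))).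
  rewrite /rowval /bound /= /r_first /= ?eqxx !big_cons big_nil /= in h1 h2.
  have h1' : f (l, z) + f (l, lam) <= 1 by move: h1; rewrite /z /lam; lra.
  have h2' : - f (l, z) + f (l, lam) <= 1 by move: h2; rewrite /z /lam; lra.
  split=> //.
    move=> [t [i k]] nl nz.
    have nl' : [&& (t == 0 :> nat), (i == 0 :> nat) & k == KLam p] = false.
      apply/negbTE; move: nl; apply: contra => /and3P[/eqP t0 /eqP i0 /eqP ->].
      by rewrite !xpair_eqE -!val_eqE /= t0 i0 !eqxx.
    have nz' : [&& (t == 0 :> nat), (i == 0 :> nat) & k == KZ p] = false.
      apply/negbTE; move: nz; apply: contra => /and3P[/eqP t0 /eqP i0 /eqP ->].
      by rewrite !xpair_eqE -!val_eqE /= t0 i0 !eqxx.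
    have k1 := rw (l, (t, (i, inl (true, k)))); have k2 := rw (l, (t, (i, inl (false, k)))).
    rewrite /rowval /bound /= /r_first /= nl' nz' !big_cons big_nil /= in k1 k2.
    by apply/andP; split; move: k1 k2; rewrite /lam; lra.
  move=> c /clausesP[t [i [ct [ls [E ->]]]]].
  have k1 := rw (l, (t, (i, inr (true, ct)))); have k2 := rw (l, (t, (i, inr (false, ct)))).
  rewrite !(rowval_clause _ _ E) /bound /= in k1 k2.
  by split; move: k1 k2; lra.
rewrite row_sysA lb; case: (enum_val i) => l [t [j ro]].
have [hc h1 h2 hcl] := H l.
case: ro => [[lo k]|[sg ct]].
  rewrite /rowval /bound /= /r_first /=.
  case: ifP => [_|nl].
    by rewrite !big_cons big_nil /=; case: lo => /=; move: h1 h2; rewrite /z /lam; lra.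
  case: ifP => [_|nz]; first by rewrite big_nil.
  have : 0 <= f (l, (t, (j, k))) <= f (l, lam).
    apply: (hc (t, (j, k))).
      apply/eqP => -[t0 i0 k0]; move: nl; rewrite t0 i0 k0 !eqxx //.
    apply/eqP => -[t0 i0 k0]; move: nz; rewrite t0 i0 k0 !eqxx //.
  by case: lo; rewrite !big_cons big_nil /lam /=; lra.
rewrite /bound /=.
case E : (lits ct (telem t) (pelem l j)) => [ls|]; last by rewrite /rowval /= E big_nil.
rewrite (rowval_clause _ _ E).
have [] := hcl (map (res t j) ls); first by apply/clausesP; exists t, j, ct, ls.
by case: sg; lra.
Qed.

Lemma sys_bounded : bounded (rat_polyhedron R sysA sysb).
Proof.
exists 1 => v Pv i.
have : polyhedron (map_mx ratr sysA) (map_mx ratr sysb) (@vec R vart (coords v)) by rewrite coordK.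
move=> /sysP H.
have -> : v i 0 = coords v (enum_val i) by rewrite /coords enum_valK.
case: (enum_val i) => l w; have Q := H l; have [hc h1 h2 hcl] := Q.
have l0 : 0 <= coords v (l, lam).
  by have := hc (ord0, (ord0, KD p ord0)) isT isT; lra.
have l1 := blockQ_lam Q.
rewrite ler_norml.
have [->|wl] := eqVneq w lam; first by lra.
have [->|wz] := eqVneq w z; first by lra.
by have := hc _ wl wz; lra.
Qed.

Definition sys_polytope : polytope R := Polytope sys_bounded.

End Family.
End System.

Local Close Scope ring_scope.

(** * A library of stack programs *)

Section Library.
Variables Reg S : finType.
Local Notation G := ((bool + S)%type : finType).
Local Notation stacks := (stacks Reg G).
Local Notation prog := (prog Reg G).
Local Notation tops_t := (tops_t Reg G).
Implicit Types (s : stacks) (a b r : Reg) (B : nat).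

Definition sbit (v : bool) : G := inl v.
Definition ubit (g : option G) : option bool := if g is Some (inl v) then Some v else None.

Definition upd s r (v : seq G) : stacks := fun r' => if r' == r then v else s r'.

Lemma upd_same s r v : upd s r v r = v.
Proof. by rewrite /upd eqxx. Qed.

Lemma upd_other s r v r' : r' != r -> upd s r v r' = s r'.
Proof. by rewrite /upd => /negbTE ->. Qed.

Lemma upd_upd s r v v' : upd (upd s r v) r v' = upd s r v'.
Proof. by apply: funext => r'; rewrite /upd; case: eqP. Qed.

Lemma upd_comm s r r' v v' : r != r' -> upd (upd s r v) r' v' = upd (upd s r' v') r v.
Proof.
move=> h; apply: funext => q; rewrite /upd; case: eqP => [->|//].
by rewrite eq_sym (negbTE h).
Qed.

Lemma upd_id s r v : s r = v -> upd s r v = s.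
Proof. by move=> <-; apply: funext => q; rewrite /upd; case: eqP => [->|]. Qed.

Lemma bigS B (p q : prog) s s1 s2 : big B p s s1 -> big B q s1 s2 -> big B (Seq p q) s s2.
Proof. by move=> h1 h2; exists s1. Qed.

Lemma big_while B (tst : tops_t -> bool) (p : prog) (F : nat -> stacks) k : k <= B ->
  (forall i, i < k -> tst (tops (F i)) /\ big B p (F i) (F i.+1)) ->
  ~~ tst (tops (F k)) -> big B (While tst p) (F 0) (F k).
Proof.
move=> kB; exists k => //; elim: k F H H0 {kB} => [|k IH] F H H0 //=.
have [h1 h2] := H 0 isT; split=> //; exists (F 1); split=> //.
by apply: (IH (fun i => F i.+1)) => // i ik; apply: H.
Qed.

Definition nop : prog := Do (fun _ _ => Keep).

Lemma big_nop B s : big B nop s s.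
Proof. by []. Qed.

Definition nonempty a : tops_t -> bool := fun tp => tp a != None.

Lemma nonempty_tops a s : nonempty a (tops s) = (s a != [::]).
Proof. by rewrite /nonempty ffunE; case: (s a). Qed.

Definition pour_act a (pf : G -> Reg -> option G) : tops_t -> Reg -> op G :=
  fun tp r => if r == a then Pop else
    if tp a is Some x then (if pf x r is Some y then Push y else Keep) else Keep.

(** All transfers between stacks are instances. One pour reverses the order, which is why [COPYF]
    consists of two. *)
Definition POUR a pf : prog := While (nonempty a) (Do (pour_act a pf)).

Lemma big_pour B a pf s : size (s a) <= B ->
  big B (POUR a pf) s
    (fun r => if r == a then [::] else catrev (pmap (pf^~ r) (s a)) (s r)).
Proof.
move=> sB; exists (size (s a)) => //; move: {sB} (erefl (s a)).
move: {2 3 4}(s a) => xs; elim: xs s => [|x xs IH] s sa /=.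
  rewrite nonempty_tops sa; split=> //; apply: funext => r.
  by case: eqP => [->|].
rewrite nonempty_tops sa; split=> //.
exists (do_ops (pour_act a pf (tops s)) s); split=> //.
have E := IH (do_ops (pour_act a pf (tops s)) s); rewrite /do_ops /pour_act eqxx /= in E.
rewrite {1}sa /= in E; have {}E := E erefl.
suff <- : (fun r => if r == a then [::] else catrev (pmap (pf^~ r) xs)
    (apply_op (if r == a then Pop else if tops s a is Some x then
       (if pf x r is Some y then Push y else Keep) else Keep) (s r))) =
    (fun r => if r == a then [::] else catrev (oapp (cons^~ (pmap (pf^~ r) xs)) (pmap (pf^~ r) xs) (pf x r)) (s r)).
  exact: E.
apply: funext => r; case: eqP => // _; rewrite ffunE sa /=.
by case: (pf x r).
Qed.

Definition MOVEF a b (f : G -> G) : prog := POUR a (fun x r => if r == b then Some (f x) else None).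

Lemma big_movef B a b f s : a != b -> size (s a) <= B ->
  big B (MOVEF a b f) s (upd (upd s a [::]) b (catrev (map f (s a)) (s b))).
Proof.
move=> ab sB; have := big_pour (fun x r => if r == b then Some (f x) else None) sB.
congr big; apply: funext => r; rewrite /upd.
have [->|ra] := eqVneq r a; first by rewrite (negbTE ab).
case: eqP => [->|_]; first by congr catrev; elim: (s a) => //= x l ->.
by elim: (s a).
Qed.

Definition MOVE a b : prog := MOVEF a b id.

Lemma big_move B a b s : a != b -> size (s a) <= B ->
  big B (MOVE a b) s (upd (upd s a [::]) b (catrev (s a) (s b))).
Proof. by move=> ab sB; have := big_movef id ab sB; rewrite map_id. Qed.

Definition CLEAR a : prog := POUR a (fun _ _ => None).

Lemma big_clear B a s : size (s a) <= B -> big B (CLEAR a) s (upd s a [::]).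
Proof.
move=> sB; have := big_pour (fun _ _ => None) sB.
congr big; apply: funext => r; rewrite /upd; case: eqP => // _.
by elim: (s a).
Qed.

(* [t] is an empty auxiliary stack *)
Definition COPYF a b t (f : G -> G) : prog :=
  Seq (MOVE a t)
    (POUR t (fun x r => if r == a then Some x else if r == b then Some (f x) else None)).

Lemma big_copyf B a b t f s : a != b -> a != t -> b != t -> s t = [::] -> size (s a) <= B ->
  big B (COPYF a b t f) s (upd s b (map f (s a) ++ s b)).
Proof.
move=> ab at' bt st sB; apply: (bigS (big_move at' sB)); rewrite st catrevE cats0.
have := @big_pour B t (fun x r => if r == a then Some x else if r == b then Some (f x) else None)
  (upd (upd s a [::]) t (rev (s a))).
rewrite upd_same size_rev => /(_ sB); congr big; apply: funext => r; rewrite /upd.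
have [->|rt] := eqVneq r t.
  by rewrite eq_sym (negbTE bt) st.
have pm (T T' : Type) (g : T -> T') l : pmap (fun x => Some (g x)) l = map g l by elim: l => //= x l ->.
have [->|ra] := eqVneq r a.
  by rewrite (negbTE ab) pm map_id catrevE cats0 revK.
case: eqP => [->|_]; first by rewrite pm map_rev catrevE revK.
have -> : pmap (fun _ : G => None : option G) (rev (s a)) = [::] by elim: (rev _).
by [].
Qed.

Definition COPY a b t : prog := COPYF a b t id.

Lemma big_copy B a b t s : a != b -> a != t -> b != t -> s t = [::] -> size (s a) <= B ->
  big B (COPY a b t) s (upd s b (s a ++ s b)).
Proof. by move=> ab at' bt st sB; have := big_copyf id ab at' bt st sB; rewrite map_id. Qed.

Definition act1 a (o : tops_t -> op G) : prog := Do (fun tp r => if r == a then o tp else Keep).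

Lemma big_act1 B a o s : big B (act1 a o) s (upd s a (apply_op (o (tops s)) (s a))).
Proof.
by rewrite /= ; apply: funext => r; rewrite /upd /do_ops; case: eqP => [->|].
Qed.

Definition PUSH a g : prog := act1 a (fun _ => Push g).
Definition POP a : prog := act1 a (fun _ => Pop).
Definition REP a g : prog := act1 a (fun _ => Rep g).

(** During the loop the processed part is on [a'] with the current element on top, where the body
    can read it; the final move restores [a]. *)
Definition FOR a a' (body : prog) : prog :=
  Seq (While (nonempty a)
        (Seq (Do (fun tp r => if r == a then Pop else
                              if r == a' then (if tp a is Some x then Push x else Keep) else Keep)) body))
      (MOVE a' a).

Definition split_at s a a' (xs : seq G) i : stacks :=
  upd (upd s a (drop i xs)) a' (rev (take i xs)).

(** The body is specified only between states whose two loop stacks are overwritten by [split_at],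
    so [Inv] need not describe them. *)
Lemma big_for B a a' body s xs (Inv : nat -> stacks -> Prop) :
  a != a' -> s a = xs -> s a' = [::] -> size xs <= B -> Inv 0 s ->
  (forall i s1, i < size xs -> Inv i s1 -> exists s2,
     big B body (split_at s1 a a' xs i.+1) (split_at s2 a a' xs i.+1) /\ Inv i.+1 s2) ->
  exists2 s2, Inv (size xs) s2 & big B (FOR a a' body) s (upd (upd s2 a xs) a' [::]).
Proof.
move=> aa sa sa' sB I0 H.
(* A choice function strings the states after the iterations into the sequence that [big_while]
   expects. *)
have [F F0 FS] : exists2 F : nat -> stacks, F 0 = s & forall i, i < size xs ->
    Inv i (F i) -> big B body (split_at (F i) a a' xs i.+1) (split_at (F i.+1) a a' xs i.+1) /\
    Inv i.+1 (F i.+1).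
  have /choice[g gP] : forall q : nat * stacks, exists s2, q.1 < size xs -> Inv q.1 q.2 ->
     big B body (split_at q.2 a a' xs q.1.+1) (split_at s2 a a' xs q.1.+1) /\ Inv q.1.+1 s2.
    move=> q; have [h1|h1] := pselect (q.1 < size xs /\ Inv q.1 q.2); last first.
      by exists s => *; case: h1.
    by have [s2 hs] := H _ _ h1.1 h1.2; exists s2.
  pose F := fix F i := if i is j.+1 then g (j, F j) else s.
  by exists F => // i ix Fi; apply: (gP (i, F i)).
have FI i : i <= size xs -> Inv i (F i).
  elim: i => [|i IH] ix; first by rewrite F0.
  by apply: (FS i _ _).2 => //; apply: IH; apply: ltnW.
pose F' i := split_at (F i) a a' xs i.
have a'a : (a' == a) = false by rewrite eq_sym (negbTE aa).
exists (F (size xs)); first exact: FI.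
have -> : s = F' 0.
  by rewrite /F' /split_at F0 drop0 take0 /rev /= upd_id ?upd_id // upd_id.
apply: (bigS (s1 := F' (size xs))).
  apply: big_while => // [i ix|]; last first.
    by rewrite nonempty_tops /F' /split_at upd_other // upd_same drop_size.
  split.
    rewrite nonempty_tops /F' /split_at upd_other // upd_same.
    by rewrite -size_eq0 size_drop subn_eq0 -ltnNge.
  apply: (bigS (s1 := split_at (F i) a a' xs i.+1)); last exact: (FS i ix (FI _ (ltnW ix))).1.
  rewrite /=; apply: funext => r; rewrite /do_ops /F' /split_at.
  have xi : exists x, drop i xs = x :: drop i.+1 xs /\ take i.+1 xs = rcons (take i xs) x.
    case: xs ix {sa sB H FS FI F' F0} => // x0 l ix; exists (nth x0 (x0 :: l) i).
    by rewrite -drop_nth // -take_nth.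
  have [x [e1 e2]] := xi.
  rewrite ffunE; rewrite /upd; have [->|ra'] := eqVneq r a'.
    by rewrite a'a eqxx (negbTE aa) e1 /= e2 rev_rcons.
  by case: eqP => _; rewrite ?e1.
have := @big_move B a' a (F' (size xs)); rewrite a'a => /(_ isT).
have -> : F' (size xs) a' = rev xs by rewrite /F' /split_at upd_same take_size.
have -> : F' (size xs) a = [::] by rewrite /F' /split_at upd_other // upd_same drop_size.
rewrite size_rev => /(_ sB); rewrite catrevE cats0 revK.
congr big; apply: funext => r; rewrite /F' /split_at /upd.
by case: eqP => [->|_]; [rewrite (negbTE aa) | case: eqP].
Qed.

Lemma big_eq B (p : prog) s s1 s2 : big B p s s1 -> s1 = s2 -> big B p s s2.
Proof. by move=> h <-. Qed.

Lemma big_forF B a a' body xs (F : nat -> stacks) :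
  a != a' -> size xs <= B -> (forall i, i <= size xs -> F i a = xs /\ F i a' = [::]) ->
  (forall i, i < size xs ->
     big B body (split_at (F i) a a' xs i.+1) (split_at (F i.+1) a a' xs i.+1)) ->
  big B (FOR a a' body) (F 0) (F (size xs)).
Proof.
move=> aa sB hF H; have [f1 f2] := hF 0 (leq0n _).
have [||s2 -> h] := @big_for B a a' body (F 0) xs (fun i s1 => s1 = F i) aa f1 f2 sB.
- by [].
- by move=> i s1 ix ->; exists (F i.+1); split=> //; apply: H.
have [g1 g2] := hF _ (leqnn _).
by move: h; rewrite (upd_id g1) (upd_id g2).
Qed.

(** * Programs that append a word to an output stack *)

Section Printing.
Variable out : Reg.

(** Only the output changes, and quantification over its previous contents makes the property
    composable. The word ends up reversed, as unloading expects. *)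
Definition Pr B (p : prog) s (w : bits) :=
  forall o, big B p (upd s out o) (upd s out (catrev (map sbit w) o)).

Lemma Pr_nop B s : Pr B nop s [::].
Proof. by []. Qed.

Lemma Pr_seq B p q s w1 w2 : Pr B p s w1 -> Pr B q s w2 -> Pr B (Seq p q) s (w1 ++ w2).
Proof. by move=> h1 h2 o; apply: (bigS (h1 o)); rewrite map_cat catrev_catl. Qed.

Lemma Pr_for B a a' body s xs (w : nat -> bits) :
  a != a' -> a != out -> a' != out -> s a = xs -> s a' = [::] -> size xs <= B ->
  (forall i, i < size xs -> Pr B body (split_at s a a' xs i.+1) (w i)) ->
  Pr B (FOR a a' body) s (flatten [seq w i | i <- iota 0 (size xs)]).
Proof.
move=> aa ao ao' sa sa' sB H o.
have oa : out != a by rewrite eq_sym. have oa' : out != a' by rewrite eq_sym.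
pose X i := catrev (map sbit (flatten [seq w j | j <- iota 0 i])) o.
have [||//|//||s2 -> h] := @big_for B a a' body (upd s out o) xs
    (fun i s1 => s1 = upd s out (X i)) aa.
- by rewrite upd_other.
- by rewrite upd_other.
- move=> i s1 ix ->; exists (upd s out (X i.+1)); split=> //.
  have sp k v : split_at (upd s out v) a a' xs k = upd (split_at s a a' xs k) out v.
    by rewrite /split_at (upd_comm _ _ _ oa) (upd_comm _ _ _ oa').
  rewrite !sp; have := H _ ix (X i); congr big; congr upd.
  by rewrite /X -(addn1 i) iotaD map_cat flatten_cat /= cats0 add0n map_cat catrev_catl.
have e1 : upd (upd s out (X (size xs))) a xs = upd s out (X (size xs)) by apply: upd_id; rewrite upd_other.
have e2 : upd (upd s out (X (size xs))) a' [::] = upd s out (X (size xs)) by apply: upd_id; rewrite upd_other.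
by move: h; rewrite e1 e2.
Qed.

Lemma Pr_let B init body fin s s1 w :
  (forall o, big B init (upd s out o) (upd s1 out o)) -> Pr B body s1 w ->
  (forall o, big B fin (upd s1 out o) (upd s out o)) ->
  Pr B (Seq init (Seq body fin)) s w.
Proof. by move=> h1 h2 h3 o; apply: (bigS (h1 o)); apply: (bigS (h2 o)). Qed.

Definition out_free (T : Type) (f : tops_t -> T) :=
  forall tp tp' : tops_t, (forall r, r != out -> tp r = tp' r) -> f tp = f tp'.

Lemma out_free_upd T (f : tops_t -> T) s o : out_free f -> f (tops (upd s out o)) = f (tops s).
Proof. by move=> h; apply: h => r ro; rewrite !ffunE upd_other. Qed.

Definition PRWfrom (wd : tops_t -> bits) (l : seq nat) : prog :=
  foldr (fun i q => Seq (If (fun tp => i < size (wd tp))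
    (act1 out (fun tp => Push (sbit (nth false (wd tp) i)))) nop) q) nop l.

(** A step pushes a single symbol, so the word is printed bit by bit. Its length is bounded because
    the tops range over a finite type; the word must not depend on the top of the output stack,
    which changes meanwhile. *)
Definition PRW (wd : tops_t -> bits) : prog :=
  PRWfrom wd (iota 0 (\max_(tp : tops_t) size (wd tp))).

Lemma Pr_word B wd s : out_free wd -> Pr B (PRW wd) s (wd (tops s)).
Proof.
move=> free; rewrite /PRW; set m := (X in iota 0 X).
have mle : size (wd (tops s)) <= m by apply: (leq_bigmax (tops s)).
have main k j : size (wd (tops s)) <= j + k ->
    Pr B (PRWfrom wd (iota j k)) s (drop j (wd (tops s))).
  elim: k j => [|k IH] j h; first by rewrite addn0 in h; rewrite drop_oversize //; exact: Pr_nop.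
  move=> o; have -> : PRWfrom wd (iota j k.+1) = Seq (If (fun tp => j < size (wd tp))
      (act1 out (fun tp => Push (sbit (nth false (wd tp) j)))) nop) (PRWfrom wd (iota j.+1 k)) by [].
  have [lt|le] := ltnP j (size (wd (tops s))).
    rewrite (drop_nth false lt).
    apply: (bigS (s1 := upd s out (sbit (nth false (wd (tops s)) j) :: o))).
      rewrite /= (out_free_upd s o free) lt; have := big_act1 B out
        (fun tp => Push (sbit (nth false (wd tp) j))) (upd s out o).
      by rewrite /= (out_free_upd s o free) upd_same upd_upd.
    by apply: (IH j.+1 _ (sbit (nth false (wd (tops s)) j) :: o)); rewrite addSnnS.
  rewrite drop_oversize //; apply: (bigS (s1 := upd s out o)).
    by rewrite /= (out_free_upd s o free) ltnNge le.
  have := IH j.+1 _ o; rewrite (drop_oversize (s := wd (tops s))); last by lia.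
  by apply; lia.
by have := main m 0; rewrite add0n drop0; apply.
Qed.

Definition PRL (T : Type) (f : T -> prog) (l : seq T) : prog := foldr (fun x q => Seq (f x) q) nop l.

Lemma Pr_list B T (f : T -> prog) s (w : T -> bits) l : (forall x, Pr B (f x) s (w x)) ->
  Pr B (PRL f l) s (flatten [seq w x | x <- l]).
Proof. by move=> h; elim: l => [|x l IH] //=; apply: Pr_seq. Qed.

End Printing.

(** * Binary increment *)

Fixpoint incb (u : bits) : bits :=
  match u with
  | [::] => [:: true]
  | true :: u => false :: incb u
  | false :: u => true :: u
  end.

(** The leading ones become zeros and the next bit becomes 1. [Rep] on an empty stack pushes, which
    covers the carry past the last bit. *)
Definition INC c t : prog :=
  Seq (While (fun tp => tp c == Some (sbit true))
        (Do (fun tp r => if r == c then Pop else if r == t then Push (sbit false) else Keep)))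
  (Seq (REP c (sbit true)) (MOVE t c)).

Lemma big_inc B c t s u : c != t -> s c = map sbit u -> s t = [::] -> size u <= B ->
  big B (INC c t) s (upd s c (map sbit (incb u))).
Proof.
move=> ct sc st uB; set n := find negb u.
have tc : t != c by rewrite eq_sym.
have nu : n <= size u by rewrite /n find_size.
have ones i : i < n -> nth false u i = true.
  by move=> h; have := before_find false h => /negbT; rewrite negbK.
pose F i := upd (upd s c (map sbit (drop i u))) t (nseq i (sbit false)).
have -> : s = F 0 by rewrite /F drop0 /= upd_id ?upd_id // upd_id.
apply: (bigS (s1 := F n)).
  apply: big_while; first exact: leq_trans nu uB.
    move=> i ik; have iu : i < size u by apply: leq_trans nu.
    have d : drop i u = true :: drop i.+1 u by rewrite (drop_nth false iu) ones.
    split; first by rewrite ffunE /F upd_other // upd_same d /= eqxx.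
    rewrite /=; apply: funext => r; rewrite /do_ops /F /upd.
    by have [->|rt] := eqVneq r t; [rewrite (negbTE tc) | have [_|rc] := eqVneq r c; rewrite ?d].
  rewrite ffunE /F upd_other // upd_same.
  have [e|lt] := eqVneq n (size u); first by rewrite e drop_size.
  have hn : n < size u by rewrite ltn_neqAle lt.
  rewrite (drop_nth false hn) /=.
  by have := @nth_find _ false negb u; rewrite has_find => /(_ hn) /negbTE ->.
have h1 := big_act1 B c (fun _ => Rep (sbit true)) (F n).
apply: (bigS h1); rewrite /=.
have := @big_move B t c (upd (F n) c (sbit true :: behead (F n c))) tc.
rewrite upd_other // /F upd_same size_nseq => /(_ (leq_trans nu uB)).
congr big; apply: funext => r; rewrite /F drop0 /= /upd.
have [_|rc] := eqVneq r c.
  rewrite eqxx (negbTE ct) catrevE.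
  have -> : rev (nseq n (sbit false)) = nseq n (sbit false).
    by apply: (@eq_from_nth _ (sbit false)); rewrite ?size_rev // => i; rewrite size_nseq => h;
       rewrite nth_rev ?size_nseq // !nth_nseq; do 2 case: ifP.
  have : u = nseq n true ++ drop n u.
    rewrite -{1}(cat_take_drop n u); congr (_ ++ _).
    apply: (@eq_from_nth _ false); rewrite size_takel ?size_nseq // => i ik.
    by rewrite nth_take // nth_nseq ik ones.
  have dn : drop n u = [::] \/ exists v, drop n u = false :: v.
    have [e|lt] := eqVneq n (size u); first by left; rewrite e drop_size.
    have hn : n < size u by rewrite ltn_neqAle lt.
    right; exists (drop n.+1 u); rewrite (drop_nth false hn); congr (_ :: _).
    by have := @nth_find _ false negb u; rewrite has_find => /(_ hn) /negbTE.
  move: (n) (drop n u) dn => k v dn ->; elim: k => [|k IH] /=; last by rewrite -IH.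
  by case: dn => [->|[v' ->]].
by have [_|rt] := eqVneq r t.
Qed.

(** * Simulation of Turing machines *)

Section Simulation.
Variable M : tm.
Local Notation k := (tm_tapes M).+1.
Local Notation mcell := (cell (tm_symbol M)).

Definition mreg : finType := (('I_k + 'I_k) + ('I_k + unit))%type.
Definition mL (j : 'I_k) : mreg := inl (inl j).
Definition mH (j : 'I_k) : mreg := inl (inr j).
Definition mR (j : 'I_k) : mreg := inr (inl j).
Definition mQ : mreg := inr (inr tt).

Variables (e : mreg -> Reg) (einv : Reg -> option mreg).
Hypotheses (eK : pcancel e einv) (einvK : forall r m, einv r = Some m -> e m = r).
Variables (ic : mcell -> G) (dc : G -> mcell) (iq : tm_state M -> G) (dq : G -> tm_state M).
Hypotheses (icK : cancel ic dc) (iqK : cancel iq dq).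

Definition dcell (g : option G) : mcell := if g is Some g then dc g else None.

Definition mcont (c : config M) (m : mreg) : seq G :=
  match m with
  | inl (inl j) => map ic (tape_left (cfg_tape c j))
  | inl (inr j) => [:: ic (tape_head (cfg_tape c j))]
  | inr (inl j) => map ic (tape_right (cfg_tape c j))
  | inr (inr _) => [:: iq (cfg_state c)]
  end.

Definition putM (c : config M) s : stacks :=
  fun r => if einv r is Some m then mcont c m else s r.

Lemma putM_e c s m : putM c s (e m) = mcont c m.
Proof. by rewrite /putM eK. Qed.

Lemma putM_other c s r : einv r = None -> putM c s r = s r.
Proof. by rewrite /putM => ->. Qed.

Lemma putM_upd c s r v : einv r = None -> putM c (upd s r v) = upd (putM c s) r v.
Proof.
move=> h; apply: funext => q; rewrite /putM /upd; case: eqP => [->|_]; first by rewrite h.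
by [].
Qed.

Definition mtrans (tp : tops_t) :=
  if tp (e mQ) is Some g then tm_trans (dq g) [ffun j => dcell (tp (e (mH j)))] else None.

Definition running (tp : tops_t) : bool := mtrans tp.

Definition step_ops (tp : tops_t) (r : Reg) : op G :=
  match einv r, mtrans tp with
  | Some m, Some (q, a) =>
      match m with
      | inl (inl j) => match (a j).2 with MoveL => Pop | MoveR => Push (ic (a j).1) | MoveN => Keep end
      | inl (inr j) => match (a j).2 with
          | MoveL => Rep (ic (dcell (tp (e (mL j))))) | MoveR => Rep (ic (dcell (tp (e (mR j)))))
          | MoveN => Rep (ic (a j).1) end
      | inr (inl j) => match (a j).2 with MoveL => Push (ic (a j).1) | MoveR => Pop | MoveN => Keep end
      | inr (inr _) => Rep (iq q)
      end
  | _, _ => Keep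
  end.

Lemma mtrans_put c s : mtrans (tops (putM c s)) =
  tm_trans (cfg_state c) [ffun i => tape_head (cfg_tape c i)].
Proof.
rewrite /mtrans ffunE putM_e /= iqK; congr tm_trans; apply/ffunP => j.
by rewrite !ffunE putM_e /= icK.
Qed.

Lemma step_ops_put c s :
  do_ops (step_ops (tops (putM c s))) (putM c s) = putM (odflt c (tm_step c)) s.
Proof.
apply: funext => r; rewrite /do_ops /step_ops mtrans_put /tm_step.
case E : (einv r) => [m|]; last by rewrite /putM E.
case T : tm_trans => [[q a]|] /=; last by rewrite /putM E.
have tpE m' : tops (putM c s) (e m') = ohead (mcont c m') by rewrite ffunE putM_e.
rewrite [putM c s r]/putM [putM _ s r]/putM E; case: m {E} => [[j|j]|[j|[]]] //=.
- by case: (a j).2 => //=; case: (tape_left _).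
- have hd (l : seq mcell) : dcell (ohead (map ic l)) = head None l by case: l => //= y l; rewrite icK.
  by rewrite !tpE /= !hd; case: (a j).2.
- by case: (a j).2 => //=; case: (tape_right _).
Qed.

Definition RUN : prog := While running (Do step_ops).

Lemma big_RUN B c s n : tm_step (tm_run n c) = None -> n <= B ->
  big B RUN (putM c s) (putM (tm_run n c) s).
Proof.
move=> h nB; suff [j jn hj] : exists2 j, j <= n &
    loopn running (big B (Do step_ops)) j (putM c s) (putM (tm_run n c) s).
  by exists j; first exact: leq_trans jn nB.
elim: n c h {nB} => [|n IH] c; rewrite ?tm_runS.
  move=> h; exists 0 => //=; split=> //; rewrite /running mtrans_put.
  by move: h; rewrite /tm_run /= /tm_step; case: tm_trans => [[]|].
case E : (tm_step c) => [c'|] /=.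
  move=> /IH [j jn hj]; exists j.+1 => //=; split.
    by rewrite /running mtrans_put; move: E; rewrite /tm_step; case: tm_trans.
  by exists (putM c' s); split=> //; rewrite step_ops_put E.
have -> : tm_run n c = c by elim: n {IH} => // n IH; rewrite tm_runS E.
move=> _; exists 0 => //=; split=> //; rewrite /running mtrans_put.
by move: E; rewrite /tm_step; case: tm_trans => [[]|].
Qed.

(** The clock stack limits the run, so nothing is assumed about halting; a machine that has halted
    idles. *)
Definition RUNC ck : prog :=
  While (nonempty ck) (Do (fun tp r => if r == ck then Pop else step_ops tp r)).

Lemma big_RUNC B ck c s : einv ck = None -> size (s ck) <= B ->
  big B (RUNC ck) (putM c s) (putM (tm_run (size (s ck)) c) (upd s ck [::])).
Proof.
move=> hck sB; exists (size (s ck)) => //.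
move: {sB} (erefl (s ck)); move: {2 3 4}(s ck) => xs; elim: xs c s => [|x xs IH] c s sx.
  by rewrite /= nonempty_tops putM_other // sx; split=> //; rewrite putM_upd // upd_id ?putM_other.
rewrite [size _]/= tm_runS /= nonempty_tops putM_other // sx; split=> //.
exists (putM (odflt c (tm_step c)) (upd s ck xs)); split.
  rewrite /= putM_upd //; apply: funext => r; rewrite /do_ops.
  have [->|rk] := eqVneq r ck; first by rewrite upd_same putM_other // sx.
  by rewrite upd_other // -step_ops_put.
have := IH (odflt c (tm_step c)) (upd s ck xs); by rewrite upd_same upd_upd; apply.
Qed.

Definition CLEARM : prog :=
  While (fun tp => [exists m : mreg, tp (e m) != None])
    (Do (fun _ r => if einv r is Some _ then Pop else Keep)).

Definition clearm s : stacks := fun r => if einv r is Some _ then [::] else s r.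

Lemma big_CLEARM B s : (forall m, size (s (e m)) <= B) -> big B CLEARM s (clearm s).
Proof.
move=> sB; pose n := \max_(m : mreg) size (s (e m)).
pose F i : stacks := fun r => if einv r is Some _ then drop i (s r) else s r.
have -> : s = F 0 by apply: funext => r; rewrite /F drop0; case: (einv r).
have -> : clearm (F 0) = F n.
  apply: funext => r; rewrite /clearm /F; case E : (einv r) => [m|] //.
  by rewrite drop_oversize // -(einvK E) (leq_bigmax m).
apply: big_while; first by apply/bigmax_leqP => m _; exact: sB.
  move=> i ik; split.
    apply: contraTT ik => /existsPn h; rewrite -leqNgt; apply/bigmax_leqP => m _.
    have := h m; rewrite negbK ffunE /F eK; case E : (drop i _) => [|//] _.
    by move/(congr1 size): E; rewrite size_drop /=; lia.
  rewrite /=; apply: funext => r; rewrite /do_ops /F; case: (einv r) => // _ /=.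
  by rewrite -drop1 drop_drop add1n.
apply/existsPn => m; rewrite ffunE /F eK negbK drop_oversize //.
exact: (leq_bigmax m).
Qed.

Definition inbit (g : G) : G := ic (if g is inl b then Some (inl b) else None).

(** The inputs have been copied to the right parts of the tapes, so their first symbols still have
    to be shifted under the heads; an empty part supplies a blank. *)
Definition FINISH : prog := Do (fun tp r =>
  match einv r with
  | Some (inl (inr j)) => Push (ic (dcell (tp (e (mR j)))))
  | Some (inr (inl j)) => Pop
  | Some (inr (inr _)) => Push (iq (tm_start M))
  | _ => Keep
  end).

(* [b] is loaded on the second tape if [two] and if there is a second tape; [t] is
   an empty auxiliary stack. *)
Definition INIT (two : bool) a b t : prog :=
  Seq CLEARM (Seq (COPYF a (e (mR ord0)) t inbit)
    (Seq (if two && (0 < tm_tapes M) then COPYF b (e (mR (inord 1))) t inbit else nop) FINISH)).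

Lemma big_INIT B two a b t s x w : einv a = None -> einv b = None -> einv t = None ->
  a != t -> b != t -> s t = [::] -> s a = map sbit x -> s b = map sbit w ->
  (forall m, size (s (e m)) <= B) -> size x <= B -> size w <= B ->
  big B (INIT two a b t) s (putM (tm_init M (if two then [:: x; w] else [:: x])) s).
Proof.
move=> ha hb ht at' bt st sa sb mB xB wB.
have ne r m : einv r = None -> r != e m by move=> h; apply/eqP => E; rewrite E eK in h.
have en r m : einv r = None -> e m != r by move=> h; rewrite eq_sym ne.
have cm r : einv r = None -> clearm s r = s r by rewrite /clearm => ->.
have fx l : map inbit (map sbit l) = [seq ic (Some (inl v)) | v <- l] by rewrite -map_comp.
apply: (bigS (big_CLEARM mB)).
set s1 := clearm s.
apply: (bigS (@big_copyf B a (e (mR ord0)) t inbit s1 _ _ _ _ _)).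
- exact: ne.
- exact: at'.
- exact: en.
- by rewrite /s1 cm.
- by rewrite /s1 cm // sa size_map.
set s2 := upd _ _ _.
pose s3 := if two && (0 < tm_tapes M) then upd s2 (e (mR (inord 1))) (map inbit (map sbit w)) else s2.
have e10 : 0 < tm_tapes M -> e (mR (inord 1)) != e (mR ord0).
  move=> h; rewrite (inj_eq (pcan_inj eK)); apply/eqP => -[/(congr1 val)] /=.
  by rewrite inordK.
apply: (bigS (s1 := s3)).
  rewrite /s3; case: ifP => // /andP[_ h].
  have s2t : s2 t = [::] by rewrite /s2 upd_other ?ne // /s1 cm.
  have s2b : s2 b = map sbit w by rewrite /s2 upd_other ?ne // /s1 cm.
  have s2e : s2 (e (mR (inord 1))) = [::] by rewrite /s2 upd_other ?e10 // /s1 /clearm eK.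
  have := @big_copyf B b (e (mR (inord 1))) t inbit s2; rewrite (ne _ _ hb) bt (en _ _ ht).
  by rewrite s2t s2b s2e cats0 size_map; apply.
rewrite /=; apply: funext => r; rewrite /do_ops /putM.
have s3o q : (forall j, q != e (mR j)) -> s3 q = s1 q.
  by move=> h; rewrite /s3; case: ifP => _; rewrite /s2 !upd_other.
have s3R j : s3 (e (mR j)) = map ic [seq Some (inl v) | v <- nth [::] (if two then [:: x; w] else [:: x]) j].
  have cl : s1 (e (mR j)) = [::] by rewrite /s1 /clearm eK.
  have [->|j0] := eqVneq j ord0.
    have -> : nth [::] (if two then [:: x; w] else [:: x]) (ord0 : 'I_k) = x by case: (two).
    have s20 : s2 (e (mR ord0)) = map ic [seq Some (inl v) | v <- x].
      by rewrite /s2 upd_same /s1 cm // sa fx /clearm eK cats0 -map_comp.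
    by rewrite /s3; case: ifP => [/andP[_ h]|_] //; rewrite upd_other // eq_sym e10.
  have s2j : s2 (e (mR j)) = [::].
    by rewrite /s2 upd_other // (inj_eq (pcan_inj eK)); apply/eqP => -[] /eqP; rewrite (negbTE j0).
  have jp : 0 < j by rewrite lt0n; apply: contra j0 => /eqP h; apply/eqP/val_inj.
  have tp : 0 < tm_tapes M by have := ltn_ord j; lia.
  rewrite /s3 tp andbT; case: (two); last by rewrite s2j nth_default.
  have [->|j1] := eqVneq j (inord 1).
    by rewrite upd_same inordK // fx -map_comp.
  rewrite upd_other ?s2j; last by rewrite (inj_eq (pcan_inj eK)); apply/eqP => -[] /eqP; rewrite (negbTE j1).
  rewrite nth_default //=; have : j != 1 :> nat.
    by apply: contra j1 => /eqP h; apply/eqP/val_inj; rewrite /= inordK.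
  lia.
case E : (einv r) => [m|] /=; last first.
  by rewrite s3o; [rewrite /s1 cm | move=> j; exact: ne].
have <- := einvK E; case: m {E} => [[j|j]|[j|[]]] /=.
- by rewrite s3o /s1 /clearm ?eK // => i; rewrite (inj_eq (pcan_inj eK)).
- rewrite s3o; last by move=> i; rewrite (inj_eq (pcan_inj eK)).
  by rewrite /s1 /clearm eK ffunE s3R; case: (map _ (nth _ _ _)) => //= y l; rewrite icK.
- by rewrite s3R; case: (map _ (nth _ _ _)).
- by rewrite s3o /s1 /clearm ?eK // => i; rewrite (inj_eq (pcan_inj eK)).
Qed.

Definition outbit (tp : tops_t) : option bool :=
  if tp (e (mH ord0)) is Some g then (if dc g is Some (inl b) then Some b else None) else None.

Definition OUTPUT dst : prog :=
  While (fun tp => outbit tp : bool) (Do (fun tp r =>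
    if r == dst then (if outbit tp is Some b then Push (sbit b) else Keep)
    else if r == e (mH ord0) then Rep (ic (dcell (tp (e (mR ord0)))))
    else if r == e (mR ord0) then Pop else Keep)).

Definition msz (c : config M) D := forall m, size (mcont c m) <= D.

(** Reading the output consumes the simulated tape, so only sizes are claimed about the remaining
    configuration, which suffices for clearing it. *)
Lemma big_OUTPUT B dst c s D : einv dst = None -> msz c D -> D < B -> exists2 c', msz c' D &
  big B (OUTPUT dst) (putM c s)
    (putM c' (upd s dst (catrev (map sbit (tape_output (cfg_tape c ord0))) (s dst)))).
Proof.
move=> hd cD DB; pose tp0 := cfg_tape c ord0.
have szr : size (tape_right tp0) <= D by have := cD (mR ord0); rewrite /= size_map.
suff [j jn [c' c'D hj]] : exists2 j, j <= (size (tape_right tp0)).+1 & exists2 c', msz c' D &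
    loopn (fun tp => outbit tp : bool) (big B (Do (fun tp r =>
    if r == dst then (if outbit tp is Some b then Push (sbit b) else Keep)
    else if r == e (mH ord0) then Rep (ic (dcell (tp (e (mR ord0)))))
    else if r == e (mR ord0) then Pop else Keep))) j (putM c s)
    (putM c' (upd s dst (catrev (map sbit (tape_output tp0)) (s dst)))).
  by exists c' => //; exists j => //; lia.
have dn m : dst != e m by apply/eqP => E; rewrite E eK in hd.
have ob c0 s0 : outbit (tops (putM c0 s0)) =
    if tape_head (cfg_tape c0 ord0) is Some (inl b) then Some b else None.
  by rewrite /outbit ffunE putM_e /= icK; case: (tape_head _) => [[]|].
rewrite /tp0; move: {tp0 szr} (erefl (tape_right (cfg_tape c ord0))).
move: {2 3}(tape_right _) => xs; elim: xs c s cD => [|x xs IH] c s cD xE.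
  case E : (tape_head (cfg_tape c ord0)) => [[b|g]|].
  - exists 1 => //.
    pose c1 := Config (cfg_state c) (fun j => if j == ord0 then
       Tape (tape_left (cfg_tape c ord0)) None [::] else cfg_tape c j).
    exists c1.
      move=> [[j|j]|[j|[]]] /=; first by case: (j == ord0); [exact: (cD (mL ord0)) | exact: (cD (mL j))].
      - exact: (cD (mH ord0)).
      - by case: (j == ord0) => //=; exact: (cD (mR j)).
      - exact: (cD mQ).
    rewrite /= ob E; split=> //; exists (putM c1 (upd s dst (sbit b :: s dst))); split.
      apply: funext => r; rewrite /do_ops putM_upd //.
      have [->|rd] := eqVneq r dst; first by rewrite upd_same putM_other.
      rewrite upd_other // ffunE putM_e /= xE /=.
      have [->|rh] := eqVneq r (e (mH ord0)); first by rewrite !putM_e /= ?eqxx.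
      have [->|rr] := eqVneq r (e (mR ord0)); first by rewrite !putM_e /= ?eqxx ?xE.
      rewrite /putM; case E' : (einv r) => [[[j|j]|[j|[]]]|] //=; case: eqP => // e0.
      + by rewrite e0.
      + by move: rh; rewrite -(einvK E') e0 eqxx.
      + by move: rr; rewrite -(einvK E') e0 eqxx.
    by rewrite ob /= ?eqxx /=; split=> //; rewrite /tape_output E xE.
  - exists 0 => //; exists c => //=; rewrite ob E; split=> //.
    by rewrite /tape_output E /= upd_id.
  - exists 0 => //; exists c => //=; rewrite ob E; split=> //.
    by rewrite /tape_output E /= upd_id.
case E : (tape_head (cfg_tape c ord0)) => [[b|g]|].
- pose c1 := Config (cfg_state c) (fun j => if j == ord0 then
     Tape (tape_left (cfg_tape c ord0)) x xs else cfg_tape c j).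
  have [||j jn [c' c'D hj]] := IH c1 (upd s dst (sbit b :: s dst)).
  + move=> [[j|j]|[j|[]]] /=; first by case: (j == ord0); [exact: (cD (mL ord0)) | exact: (cD (mL j))].
    * exact: (cD (mH ord0)).
    * case: (j == ord0) => /=; last exact: (cD (mR j)).
      by have := cD (mR ord0); rewrite /= xE /=; lia.
    * exact: (cD mQ).
  + by [].
  exists j.+1 => //; exists c' => //=; rewrite ob E; split=> //.
  exists (putM c1 (upd s dst (sbit b :: s dst))); split.
    apply: funext => r; rewrite /do_ops putM_upd //.
    have [->|rd] := eqVneq r dst; first by rewrite upd_same putM_other.
    rewrite upd_other // ffunE putM_e /= xE /= icK.
    have [->|rh] := eqVneq r (e (mH ord0)); first by rewrite !putM_e /= ?eqxx.
    have [->|rr] := eqVneq r (e (mR ord0)); first by rewrite !putM_e /= ?eqxx ?xE.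
    rewrite /putM; case E' : (einv r) => [[[i|i]|[i|[]]]|] //=; case: eqP => // e0.
    + by rewrite e0.
    + by move: rh; rewrite -(einvK E') e0 eqxx.
    + by move: rr; rewrite -(einvK E') e0 eqxx.
  by move: hj; rewrite upd_same upd_upd /= ?eqxx /= /tape_output E xE /=; exact.
- exists 0 => //; exists c => //=; rewrite ob E; split=> //.
  by rewrite /tape_output E /= upd_id.
- exists 0 => //; exists c => //=; rewrite ob E; split=> //.
  by rewrite /tape_output E /= upd_id.
Qed.

Lemma msz_init ws : msz (tm_init M ws) (sumn [seq size w | w <- ws]).+1.
Proof.
have h (j : 'I_k) : size (nth [::] ws j) <= sumn [seq size w | w <- ws].
  have [le|lt] := leqP (size ws) j; first by rewrite nth_default.
  elim: (ws) (nat_of_ord j) lt => // w ws' IH [|i'] /=; first by rewrite leq_addr.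
  by move=> /IH; lia.
move=> [[j|j]|[j|[]]] //=; rewrite size_map size_behead size_map.
by have := h j; lia.
Qed.

Lemma msz_run c D n : msz c D -> 0 < D -> msz (tm_run n c) (D + n).
Proof.
elim: n c D => [|n IH] c D cD D0; first by rewrite addn0.
rewrite tm_runS addnS -addSn; apply: IH => //; rewrite /tm_step.
case: tm_trans => [[q a]|] /= m; last exact: leqW (cD m).
case: m => [[j|j]|[j|[]]] //=; have h1 := cD (mL j); have h2 := cD (mR j);
  rewrite /= !size_map in h1 h2 *; case: (a j).2 => //=; rewrite ?size_behead; lia.
Qed.

Definition CALL two a b t dst : prog :=
  Seq (INIT two a b t) (Seq RUN (Seq (OUTPUT dst) CLEARM)).
Definition CALLC two a b t ck dst : prog :=
  Seq (INIT two a b t) (Seq (RUNC ck) (Seq (OUTPUT dst) CLEARM)).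

Lemma big_finish B D dst c s : einv dst = None -> (forall m, s (e m) = [::]) ->
  msz c D -> D < B ->
  big B (Seq (OUTPUT dst) CLEARM) (putM c s)
    (upd s dst (catrev (map sbit (tape_output (cfg_tape c ord0))) (s dst))).
Proof.
move=> hd cl cD DB; have [c' c'D h] := big_OUTPUT s hd cD DB.
apply: (bigS h); have := @big_CLEARM B (putM c' (upd s dst
  (catrev (map sbit (tape_output (cfg_tape c ord0))) (s dst)))).
have -> : clearm (putM c' (upd s dst (catrev (map sbit (tape_output (cfg_tape c ord0))) (s dst)))) =
    upd s dst (catrev (map sbit (tape_output (cfg_tape c ord0))) (s dst)).
  apply: funext => r; rewrite /clearm /putM; case E : (einv r) => [m|] //.
  by rewrite -(einvK E) upd_other ?cl //; apply/eqP => E'; rewrite -E' eK in hd.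
by apply=> m; rewrite putM_e; apply: (leq_trans (c'D m)); exact: ltnW.
Qed.

Lemma big_CALL B D two a b t dst s x w n out :
  einv a = None -> einv b = None -> einv t = None -> einv dst = None ->
  a != t -> b != t -> s t = [::] -> s a = map sbit x -> s b = map sbit w ->
  (forall m, s (e m) = [::]) ->
  tm_computes_in M n (if two then [:: x; w] else [:: x]) out ->
  (size x + size w).+1 + n <= D -> D < B ->
  big B (CALL two a b t dst) s (upd s dst (catrev (map sbit out) (s dst))).
Proof.
move=> ha hb ht hd at' bt st sa sb cl [h1 <-] nD DB.
apply: (bigS (big_INIT two ha hb ht at' bt st sa sb _ _ _)).
- by move=> m; rewrite cl.
- by lia.
- by lia.
apply: (bigS (big_RUN s h1 _)); first by lia.
apply: (big_finish (D := D)) => //.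
have h0 := msz_init (if two then [:: x; w] else [:: x]).
move=> m; apply: (leq_trans (msz_run n h0 _ m)) => //; apply: leq_trans nD.
by case: (two); rewrite /= ?addn0 ; lia.
Qed.

Lemma big_CALLC B D two a b t ck dst s x w n :
  einv a = None -> einv b = None -> einv t = None -> einv dst = None -> einv ck = None ->
  a != t -> b != t -> ck != dst -> s t = [::] -> s a = map sbit x -> s b = map sbit w ->
  (forall m, s (e m) = [::]) -> size (s ck) = n ->
  (size x + size w).+1 + n <= D -> D < B ->
  big B (CALLC two a b t ck dst) s (upd (upd s ck [::]) dst (catrev (map sbit
    (tape_output (cfg_tape (tm_run n (tm_init M (if two then [:: x; w] else [:: x]))) ord0))) (s dst))).
Proof.
move=> ha hb ht hd hc at' bt cd st sa sb cl szc nD DB.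
apply: (bigS (big_INIT two ha hb ht at' bt st sa sb _ _ _)).
- by move=> m; rewrite cl.
- by lia.
- by lia.
apply: (bigS (big_RUNC _ hc _)); first by lia.
rewrite szc -[s dst](@upd_other s ck [::]); last by rewrite eq_sym.
apply: (big_finish (D := D)) => //.
  by move=> m; rewrite upd_other ?cl //; apply/eqP => E; rewrite -E eK in hc.
have h0 := msz_init (if two then [:: x; w] else [:: x]).
move=> m; apply: (leq_trans (msz_run n h0 _ m)) => //; apply: leq_trans nD.
by case: (two); rewrite /= ?addn0 ; lia.
Qed.

End Simulation.
End Library.

(** * Binary numbers *)

Fixpoint num (u : bits) : nat := if u is b :: u' then b + (num u').*2 else 0.

Definition better (mx : bool) (v th : nat) : bool := if mx then th < v else v < th.

(** Bits arrive least significant first, so a later difference overrides the verdict [fl] reached so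
    far. *)
Definition cmp_step (mx : bool) (a b fl : bool) : bool :=
  if a == b then fl else if mx then a else b.

Fixpoint cmpn (mx : bool) (k : nat) (v th : bits) (fl : bool) : bool :=
  if k is k'.+1 then
    cmpn mx k' (behead v) (behead th) (cmp_step mx (head false v) (head false th) fl)
  else fl.

Lemma num_behead u : num u = head false u + (num (behead u)).*2.
Proof. by case: u. Qed.

Lemma cmpnP mx k v th fl : size v <= k -> size th <= k ->
  cmpn mx k v th fl = if num v == num th then fl else better mx (num v) (num th).
Proof.
elim: k v th fl => [|k IH] v th fl; first by case: v => //; case: th.
move=> hv ht; rewrite /= IH ?size_behead; try by lia.
rewrite (num_behead v) (num_behead th) /cmp_step /better; clear IH hv ht.
move: (num (behead v)) (num (behead th)) => a b.
by case: (head false v); case: (head false th); case: mx; rewrite /=;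
  case: (ltngtP a b) => h; case: eqP => h' //=; lia.
Qed.

Lemma num_nseq0 k u : num (nseq k false ++ u) = 2 ^ k * num u.
Proof. by elim: k => [|k IH] /=; rewrite ?mul1n // IH expnS; lia. Qed.

Lemma num_drop k u : num (drop k u) = num u %/ 2 ^ k.
Proof.
elim: k u => [|k IH] u; first by rewrite drop0 divn1.
case: u => [|b u]; first by rewrite div0n.
rewrite /= IH expnS divnMA; congr (_ %/ _).
by rewrite -muln2 addnC divnMDl // divn_small ?addn0 //; case: b.
Qed.

Lemma num_lt u : num u < 2 ^ size u.
Proof. by elim: u => //= b u IH; rewrite expnS; case: b; lia. Qed.

Lemma num_incb u : num (incb u) = (num u).+1.
Proof. by elim: u => //= -[] u IH //=; rewrite ?IH; lia. Qed.

Definition canonical (u : bits) := (u == [::]) || last false u.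

Lemma num_enc_nat n : num (enc_nat n) = n.
Proof.
rewrite /enc_nat -[RHS]bin_of_natK; case: (bin_of_nat n) => //= q.
elim: q => //= q ->; rewrite /= NatTrec.doubleE; lia.
Qed.

Lemma enc_nat_canonical n : canonical (enc_nat n).
Proof.
rewrite /canonical /enc_nat; case: (bin_of_nat n) => //= q; apply/orP; right.
have h b r : last b (enc_pos r) = last false (enc_pos r) by elim: r b => //= r IH b; rewrite !(IH _).
by elim: q => //= q IH; rewrite h.
Qed.

Lemma canonical_inj u v : canonical u -> canonical v -> num u = num v -> u = v.
Proof.
have pos (b : bool) (u' : bits) : last b u' -> num (b :: u') != 0.
  elim: u' b => [|c u' IH] b; first by case: b.
  by move=> /IH; rewrite /=; lia.
elim: u v => [|a u IH] [|b v] //.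
- by move=> _ /= /(pos b v) /eqP + /esym.
- by move=> /= /(pos a u) /eqP.
rewrite /canonical /= => ha hb E.
have ab : a = b by move: E; case: (a) (b) => -[]; lia.
rewrite ab; congr cons; apply: IH; last by move: E; rewrite ab; lia.
- by case: u ha {E} => //= c u; rewrite /canonical.
- by case: v hb {E} => //= c u'; rewrite /canonical.
Qed.

Lemma enc_natS n : enc_nat n.+1 = incb (enc_nat n).
Proof.
apply: canonical_inj; first exact: enc_nat_canonical; last by rewrite num_incb !num_enc_nat.
have := enc_nat_canonical n; rewrite /canonical.
have h u : last false u -> last false (incb u).
  have k b : last b u -> last false (incb u) || (u == [::]).
    elim: u b => //= -[] u IH b.
      move=> hl; have := IH true hl; rewrite orbF => /orP[|/eqP -> //].
      by case: (incb u).
    by rewrite orbF => hl; case: (u) hl.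
  by case: u k => // a u k hl; have := k a hl; rewrite orbF.
by move=> /orP[/eqP -> //|/h ->]; rewrite orbT.
Qed.

Lemma enc_nat_iter n : enc_nat n = iter n incb [::].
Proof. by elim: n => // n IH; rewrite enc_natS IH. Qed.

Lemma size_incb u : size (incb u) <= (size u).+1.
Proof. by elim: u => //= -[] u IH. Qed.

Lemma size_enc_nat n : size (enc_nat n) <= n.
Proof. by rewrite enc_nat_iter; elim: n => //= n IH; apply: leq_trans (size_incb _) _. Qed.

(** Together with [enc_nat_lt] this places the power of two that scales the thresholds between the
    value and its double. *)
Lemma enc_nat_gt n : 0 < n -> 2 ^ size (enc_nat n) <= n.*2.
Proof.
move=> n0; have := enc_nat_canonical n; rewrite /canonical.
have : enc_nat n != [::].
  by apply/eqP => E; have := num_enc_nat n; rewrite E /=; lia.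
move=> /negbTE -> /=; rewrite -[X in _ <= X.*2](num_enc_nat n).
elim: (enc_nat n) => // b u IH; case: u IH => [|c u] IH; first by case: b.
move=> /IH {}IH; have -> : size [:: b, c & u] = (size (c :: u)).+1 by [].
rewrite expnS; have -> : num [:: b, c & u] = b + (num (c :: u)).*2 by [].
by move: IH; move: (2 ^ _) (num _) => ? ?; case: b; lia.
Qed.

Lemma enc_nat_lt n : n < 2 ^ size (enc_nat n).
Proof. by have := num_lt (enc_nat n); rewrite num_enc_nat. Qed.

(** * The host machine *)

(** Registers are concrete, so comparisons between them are decided by computation: [lk] simplifies
    lookups in updated states, and [steq] compares two states register by register. *)
Ltac lk := repeat match goal with
  | |- context [upd ?s ?r ?v ?r'] =>
      first [ rewrite (upd_same s r v) | rewrite (@upd_other _ _ s r v r' isT) ]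
  end.

Ltac ceq := repeat match goal with
  | |- context [?a == ?b] =>
      first [ rewrite (_ : (a == b) = false); last by [] | rewrite (_ : (a == b) = true); last by [] ]
  end.

Ltac steq :=
  let q := fresh "q" in let E := fresh "E" in apply: funext => q; rewrite /upd;
  repeat match goal with
  | |- context [q == ?a] =>
      case: (q =P a) => [E|/eqP/negbTE E]; [by rewrite ?E ?eqxx; ceq | rewrite ?E; clear E]
  end; try by [].

Ltac run L := eapply bigS; [apply: L => // |].
Ltac runlast L := apply: big_eq; [apply: L => // |].

Section Host.
Variables Ms Mv Ma : tm.

Definition msym (M : tm) : finType := (cell (tm_symbol M) + tm_state M)%type.

Definition hS : finType :=
  (((relem + celem) + unit) + (msym Ms + (msym Mv + msym Ma)))%type.
Definition hG : finType := (bool + hS)%type.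

Definition breg : finType := 'I_40.
Definition hR' : finType := (breg + (mreg Ms + (mreg Mv + mreg Ma)))%type.
Definition hReg : finType := ('I_3 + hR')%type.

Definition hK : nat := 2 + #|hR'|.
(** The three input registers come first because the inputs are written on the first tapes. *)
Definition hix (r : hReg) : 'I_hK.+1 :=
  unsplit (match r with inl i => inl i | inr r => inr (enum_rank r) end : 'I_3 + 'I_#|hR'|).
Definition hrx (j : 'I_hK.+1) : hReg :=
  match split (j : 'I_(3 + #|hR'|)) with inl i => inl i | inr i => inr (enum_val i) end.

Lemma hixK : cancel hix hrx.
Proof. by case=> [i|r]; rewrite /hix /hrx unsplitK // enum_rankK. Qed.

Lemma hrxK : cancel hrx hix.
Proof.
move=> j; have h := splitK (j : 'I_(3 + #|hR'|)); rewrite /hix /hrx.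
by case: (split _) h => i h; rewrite ?enum_valK; exact: h.
Qed.

Definition hin (i : 'I_3) : hReg := inl i.
Definition hb (i : breg) : hReg := inr (inl i).
Local Notation br i := (hb (@Ordinal 40 i isT)).

(* Registers: instance [bX], vertices [bY], ratio [bR], candidate solution [bW],
   threshold [bTH], value of the candidate [bVAL], verdict [bVD], validity [bSV],
   unary sizes [bUN], [bWB] and [bLU], best solution [bBW] with its value [bBV];
   a primed register holds the part of a list that a loop has processed. *)
Definition R0 : hReg := hin ord0.
Definition R1 : hReg := hin (Ordinal (isT : 1 < 3)).
Definition R2 : hReg := hin (Ordinal (isT : 2 < 3)).
Definition bX := br 0.   Definition bY := br 1.   Definition bR := br 2.
Definition bW := br 3.   Definition bTH := br 4.  Definition bVAL := br 5.
Definition bVD := br 6.  Definition bSV := br 7.  Definition bT1 := br 8.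
Definition bT2 := br 9.  Definition bT3 := br 10. Definition bT4 := br 11.
Definition bT5 := br 12. Definition bUN := br 13. Definition bBS := br 14.
Definition bWB := br 15. Definition bLU := br 16. Definition bLV := br 17.
Definition bLV' := br 18. Definition bTT := br 19. Definition bTT' := br 20.
Definition bPP := br 21. Definition bPP' := br 22. Definition bLV2 := br 23.
Definition bLV2' := br 24. Definition bTT2 := br 25. Definition bTT2' := br 26.
Definition bPP2 := br 27. Definition bPP2' := br 28. Definition bCN := br 29.
Definition bBW := br 30. Definition bBV := br 31. Definition bFL := br 32.
Definition bF1 := br 33. Definition bFN := br 34. Definition bST := br 35.
Definition bCT := br 36. Definition bYF := br 37.

Definition gR (e : relem) : hG := inr (inl (inl (inl e))).
Definition gC (e : celem) : hG := inr (inl (inl (inr e))).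
Definition gu : hG := inr (inl (inr tt)).

Definition eS (m : mreg Ms) : hReg := inr (inr (inl m)).
Definition eV (m : mreg Mv) : hReg := inr (inr (inr (inl m))).
Definition eA (m : mreg Ma) : hReg := inr (inr (inr (inr m))).
Definition eSi (r : hReg) := if r is inr (inr (inl m)) then Some m else None.
Definition eVi (r : hReg) := if r is inr (inr (inr (inl m))) then Some m else None.
Definition eAi (r : hReg) := if r is inr (inr (inr (inr m))) then Some m else None.

Lemma eSK : pcancel eS eSi. Proof. by []. Qed.
Lemma eVK : pcancel eV eVi. Proof. by []. Qed.
Lemma eAK : pcancel eA eAi. Proof. by []. Qed.
Lemma eSiK r m : eSi r = Some m -> eS m = r. Proof. by case: r => [//|[//|[k [->]|[|]]]]. Qed.
Lemma eViK r m : eVi r = Some m -> eV m = r. Proof. by case: r => [//|[//|[|[k [->]|]]]]. Qed.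
Lemma eAiK r m : eAi r = Some m -> eA m = r. Proof. by case: r => [//|[//|[|[|k [->]]]]]. Qed.

Definition icS (c : cell (tm_symbol Ms)) : hG := inr (inr (inl (inl c))).
Definition iqS (q : tm_state Ms) : hG := inr (inr (inl (inr q))).
Definition dcS (g : hG) := if g is inr (inr (inl (inl c))) then c else None.
Definition dqS (g : hG) := if g is inr (inr (inl (inr q))) then q else tm_start Ms.
Definition icV (c : cell (tm_symbol Mv)) : hG := inr (inr (inr (inl (inl c)))).
Definition iqV (q : tm_state Mv) : hG := inr (inr (inr (inl (inr q)))).
Definition dcV (g : hG) := if g is inr (inr (inr (inl (inl c)))) then c else None.
Definition dqV (g : hG) := if g is inr (inr (inr (inl (inr q)))) then q else tm_start Mv.
Definition icA (c : cell (tm_symbol Ma)) : hG := inr (inr (inr (inr (inl c)))).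
Definition iqA (q : tm_state Ma) : hG := inr (inr (inr (inr (inr q)))).
Definition dcA (g : hG) := if g is inr (inr (inr (inr (inl c)))) then c else None.
Definition dqA (g : hG) := if g is inr (inr (inr (inr (inr q)))) then q else tm_start Ma.

Lemma icSK : cancel icS dcS. Proof. by []. Qed.
Lemma iqSK : cancel iqS dqS. Proof. by []. Qed.
Lemma icVK : cancel icV dcV. Proof. by []. Qed.
Lemma iqVK : cancel iqV dqV. Proof. by []. Qed.
Lemma icAK : cancel icA dcA. Proof. by []. Qed.
Lemma iqAK : cancel iqA dqA. Proof. by []. Qed.

Local Notation prog := (prog hReg hG).
Local Notation stacks := (stacks hReg hG).
Local Notation sb := (@sbit hS).
Local Notation ubit := (@ubit hS).
Implicit Types (s : stacks) (B : nat).

Local Notation CLEAR := (@CLEAR hReg hS).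
Local Notation MOVE := (@MOVE hReg hS).
Local Notation COPY := (@COPY hReg hS).
Local Notation POP := (@POP hReg hS).
Local Notation INC := (@INC hReg hS).
Local Notation nop := (@nop hReg hS).
Local Notation upd := (@upd hReg hS).

Definition PushB (r : hReg) (b : bool) : prog := PUSH r (sb b : hG).

Variable mx : bool.

(** * Verification of a candidate solution *)

Definition CMP : prog :=
  While (fun tp => (tp bT2 != None) || (tp bT3 != None)) (Do (fun tp r =>
    if (r == bT2) || (r == bT3) then Pop else
    if r == bVD then Rep (sb (cmp_step mx (odflt false (ubit (tp bT2)))
                       (odflt false (ubit (tp bT3))) (odflt false (ubit (tp bVD)))))
    else Keep)).

Lemma big_CMP B s v th fl : s bT2 = map sb v -> s bT3 = map sb th -> s bVD = [:: sb fl] ->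
  size v <= B -> size th <= B ->
  big B CMP s (upd (upd (upd s bT2 [::]) bT3 [::]) bVD
    [:: sb (if num v == num th then fl else better mx (num v) (num th))]).
Proof.
move=> e2 e3 ed vB tB; set k := maxn (size v) (size th).
have kB : k <= B by rewrite geq_max vB tB.
have hv : size v <= k by rewrite leq_maxl.
have ht : size th <= k by rewrite leq_maxr.
rewrite -(cmpnP mx fl hv ht); exists k => //.
have : k = maxn (size v) (size th) by [].
move: {hv ht kB vB tB} k => k.
elim: k v th fl s e2 e3 ed => [|k IH] v th fl s e2 e3 ed kE.
  have [v0 t0] : v = [::] /\ th = [::] by case: v th {e2 e3} kE => [|? ?] [|? ?] //=; lia.
  rewrite v0 t0 /= in e2 e3 *; rewrite /= !ffunE e2 e3; split=> //.
  by steq; rewrite ?e2 ?e3 ?ed.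
rewrite [loopn _ _ _ _ _]/= !ffunE e2 e3; split.
  by case: v th kE {e2 e3} => [|? ?] [|? ?].
eexists; split; first reflexivity.
have obt u : odflt false (ubit (ohead (map sb u))) = head false u by case: u.
set s1 := do_ops _ _.
have s1E : s1 = upd (upd (upd s bT2 (map sb (behead v))) bT3 (map sb (behead th)))
    bVD [:: sb (cmp_step mx (head false v) (head false th) fl)].
  rewrite /s1; apply: funext => r; rewrite /do_ops ed !obt /upd.
  case: (r =P bVD) => [->|_]; first by rewrite ed.
  case: (r =P bT3) => [->|_]; first by rewrite e3 /=; case: (th).
  by case: (r =P bT2) => [->|_]; first by rewrite e2 /=; case: (v).
have := IH (behead v) (behead th) (cmp_step mx (head false v) (head false th) fl) s1.
rewrite s1E => /(_ erefl erefl erefl) H.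
have kk : k = maxn (size (behead v)) (size (behead th)) by rewrite !size_behead; move: kE; lia.
have {H} := H kk; congr loopn.
by apply: funext => r; rewrite /upd; do 3![case: (r =P _) => // _].
Qed.

Lemma big_if B (c : tops_t hReg hG -> bool) (p q : prog) s s' :
  big B (if c (tops s) then p else q) s s' -> big B (If c p q) s s'.
Proof. by rewrite /=; case: ifP. Qed.

Arguments big : simpl never.

Definition CALLs := CALL eS eSi icS dcS iqS dqS true bX bW bT1 bSV.
Definition CALLv := CALL eV eVi icV dcV iqV dqV true bX bW bT1 bT2.

(* The verdict says whether [bW] is a solution of [bX] with a value better than [bTH]. *)
Definition CHECK : prog :=
  Seq CALLs (If (fun tp => tp bSV == Some (sb true))
    (Seq CALLv (Seq (MOVE bT2 bVAL) (Seq (COPY bVAL bT2 bT1) (Seq (COPY bTH bT3 bT1)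
      (Seq (PushB bVD false) CMP)))))
    (PushB bVD false)).

Lemma size_tape_output (M : tm) t ws :
  size (tape_output (cfg_tape (tm_run t (tm_init M ws)) ord0)) <= sumn [seq size w | w <- ws] + t + 2.
Proof.
set c := tm_run _ _.
have lb (l : seq (cell (tm_symbol M))) : size (leading_bits l) <= size l.
  by elim: l => //= -[[b|q]|] l IH //=.
apply: (leq_trans (lb _)) => /=.
(* Trivial codes suffice, since the simulation is used here only to count cells. *)
pose ic (_ : cell (tm_symbol M)) : bool + unit := inl true.
pose iq (_ : tm_state M) : bool + unit := inl true.
have h1 := @msz_init unit M ic iq ws.
have := msz_run t h1 isT (mR ord0); rewrite /= size_map -/c; lia.
Qed.

Lemma size_computes (M : tm) t ws out : tm_computes_in M t ws out ->
  size out <= sumn [seq size w | w <- ws] + t + 2.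
Proof. by move=> [_ <-]; exact: size_tape_output. Qed.

Definition clean s := forall m, s (inr (inr m)) = [::].

Definition checked s (valid : bool) (v th : bits) : stacks :=
  upd (upd (upd s bSV [:: sb valid]) bVAL (if valid then map sb v else [::]))
    bVD [:: sb (valid && better mx (num v) (num th))].

Lemma big_CHECK B D s x w th (valid : bool) (v : bits) ts tv :
  s bX = map sb x -> s bW = map sb w -> s bTH = map sb th ->
  s bT1 = [::] -> s bT2 = [::] -> s bT3 = [::] ->
  s bVD = [::] -> s bSV = [::] -> s bVAL = [::] -> clean s ->
  tm_computes_in Ms ts [:: x; w] [:: valid] ->
  (valid -> tm_computes_in Mv tv [:: x; w] v) ->
  size th <= D -> (size x + size w).+2 + ts <= D -> (size x + size w).+2 + tv <= D -> D < B ->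
  big B CHECK s (checked s valid v th).
Proof.
move=> eX eW eTH e1 e2 e3 ed es ev cl hs hv thD tsD tvD DB.
eapply bigS.
  apply: (big_CALL eSK eSiK icSK iqSK (D := D) (two := true) _ _ _ _ _ _ _ eX eW _ hs) => //.
    by move=> m; exact: cl.
  by lia.
rewrite es /=; set s1 := upd _ _ _.
have s1V : tops s1 bSV = Some (sb valid) by rewrite ffunE /s1 upd_same.
apply: big_if; rewrite s1V; case: valid hv {hs s1V} @s1 => hv s1 /=; last first.
  runlast big_act1; rewrite /s1 /checked /=; lk; rewrite ed.
  by apply: funext => q; rewrite /upd; case: (q =P bVD) => // _; case: (q =P bVAL) => [->|//]; lk.
have {}hv := hv isT; have vD := size_computes hv; rewrite /= addn0 in vD.
eapply bigS.
  apply: (big_CALL eVK eViK icVK iqVK (D := D) (two := true) _ _ _ _ _ _ _ _ _ _ hv) => //; try by rewrite /s1; lk.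
    by move=> m; rewrite /s1; lk; exact: cl.
  by lia.
run big_move; rewrite /s1; lk; rewrite e2 catrevE cats0.
  by rewrite size_rev size_map; lia.
run big_copy; lk; rewrite ?size_rev ?size_map ?ev ?catrevE ?cats0 ?revK ?size_map //; first by lia.
run big_copy; lk; rewrite ?eTH ?size_map //; first by lia.
run big_act1; lk; rewrite e3 cats0 ed /=.
apply: big_eq; [apply: (big_CMP (v := v) (th := th) (fl := false)) => // |]; lk => //; try by lia.
(* On equal values the initial verdict [false] survives, in agreement with the strictness of
   [better]. *)
rewrite /checked /better; case: eqP => [->|_]; rewrite ?ltnn ?if_same /=.
all: steq.
Qed.

(** * Preprocessing *)

(** [2 ^ cL] will bound the ratio of the approximation algorithm; [K1] and [K] are the exponents of
    the length bound for solutions and of the number of rows of the tableau. *)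
Variables cL K1 K : nat.

Definition cgu (_ : hG) : hG := gu.
Definition gus (k : nat) : seq hG := nseq k gu.

Lemma gusD a b : gus (a + b) = gus a ++ gus b.
Proof. exact: nseqD. Qed.

Lemma size_gus a : size (gus a) = a.
Proof. exact: size_nseq. Qed.

Lemma map_cgu (l : seq hG) : map cgu l = gus (size l).
Proof. by elim: l => //= a l ->. Qed.

Lemma catrev_gus a b : catrev (gus a) (gus b) = gus (a + b).
Proof. by elim: a b => // a IH b; rewrite addSnnS -IH. Qed.

Lemma catrev_gus0 a : catrev (gus a) [::] = gus a.
Proof. by rewrite -[X in catrev _ X]/(gus 0) catrev_gus addn0. Qed.

Definition MUL : prog :=
  Seq (FOR bBS bT3 (COPY bUN bT1 bT2)) (Seq (CLEAR bUN) (MOVE bT1 bUN)).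

Lemma big_MUL B s m a : s bUN = gus a -> s bBS = gus m ->
  s bT1 = [::] -> s bT2 = [::] -> s bT3 = [::] -> a <= B -> m <= B -> m * a <= B ->
  big B MUL s (upd s bUN (gus (m * a))).
Proof.
move=> eU eB e1 e2 e3 aB mB maB; pose F i := upd s bT1 (gus (i * a)).
apply: (bigS (s1 := F m)).
  have := @big_forF _ _ B bBS bT3 (COPY bUN bT1 bT2) (gus m) F isT; rewrite size_gus.
  have -> : F 0 = s by rewrite /F /=; apply: upd_id.
  apply=> // i im.
  rewrite /split_at /F; runlast big_copy; lk => //; first by rewrite eU size_gus.
  by rewrite eU mulSn gusD; steq.
rewrite /F; run big_clear; lk; first by rewrite eU size_gus.
runlast big_move; lk; first by rewrite size_gus.
by rewrite catrev_gus0; steq.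
Qed.

Fixpoint POW k : prog := if k is k'.+1 then Seq MUL (POW k') else nop.

Lemma big_POW B s m a k : s bUN = gus a -> s bBS = gus m -> 0 < m ->
  s bT1 = [::] -> s bT2 = [::] -> s bT3 = [::] -> m <= B -> m ^ k * a <= B ->
  big B (POW k) s (upd s bUN (gus (m ^ k * a))).
Proof.
move=> + eB m0 + + + mB; elim: k s a eB => [|k IH] s a eB eU e1 e2 e3 h.
  by rewrite mul1n upd_id.
have mk : 0 < m ^ k by rewrite expn_gt0 m0.
have h1 : m * a <= B by apply: leq_trans h; rewrite expnS; nia.
have h2 : a <= B by nia.
rewrite [POW _]/=; eapply bigS; first by apply: (big_MUL eU eB).
have := IH (upd s bUN (gus (m * a))) (m * a); rewrite upd_upd; lk.
by rewrite expnSr -mulnA in h *; apply.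
Qed.

Fixpoint PUSHN k : prog := if k is k'.+1 then Seq (PUSH bLU (gu : hG)) (PUSHN k') else nop.

Lemma big_PUSHN B s a k : s bLU = gus a -> big B (PUSHN k) s (upd s bLU (gus (k + a))).
Proof.
elim: k s a => [|k IH] s a e; first by rewrite upd_id.
run big_act1; rewrite e; have := IH (upd s bLU (gus a.+1)) a.+1.
by rewrite upd_upd upd_same addSnnS; apply.
Qed.

(** One doubling per bit of the code of [r]: exponential in its length, but constant for a fixed
    ratio. *)
Definition DOUBLE : prog := FOR bR bT3 (Seq (COPY bLU bT1 bT2) (MOVE bT1 bLU)).

Lemma big_DOUBLE B s (r : seq hG) a : s bLU = gus a -> s bR = r ->
  s bT1 = [::] -> s bT2 = [::] -> s bT3 = [::] -> size r <= B -> a * 2 ^ size r <= B ->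
  big B DOUBLE s (upd s bLU (gus (a * 2 ^ size r))).
Proof.
move=> eL eR e1 e2 e3 rB aB; pose F i := upd s bLU (gus (a * 2 ^ i)).
have := @big_forF _ _ B bR bT3 (Seq (COPY bLU bT1 bT2) (MOVE bT1 bLU)) r F isT rB.
have -> : F 0 = s by rewrite /F muln1; apply: upd_id.
apply=> // i im.
have le : a * 2 ^ i <= B.
  by apply: leq_trans aB; rewrite leq_mul2l leq_pexp2l ?orbT // ltnW.
rewrite /split_at /F; run big_copy; lk; rewrite ?size_gus ?e1 ?cats0 //.
runlast big_move; lk; rewrite ?size_gus // catrev_gus.
have -> : a * 2 ^ i + a * 2 ^ i = a * 2 ^ i.+1 by rewrite expnS; lia.
by steq.
Qed.

Definition CALLa := CALLC eA eAi icA dcA iqA dqA false bX bX bT1 bT2 bT3.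

Definition PRE1 : prog :=
  Seq (COPYF bX bBS bT1 cgu) (Seq (COPYF bR bBS bT1 cgu)
  (Seq (PUSH bBS (gu : hG)) (Seq (PUSH bBS (gu : hG))
  (Seq (PUSH bUN (gu : hG)) (Seq (POW K1) (Seq (MOVE bUN bWB)
  (Seq (PUSH bUN (gu : hG)) (Seq (POW K)
  (Seq (PUSHN (2 ^ cL)) DOUBLE))))))))).
Definition PRE2 : prog := Seq (COPY bUN bT2 bT1) (Seq CALLa (MOVE bT3 bW)).
(** The check runs with an empty threshold; its verdict is discarded, and validity and value of the
    start word are kept. *)
Definition PRE3 : prog :=
  Seq CHECK (Seq (CLEAR bVD) (Seq (COPY bW bBW bT1) (Seq (CLEAR bW)
  (Seq (COPY bVAL bBV bT1) (CLEAR bVAL))))).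
Definition PRE : prog := Seq PRE1 (Seq PRE2 PRE3).

Definition S0 : stacks := fun _ => [::].

(** The summand 2 makes the base large enough for pure powers of it to dominate all polynomials, see
    [polyb]. *)
Definition m0 (x r : bits) := size x + size r + 2.
Definition nn x r := m0 x r ^ K.
Definition nwd x r := m0 x r ^ K1.
Definition nlev (r : bits) := 2 ^ (cL + size r).
(* The approximation algorithm is run with a clock, as it need not halt when there is
   no solution. *)
Definition w_start x r :=
  tape_output (cfg_tape (tm_run (nn x r) (tm_init Ma [:: x])) ord0).

Definition in_st (x r : bits) (y : seq hG) : stacks :=
  upd (upd (upd S0 bX (map sb x)) bY y) bR (map sb r).

Definition pre_st x r y (valid : bool) (w v : bits) : stacks :=
  upd (upd (upd (upd (upd (upd (upd (in_st x r y) bBS (gus (m0 x r))) bUN (gus (nn x r)))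
    bWB (gus (nwd x r))) bLU (gus (nlev r))) bSV [:: sb valid]) bBW (map sb w))
    bBV (if valid then map sb v else [::]).

Lemma big_PRE1 B s x r : s bX = map sb x -> s bR = map sb r ->
  s bT1 = [::] -> s bT2 = [::] -> s bT3 = [::] -> s bBS = [::] -> s bUN = [::] ->
  s bWB = [::] -> s bLU = [::] ->
  nn x r <= B -> nwd x r <= B -> nlev r <= B -> m0 x r <= B ->
  big B PRE1 s (upd (upd (upd (upd s bBS (gus (m0 x r))) bUN (gus (nn x r)))
    bWB (gus (nwd x r))) bLU (gus (nlev r))).
Proof.
move=> eX eR e1 e2 e3 eB eU eW eL nB nwB nlB mB.
have m00 : 0 < m0 x r by rewrite /m0; lia.
have xB : size x <= B by move: mB; rewrite /m0; lia.
have rB : size r <= B by move: mB; rewrite /m0; lia.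
have m0E : m0 x r = (size r + size x).+2 by rewrite /m0; lia.
eapply bigS; first by apply: big_copyf => //; rewrite eX size_map.
rewrite map_cgu eX size_map eB cats0.
eapply bigS; first by apply: big_copyf => //; lk => //; rewrite eR size_map.
rewrite upd_upd map_cgu; lk; rewrite eR size_map -gusD.
run big_act1; run big_act1; lk; rewrite !upd_upd ![apply_op (Push _) _]/=.
rewrite -[gu :: gu :: _]/(gus (size r + size x).+2) -m0E.
run big_act1; lk; rewrite [apply_op _ _]/= eU -[[:: gu]]/(gus 1).
eapply bigS; first by apply: (@big_POW B _ (m0 x r) 1 K1) => //; lk => //; rewrite muln1.
rewrite muln1 upd_upd -/(nwd x r).
run big_move; lk; first by rewrite size_gus.
rewrite upd_upd eW catrev_gus0.
run big_act1; lk; rewrite [apply_op _ _]/= -[[:: gu]]/(gus 1).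
eapply bigS; first by apply: (@big_POW B _ (m0 x r) 1 K) => //; lk => //; rewrite muln1.
rewrite muln1 upd_upd -/(nn x r).
eapply bigS; first by apply: (@big_PUSHN B _ 0) => //; lk.
rewrite addn0.
apply: big_eq; first by apply: (@big_DOUBLE B _ (map sb r) (2 ^ cL)) => //; lk => //;
  rewrite ?size_map // -expnD.
by rewrite size_map -expnD -/(nlev r) upd_upd; steq.
Qed.

Lemma big_PRE2 B D s x r : s bX = map sb x -> s bUN = gus (nn x r) -> s bW = [::] ->
  s bT1 = [::] -> s bT2 = [::] -> s bT3 = [::] -> clean s ->
  nn x r + (size x + size x) + 2 <= D -> size (w_start x r) <= D -> D < B ->
  big B PRE2 s (upd s bW (map sb (w_start x r))).
Proof.
move=> eX eU eW e1 e2 e3 cl nD wD DB.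
eapply bigS; first by apply: big_copy => //; rewrite eU size_gus; lia.
rewrite eU e2 cats0.
eapply bigS.
  apply: (@big_CALLC _ _ Ma eA eAi eAK eAiK icA dcA iqA dqA icAK iqAK B D false bX bX bT1 bT2 bT3 _ x x (nn x r)) => //;
    lk => //.
  - by move=> m; lk; exact: cl.
  - by rewrite size_gus.
  by lia.
rewrite -/(w_start x r) upd_upd.
runlast big_move; lk; rewrite e3 catrevE cats0 ?size_rev ?size_map; first by lia.
by rewrite eW catrevE cats0 revK; steq.
Qed.

Lemma big_PRE3 B D s x w (valid : bool) v ts tv : s bX = map sb x -> s bW = map sb w ->
  s bT1 = [::] -> s bT2 = [::] -> s bT3 = [::] -> s bTH = [::] ->
  s bVD = [::] -> s bSV = [::] -> s bVAL = [::] -> s bBW = [::] -> s bBV = [::] -> clean s ->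
  tm_computes_in Ms ts [:: x; w] [:: valid] ->
  (valid -> tm_computes_in Mv tv [:: x; w] v) ->
  (size x + size w).+2 + ts <= D -> (size x + size w).+2 + tv <= D -> D < B ->
  big B PRE3 s (upd (upd (upd (upd s bW [::]) bSV [:: sb valid]) bBW (map sb w))
    bBV (if valid then map sb v else [::])).
Proof.
move=> eX eW e1 e2 e3 et ed es ev ebw ebv cl hs hv h1 h2 DB.
eapply bigS.
  by apply: (big_CHECK (x := x) (w := w) (th := [::]) (D := D) _ _ _ _ _ _ _ _ _ _ hs hv).
rewrite /checked.
have vD : valid -> size v <= D by move=> /hv /size_computes; rewrite /= addn0; lia.
run big_clear; lk => //; first by rewrite /=; lia.
rewrite upd_upd.
run big_copy; lk => //; first by rewrite eW size_map; lia.
rewrite eW ebw cats0; run big_clear; lk => //; first by rewrite eW size_map; lia.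
have vB : size (if valid then map sb v else [::]) <= B.
  by case: (valid) vD => // /(_ isT); rewrite size_map; lia.
run big_copy; lk => //.
rewrite ebv cats0; runlast big_clear; lk => //.
by steq.
Qed.

Lemma big_PRE B D x r y (valid : bool) v ts tv :
  tm_computes_in Ms ts [:: x; w_start x r] [:: valid] ->
  (valid -> tm_computes_in Mv tv [:: x; w_start x r] v) ->
  (size x + size (w_start x r)).+2 + ts <= D -> (size x + size (w_start x r)).+2 + tv <= D ->
  nn x r + (size x + size x) + 2 <= D -> D < B -> nwd x r <= B -> nlev r <= B -> m0 x r <= B ->
  big B PRE (in_st x r y) (pre_st x r y valid (w_start x r) v).
Proof.
move=> hs hv h1 h2 h3 DB nwB nlB mB.
eapply bigS; first by apply: (@big_PRE1 B (in_st x r y) x r) => //; lia.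
eapply bigS; first by apply: (@big_PRE2 B D _ x r) => //; lia.
apply: big_eq; first by apply: (@big_PRE3 B D _ x (w_start x r) valid v ts tv).
by rewrite /pre_st; steq.
Qed.

(** * Building the row and column data *)

(* [floor ((l + 1) * 2 ^ |vb| / 2 ^ |r|)], least significant bit first. *)
Definition thw (l : nat) (r vb : bits) : bits :=
  drop (size r) (nseq (size vb) false ++ enc_nat l.+1).

(** Inside the level loop [bLV'] already contains the current element, so counting it yields
    [l + 1]. Prefixing zeros multiplies by a power of two and popping bits divides with rounding
    down. *)
Definition THP : prog :=
  Seq (FOR bLV' bT3 (INC bTH bT1))
  (Seq (COPYF bBV bTH bT1 (fun _ => sb false : hG)) (FOR bR bT3 (POP bTH))).

Lemma big_INCS B s a t c :
  [/\ a != t, c != a, c != t & c != bT1] -> [/\ a != bT1 & t != bT1] ->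
  s c = [::] -> s t = [::] -> s bT1 = [::] -> size (s a) <= B ->
  big B (FOR a t (INC c bT1)) s (upd s c (map sb (enc_nat (size (s a))))).
Proof.
move=> [h1 h2 h3 h4] [h5 h6] ec et e1 aB.
pose F i := upd s c (map sb (enc_nat i)).
have := @big_forF _ _ B a t (INC c bT1) (s a) F h1 aB.
have -> : F 0 = s by apply: upd_id.
apply=> [i _|i im]; first by rewrite /F !upd_other // eq_sym.
have := @big_inc _ _ B c bT1 (split_at (F i) a t (s a) i.+1) (enc_nat i) h4.
rewrite /split_at /F; have e : bT1 != c by rewrite eq_sym.
have e' : bT1 != a by rewrite eq_sym. have e'' : bT1 != t by rewrite eq_sym.
rewrite !(upd_same, upd_other) // => /(_ erefl e1) H.
have sz : size (enc_nat i) <= B.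
  by apply: (leq_trans (size_enc_nat i)); apply: leq_trans aB; exact: ltnW.
apply: (big_eq (H sz)); rewrite -enc_natS.
by rewrite (upd_comm _ _ _ (_ : t != c)) 1?eq_sym // (upd_comm _ _ _ (_ : a != c)) 1?eq_sym // upd_upd.
Qed.

Lemma big_THP B s l r vb : size (s bLV') = l.+1 -> s bBV = map sb vb -> s bR = map sb r ->
  s bTH = [::] -> s bT1 = [::] -> s bT3 = [::] ->
  l < B -> size vb <= B -> size r <= B ->
  big B THP s (upd s bTH (map sb (thw l r vb))).
Proof.
move=> el ev er et e1 e3 lB vB rB.
eapply bigS; first by apply: big_INCS => //; rewrite el.
eapply bigS; first by apply: big_copyf => //; lk => //; rewrite ev size_map.
rewrite upd_upd; lk; rewrite ev el.
have -> : map (fun _ => sb false : hG) (map sb vb) = map sb (nseq (size vb) false).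
  by elim: (vb) => //= b u ->.
rewrite -map_cat; set u := nseq _ _ ++ _.
pose F i := upd s bTH (map sb (drop i u)).
have := @big_forF _ _ B bR bT3 (POP bTH) (map sb r) F isT; rewrite size_map.
rewrite /F drop0; apply=> // i im; rewrite /split_at.
runlast big_act1; lk; rewrite /apply_op behead_map -drop1 drop_drop add1n.
by steq.
Qed.

Definition getR (g : option hG) : relem :=
  if g is Some (inr (inl (inl (inl e)))) then e else (false, false, None, None, false).
Definition getC (g : option hG) : celem :=
  if g is Some (inr (inl (inl (inr e)))) then e else (false, false, false).

Definition BUILDW : prog :=
  While (nonempty bT2) (Do (fun tp r =>
    if (r == bT2) || (r == bT3) || (r == bT4) || (r == bT5) then Pop else
    if r == bTT then Push (gR (tp bTT == None, false, ubit (tp bT3), ubit (tp bT4), tp bT5 != None))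
    else Keep)).

(** Which element is last is known only after the loop, so its flag is set afterwards. The second
    list is a copy because times and depths range over the same interval. *)
Definition BUILD : prog :=
  Seq (COPY bUN bT2 bT1) (Seq (COPY bX bT3 bT1) (Seq (COPY bTH bT4 bT1) (Seq (COPY bWB bT5 bT1)
  (Seq BUILDW
  (Seq (act1 bTT (fun tp => Rep (gR (let e := getR (tp bTT) in
         (r_first e, true, r_x e, r_th e, r_w e)))))
  (Seq (MOVE bTT bPP) (COPY bPP bTT bT1))))))).

Definition plist N nw x th : seq hG := [seq gR (pelem N nw x th i) | i <- iota 0 N.+1].

Lemma size_plist N nw x th : size (plist N nw x th) = N.+1.
Proof. by rewrite size_map size_iota. Qed.

Lemma big_BUILDW B s n nw x th : s bT2 = gus n -> s bT3 = map sb x -> s bT4 = map sb th ->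
  s bT5 = gus nw -> s bTT = [::] -> size x <= n -> size th <= n -> nw <= n -> n <= B ->
  big B BUILDW s (upd (upd (upd (upd (upd s bT2 [::]) bT3 [::]) bT4 [::]) bT5 [::]) bTT
    (rev [seq gR (i == 0, false, onth x i, onth th i, i < nw) | i <- iota 0 n])).
Proof.
move=> e2 e3 e4 e5 et xn tn nwn nB.
pose F i := upd (upd (upd (upd (upd s bT2 (gus (n - i))) bT3 (map sb (drop i x)))
    bT4 (map sb (drop i th))) bT5 (gus (nw - i))) bTT
    (rev [seq gR (j == 0, false, onth x j, onth th j, j < nw) | j <- iota 0 i]).
have E0 : s = F 0 by rewrite /F !drop0 !subn0; steq.
have -> : upd (upd (upd (upd (upd s bT2 [::]) bT3 [::]) bT4 [::]) bT5 [::]) bTT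
    (rev [seq gR (i == 0, false, onth x i, onth th i, i < nw) | i <- iota 0 n]) = F n.
  by rewrite /F !drop_oversize // subnn; have -> : nw - n = 0 by lia.
rewrite {1}E0 {E0}.
apply: big_while => // [i im|]; last by rewrite nonempty_tops /F; lk; rewrite subnn.
have ob (u : bits) : ubit (ohead (map sb (drop i u))) = onth u i.
  by elim: (u) (i) => [|b u' IH] [|j] //=.
have bh (u : bits) : map sb (drop i.+1 u) = behead (map sb (drop i u)).
  by rewrite behead_map -drop1 drop_drop add1n.
split.
  rewrite nonempty_tops /F; lk; have : 0 < n - i by lia.
  by case: (n - i).
rewrite /big /=; apply: funext => q; rewrite /do_ops !ffunE /F; lk.
rewrite !ob.
have -> : iota 0 i.+1 = rcons (iota 0 i) i by rewrite -(addn1 i) iotaD cats1.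
rewrite map_rcons rev_rcons !bh.
have g1 : gus (n - i.+1) = behead (gus (n - i)) by rewrite subnS; case: (n - i).
have g2 : gus (nw - i.+1) = behead (gus (nw - i)) by rewrite subnS; case: (nw - i).
have g3 : (ohead (gus (nw - i)) != None) = (i < nw).
  by rewrite -subn_gt0; case: (nw - i).
have g4 : (ohead (rev [seq gR (j == 0, false, onth x j, onth th j, j < nw) | j <- iota 0 i]) == None)
    = (i == 0).
  case: (i) => // k; have -> : iota 0 k.+1 = rcons (iota 0 k) k by rewrite -(addn1 k) iotaD cats1.
  by rewrite map_rcons rev_rcons.
rewrite g1 g2 g3 g4 /upd.
case: (q =P bTT) => [->|_] //.
case: (q =P bT5) => [->|_] //; case: (q =P bT4) => [->|_] //.
by case: (q =P bT3) => [->|_] //; case: (q =P bT2).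
Qed.

Lemma big_BUILD B s N nw x th : s bUN = gus N.+1 -> s bX = map sb x -> s bTH = map sb th ->
  s bWB = gus nw -> s bTT = [::] -> s bPP = [::] ->
  s bT1 = [::] -> s bT2 = [::] -> s bT3 = [::] -> s bT4 = [::] -> s bT5 = [::] ->
  size x <= N.+1 -> size th <= N.+1 -> nw <= N.+1 -> N < B ->
  big B BUILD s (upd (upd s bPP (plist N nw x th)) bTT (plist N nw x th)).
Proof.
move=> eU eX eT eW ett epp e1 e2 e3 e4 e5 xn tn nwn nB.
eapply bigS; first by apply: big_copy => //; rewrite eU size_gus.
rewrite eU e2 cats0.
eapply bigS; first by apply: big_copy => //; lk => //; rewrite eX size_map; lia.
lk; rewrite eX e3 cats0.
eapply bigS; first by apply: big_copy => //; lk => //; rewrite eT size_map; lia.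
lk; rewrite eT e4 cats0.
eapply bigS; first by apply: big_copy => //; lk => //; rewrite eW size_gus; lia.
lk; rewrite eW e5 cats0.
eapply bigS; first by apply: (@big_BUILDW B _ N.+1 nw x th) => //; lk.
set u := rev _.
run big_act1; lk; rewrite upd_upd ffunE; lk; rewrite [apply_op _ _]/=.
set g := gR _.
have gE : g :: behead u = rev (plist N nw x th).
  rewrite /g /u /plist; rewrite -(addn1 N) iotaD !map_cat /= !rev_cat /= add0n.
  congr (_ :: _); first by rewrite /pelem /= eqxx.
  rewrite /rev !catrevE ?cats0; congr rev; apply/eq_in_map => i; rewrite mem_iota => im.
  by rewrite /pelem; have -> : (i == N) = false by lia.
rewrite gE.
run big_move; lk; first by rewrite size_rev size_plist.
rewrite epp catrevE cats0 revK.
runlast big_copy; lk => //; first by rewrite size_plist.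
by rewrite cats0; steq.
Qed.

Definition c0 (_ : hG) : hG := gC (false, false, false).
Definition m01 : hG := gC (false, false, true).
Definition m10 : hG := gC (false, true, false).

(* Inside a loop with remaining part [a] and processed part [a'], [dst] becomes the
   list of the positions of all list elements relative to the current one. *)
Definition MARK dst a a' : prog :=
  Seq (COPYF a dst bT1 c0)
  (Seq (act1 dst (fun tp => if tp dst is Some _ then Rep m01 else Keep))
  (Seq (PUSH dst m10)
  (Seq (Do (fun tp r => if r == a' then Pop else
             if r == bT2 then (if tp a' is Some g then Push g else Keep) else Keep))
  (Seq (COPYF a' dst bT1 c0)
  (Seq (Do (fun tp r => if r == bT2 then Pop else
             if r == a' then (if tp bT2 is Some g then Push g else Keep) else Keep))
  (act1 dst (fun tp => Rep (gC (let e := getC (tp dst) in (true, e.1.2, e.2)))))))))).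

Definition clist n t : seq hG := [seq gC (colelem t i) | i <- iota 0 n].

Lemma size_clist n t : size (clist n t) = n.
Proof. by rewrite size_map size_iota. Qed.

Lemma clistE n t (u : seq hG) : t < n ->
  u = nseq t (c0 gu) ++ m10 :: (if nseq (n - t.+1) (c0 gu) is _ :: v then m01 :: v else [::]) ->
  gC (true, (getC (ohead u)).1.2, (getC (ohead u)).2) :: behead u = clist n t.
Proof.
move=> tn ->; set v := (if _ is _ :: v then _ else _).
have sv : size v = n - t.+1 by rewrite /v; case: (n - t.+1) => //= k; rewrite size_nseq.
have nv j : nth gu v j = if j < n - t.+1 then gC (colelem t (t.+1 + j)) else gu.
  rewrite /v; case E : (n - t.+1) => [|k]; first by rewrite nth_nil.
  case: j => [|j] /=; first by rewrite addn0 /m01 /colelem eqxx; congr gC; congr (_, _, _); lia.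
  rewrite nth_nseq ltnS; case: ifP => // _; congr gC; rewrite /colelem; congr (_, _, _); lia.
move: v sv nv => v sv nv.
have sz : size (gC (true, (getC (ohead (nseq t (c0 gu) ++ m10 :: v))).1.2,
    (getC (ohead (nseq t (c0 gu) ++ m10 :: v))).2) :: behead (nseq t (c0 gu) ++ m10 :: v)) = n.
  rewrite -[LHS]/((size (behead (nseq t (c0 gu) ++ m10 :: v))).+1) size_behead size_cat size_nseq.
  by rewrite -[size (m10 :: v)]/((size v).+1) sv; lia.
apply: (@eq_from_nth _ gu); rewrite sz ?size_clist // => i im.
rewrite (nth_map 0) ?size_iota // nth_iota // add0n {sz}.
case: t tn sv nv => [|t] tn sv nv.
  case: i im => [|i] im //=; rewrite nv; have -> : i < n - 1 by lia.
  by rewrite add1n.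
case: i im => [|i] im /=; first by rewrite /colelem; congr gC; congr (_, _, _); lia.
rewrite nth_cat size_nseq; case: ltnP => it.
  by rewrite nth_nseq it; congr gC; rewrite /colelem; congr (_, _, _); lia.
have [->|ne] := eqVneq i t; first by rewrite subnn /= /m10 /colelem; congr gC; congr (_, _, _); lia.
have -> : i - t = (i - t).-1.+1 by lia.
rewrite /= nv; have -> : (i - t).-1 < n - t.+2 by lia.
by congr gC; congr colelem; lia.
Qed.

Definition marked B dst a a' := forall s (xs : seq hG) t, t < size xs ->
  s a = drop t.+1 xs -> s a' = rev (take t.+1 xs) -> s dst = [::] -> s bT1 = [::] -> s bT2 = [::] ->
  size xs <= B -> big B (MARK dst a a') s (upd s dst (clist (size xs) t)).

Lemma big_MARK B dst a a' : [/\ a != a', a != dst & a' != dst] ->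
  [/\ dst != bT1, a != bT1 & a' != bT1] -> [/\ dst != bT2, a != bT2 & a' != bT2] ->
  marked B dst a a'.
Proof.
move=> H1 H2 H3 s xs t tn ea ea' ed e1 e2 xB.
have sz1 : size (s a) <= B by clear H1 H2 H3; rewrite ea size_drop; lia.
have sz2' : size (rev (take t xs)) <= B.
  by clear H1 H2 H3; rewrite size_rev size_take; case: ifP; lia.
case: H1 H2 H3 => [n1 n2 n3] [n4 n5 n6] [n7 n8 n9].
have sy (p q : hReg) : p != q -> q != p by rewrite eq_sym.
have n10 : bT1 != bT2 by [].
have m1 := sy _ _ n1; have m2 := sy _ _ n2; have m3 := sy _ _ n3; have m4 := sy _ _ n4.
have m5 := sy _ _ n5; have m6 := sy _ _ n6; have m7 := sy _ _ n7; have m8 := sy _ _ n8.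
have m9 := sy _ _ n9; have m10' := sy _ _ n10.
have ng := (negbTE n1, negbTE n2, negbTE n3, negbTE n4, negbTE n5, negbTE n6, negbTE n7,
  negbTE n8, negbTE n9, (negbTE m1, negbTE m2, negbTE m3, negbTE m4, negbTE m5, negbTE m6,
  negbTE m7, negbTE m8, negbTE m9), negbTE n10, negbTE m10').
have [g gE] : exists g, rev (take t.+1 xs) = g :: rev (take t xs).
  by case: (xs) tn => // x0 l tn; exists (nth x0 (x0 :: l) t); rewrite (take_nth x0 tn) rev_rcons.
have mc0 (l : seq hG) : map c0 l = nseq (size l) (c0 gu) by elim: l => //= ? ? ->.
apply: (bigS (big_copyf c0 n2 n5 n4 e1 sz1)).
rewrite ea ed cats0 mc0 size_drop.
apply: (bigS (big_act1 _ _ _ _)); rewrite upd_upd ffunE upd_same.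
set v := apply_op _ _.
have vE : v = (if nseq (size xs - t.+1) (c0 gu) is _ :: v then m01 :: v else [::]).
  by rewrite /v; case: (nseq _ _).
rewrite vE; apply: (bigS (big_act1 _ _ _ _)); rewrite upd_upd upd_same [apply_op _ _]/=.
set v1 := m10 :: _.
pose s3 := upd (upd (upd s dst v1) a' (rev (take t xs))) bT2 [:: g].
apply: (bigS (s1 := s3)).
  rewrite /big /=; apply: funext => q; rewrite /do_ops !ffunE /s3 /upd.
  case: (q =P bT2) => [->|_]; first by rewrite ?ng ?eqxx ea' gE /= e2.
  case: (q =P a') => [->|_]; first by rewrite ?ng ?eqxx ea' gE.
  by case: (q =P dst).
have t1 : s3 bT1 = [::] by rewrite /s3 /upd ?ng e1.
have t2 : s3 a' = rev (take t xs) by rewrite /s3 /upd ?ng ?eqxx.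
have t3 : s3 dst = v1 by rewrite /s3 /upd ?ng ?eqxx.
have sz2 : size (s3 a') <= B by rewrite t2.
apply: (bigS (big_copyf c0 n3 n6 n4 t1 sz2)).
rewrite t2 t3 mc0 size_rev size_takel; last exact: ltnW.
apply: (bigS (s1 := upd s dst (nseq t (c0 gu) ++ v1))).
  rewrite /big /=; apply: funext => q; rewrite /do_ops !ffunE /s3 /upd.
  case: (q =P dst) => [->|_]; first by rewrite ?ng ?eqxx.
  case: (q =P bT2) => [->|_]; first by rewrite ?ng ?eqxx /= e2.
  by case: (q =P a') => [->|_]; first by rewrite ?ng ?eqxx /= ea' gE.
apply: big_eq; [exact: big_act1 |]; rewrite upd_upd ffunE upd_same; congr upd.
exact: clistE.
Qed.

Lemma big_MARKl B : marked B bLV2 bLU bLV'. Proof. exact: big_MARK. Qed.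
Lemma big_MARKt B : marked B bTT2 bTT bTT'. Proof. exact: big_MARK. Qed.
Lemma big_MARKp B : marked B bPP2 bPP bPP'. Proof. exact: big_MARK. Qed.

(** * Printing the polytope *)

Definition dbl (w : bits) : bits := flatten [seq [:: true; b] | b <- w].

Lemma delimitE w : delimit w = dbl w ++ [:: false].
Proof. by elim: w => //= b w ->. Qed.

Lemma dbl_cat u v : dbl (u ++ v) = dbl u ++ dbl v.
Proof. by rewrite /dbl map_cat flatten_cat. Qed.

Lemma dbl_flatten (ss : seq bits) : dbl (flatten ss) = flatten [seq dbl u | u <- ss].
Proof. by elim: ss => //= u ss <-; rewrite dbl_cat. Qed.

Local Notation kdc := (kd CHECK).
Local Notation rhoc := (rho CHECK).
Local Notation entryc := (@entry _ _ CHECK bX bW bTH bVD sb (sb false)).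
Local Notation rhsc := (@rhs _ _ CHECK).

(** The time loop runs over a copy of the depth list, whose word data have to be dropped to obtain
    [telem]. *)
Definition strip (e : relem) : relem := (r_first e, r_last e, None, None, false).

(** An entry lies inside its row, which lies inside the matrix; each enclosing [delimit] doubles all
    bits once more. For the same reason a row ends with [[:: true; false]] and the matrix with
    [[:: false]]. *)
Definition eword (z : int) : bits := dbl (dbl (delimit (enc_rat (z%:~R)%R))).

Definition wdA (ro : rhoc) (k : kdc) (tp : tops_t hReg hG) : bits :=
  eword (entryc ro (strip (getR (tp bTT'))) (getR (tp bPP'))
    (getC (tp bLV2')) (getC (tp bTT2')) (getC (tp bPP2')) k).
Definition wdB (ro : rhoc) (tp : tops_t hReg hG) : bits :=
  eword (rhsc ro (strip (getR (tp bTT'))) (getR (tp bPP'))) ++ [:: true; false].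

Definition LEVEL : prog := Seq THP BUILD.
Definition UNLEVEL : prog := Seq (CLEAR bTH) (Seq (CLEAR bPP) (CLEAR bTT)).
(** The nesting of levels, times and depths is the lexicographic order in which [rowt] and [vart]
    are enumerated. *)
Definition GRID (inner : prog) : prog :=
  FOR bLU bLV' (Seq LEVEL (Seq (FOR bTT bTT' (FOR bPP bPP' inner)) UNLEVEL)).

Definition MARKS : prog :=
  Seq (MARK bLV2 bLU bLV') (Seq (MARK bTT2 bTT bTT') (MARK bPP2 bPP bPP')).
Definition UNMARKS : prog := Seq (CLEAR bLV2) (Seq (CLEAR bTT2) (CLEAR bPP2)).

Definition COLS ro : prog :=
  FOR bLV2 bLV2' (FOR bTT2 bTT2' (FOR bPP2 bPP2' (PRL (fun k => PRW R0 (wdA ro k)) (enum kdc)))).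

Definition INA : prog :=
  Seq MARKS (Seq (PRL (fun ro => Seq (COLS ro) (PRW R0 (fun _ => [:: true; false]))) (enum rhoc))
    UNMARKS).
Definition INB : prog := PRL (fun ro => PRW R0 (wdB ro)) (enum rhoc).

(** The dimensions are found by running the same loops with a unary output, which is then converted
    to binary and printed in delimited form. *)
Definition COUNT q : prog :=
  Seq (GRID (PRW bCT (fun _ => nseq q true)))
  (Seq (FOR bCT bT4 (INC bCN bT1))
  (Seq (FOR bCN bT4 (PRW R0 (fun tp => [:: true; odflt false (ubit (tp bT4))])))
  (Seq (PRW R0 (fun _ => [:: false])) (Seq (CLEAR bCT) (CLEAR bCN))))).

Definition FOUT : prog :=
  Seq (COUNT #|rhoc|) (Seq (COUNT #|kdc|)
  (Seq (GRID INA) (Seq (PRW R0 (fun _ => [:: false]))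
  (Seq (GRID INB) (PRW R0 (fun _ => [:: false])))))).

Lemma ohead_take (g : nat -> hG) n i : i < n ->
  ohead (rev (take i.+1 [seq g j | j <- iota 0 n])) = Some (g i).
Proof.
move=> im; have h : i < size [seq g j | j <- iota 0 n] by rewrite size_map size_iota.
by rewrite (take_nth gu h) rev_rcons /= (nth_map 0) ?size_iota // nth_iota.
Qed.

Lemma Pr_forn out B a a' (body : prog) s (xs : seq hG) n (wd : nat -> bits) :
  a != a' -> a != out -> a' != out -> s a = xs -> s a' = [::] -> size xs = n -> n <= B ->
  (forall i, i < n -> Pr out B body (split_at s a a' xs i.+1) (wd i)) ->
  Pr out B (FOR a a' body) s (flatten [seq wd i | i <- iota 0 n]).
Proof. by move=> h1 h2 h3 h4 h5 <- h6 h7; apply: Pr_for. Qed.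

Section Grid.
Variables (B : nat) (x r vb w : bits).
Local Notation n := (nn x r).
Local Notation nw := (nwd x r).
Local Notation L := (nlev r).
Local Notation th l := (thw l r vb).
Local Notation PL l := (plist n.-1 nw x (th l)).
Hypotheses (n0 : 0 < n) (nB : n <= B) (LB : L <= B) (vB : size vb <= B) (rB : size r <= B).
Hypotheses (xn : size x <= n) (nwn : nw <= n).
Hypothesis thn : forall l, l < L -> size (th l) <= n.

Definition ready s := forall q, q != R0 -> q != bCT -> s q = pre_st x r [::] true w vb q.
Definition outr (b : bool) := if b then R0 else bCT.

Lemma ready_out b s o : ready s -> ready (upd s (outr b) o).
Proof. by case: b => h q q1 q2; rewrite upd_other // h. Qed.

Definition levs s l := split_at s bLU bLV' (gus L) l.+1.
Definition levst s l :=
  upd (upd (upd (levs s l) bTH (map sb (th l))) bPP (PL l)) bTT (PL l).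

Lemma levs_out b s l o : levs (upd s (outr b) o) l = upd (levs s l) (outr b) o.
Proof. by rewrite /levs /split_at; case: b; rewrite /outr; steq. Qed.

Lemma levst_out b s l o : levst (upd s (outr b) o) l = upd (levst s l) (outr b) o.
Proof. by rewrite /levst /levs /split_at; case: b; rewrite /outr; steq. Qed.

Lemma nn_pred : n.-1.+1 = n. Proof. exact: prednK. Qed.

Lemma big_LEVEL s l : ready s -> l < L -> big B LEVEL (levs s l) (levst s l).
Proof.
move=> rd lL; rewrite /levst.
have eq q : q != R0 -> q != bCT -> q != bLU -> q != bLV' -> levs s l q = pre_st x r [::] true w vb q.
  by move=> h1 h2 h3 h4; rewrite /levs /split_at !upd_other // rd.
have e0 : size (levs s l bLV') = l.+1.
  by rewrite /levs /split_at upd_same size_rev size_take size_gus; case: ltnP => //; lia.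
move: (levs s l) eq e0 => s1 eq e0.
eapply bigS.
  apply: (@big_THP B s1 l r vb) => //; try by rewrite eq.
  by lia.
apply: big_eq.
  apply: (@big_BUILD B _ n.-1 nw x (th l)); lk; rewrite ?nn_pred //; try by rewrite eq.
  exact: thn.
by [].
Qed.

Lemma big_UNLEVEL s l : ready s -> l < L -> big B UNLEVEL (levst s l) (levs s l).
Proof.
move=> rd lL; rewrite /levst.
have eq q : q != R0 -> q != bCT -> q != bLU -> q != bLV' -> levs s l q = pre_st x r [::] true w vb q.
  by move=> h1 h2 h3 h4; rewrite /levs /split_at !upd_other // rd.
move: (levs s l) eq => s1 eq.
have e1 : s1 bTH = [::] by rewrite eq.
have e2 : s1 bPP = [::] by rewrite eq.
have e3 : s1 bTT = [::] by rewrite eq.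
eapply bigS; first by apply: big_clear; lk; rewrite size_map (leq_trans (thn lL)).
eapply bigS; first by apply: big_clear; lk; rewrite size_plist nn_pred.
apply: big_eq; first by apply: big_clear; lk; rewrite size_plist nn_pred.
by steq.
Qed.

Definition cellst s l t i :=
  split_at (split_at (levst s l) bTT bTT' (PL l) t.+1) bPP bPP' (PL l) i.+1.

Lemma Pr_grid b s inner (wd : nat -> nat -> nat -> bits) : ready s ->
  (forall l t i, l < L -> t < n -> i < n -> Pr (outr b) B inner (cellst s l t i) (wd l t i)) ->
  Pr (outr b) B (GRID inner) s (flatten [seq flatten [seq flatten [seq wd l t i
    | i <- iota 0 n] | t <- iota 0 n] | l <- iota 0 L]).
Proof.
move=> rd H.
have eq q : q != R0 -> q != bCT -> q != bLU -> q != bLV' -> forall l, levs s l q = pre_st x r [::] true w vb q.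
  by move=> h1 h2 h3 h4 l; rewrite /levs /split_at !upd_other // rd.
have no q : q != R0 -> q != bCT -> q != outr b by case: (b).
have szL : size (gus L) = L by exact: size_gus.
apply: (Pr_forn _ _ _ _ _ szL); rewrite ?no //; try by rewrite rd.
move=> l lL; rewrite -/(levs s l).
apply: (Pr_let (s1 := levst s l)).
- by move=> o; rewrite -levs_out -levst_out; apply: big_LEVEL => //; apply: ready_out.
- have szP : size (PL l) = n by rewrite size_plist nn_pred.
  apply: (Pr_forn _ _ _ _ _ szP); rewrite ?no //; try by rewrite /levst; lk; rewrite ?eq.
  move=> t tn.
  apply: (Pr_forn _ _ _ _ _ szP); rewrite ?no //; try by rewrite /split_at /levst; lk; rewrite ?eq.
  by move=> i im; apply: H.
- by move=> o; rewrite -levs_out -levst_out; apply: big_UNLEVEL => //; apply: ready_out.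
Qed.

Definition mst s l t i :=
  upd (upd (upd (cellst s l t i) bLV2 (clist L l)) bTT2 (clist n t)) bPP2 (clist n i).

Lemma Pr_marks s l t i body wd : ready s -> l < L -> t < n -> i < n ->
  Pr R0 B body (mst s l t i) wd -> Pr R0 B (Seq MARKS (Seq body UNMARKS)) (cellst s l t i) wd.
Proof.
move=> rd lL tn im h; apply: (Pr_let _ h) => o.
  rewrite /mst /cellst /levst /levs /split_at.
  have e1 : s bLV2 = [::] by rewrite rd. have e2 : s bTT2 = [::] by rewrite rd.
  have e3 : s bPP2 = [::] by rewrite rd. have e4 : s bT1 = [::] by rewrite rd.
  have e5 : s bT2 = [::] by rewrite rd.
  have szP : size (PL l) = n by rewrite size_plist nn_pred.
  eapply bigS; first by apply: (@big_MARKl B _ (gus L) l); lk; rewrite ?size_gus.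
  eapply bigS; first by apply: (@big_MARKt B _ (PL l) t); lk; rewrite ?szP.
  apply: big_eq; first by apply: (@big_MARKp B _ (PL l) i); lk; rewrite ?szP.
  by rewrite !szP size_gus; steq.
rewrite /mst; have e1 : cellst s l t i bLV2 = [::] by rewrite /cellst /levst /levs /split_at; lk; rewrite rd.
have e2 : cellst s l t i bTT2 = [::] by rewrite /cellst /levst /levs /split_at; lk; rewrite rd.
have e3 : cellst s l t i bPP2 = [::] by rewrite /cellst /levst /levs /split_at; lk; rewrite rd.
move: (cellst s l t i) e1 e2 e3 => s1 e1 e2 e3.
eapply bigS; first by apply: big_clear; lk; rewrite size_clist.
eapply bigS; first by apply: big_clear; lk; rewrite size_clist.
apply: big_eq; first by apply: big_clear; lk; rewrite size_clist.
by steq.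
Qed.

Definition entw ro l t i l' t' i' k :=
  eword (entryc ro (telem n.-1 t) (pelem n.-1 nw x (th l) i)
    (colelem l l') (colelem t t') (colelem i i') k).

Definition colw ro l t i := flatten [seq flatten [seq flatten [seq flatten
    [seq entw ro l t i l' t' i' k | k <- enum kdc]
    | i' <- iota 0 n] | t' <- iota 0 n] | l' <- iota 0 L].

Lemma Pr_cols s l t i ro : ready s -> l < L -> t < n -> i < n ->
  Pr R0 B (COLS ro) (mst s l t i) (colw ro l t i).
Proof.
move=> rd lL tn im.
have e1 : cellst s l t i bLV2' = [::] by rewrite /cellst /levst /levs /split_at; lk; rewrite rd.
have e2 : cellst s l t i bTT2' = [::] by rewrite /cellst /levst /levs /split_at; lk; rewrite rd.
have e3 : cellst s l t i bPP2' = [::] by rewrite /cellst /levst /levs /split_at; lk; rewrite rd.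
have e4 : ohead (cellst s l t i bTT') = Some (gR (pelem n.-1 nw x (th l) t)).
  by rewrite /cellst /split_at; lk; rewrite ohead_take ?nn_pred.
have e5 : ohead (cellst s l t i bPP') = Some (gR (pelem n.-1 nw x (th l) i)).
  by rewrite /cellst /split_at; lk; rewrite ohead_take ?nn_pred.
rewrite /mst; move: (cellst s l t i) e1 e2 e3 e4 e5 => s1 e1 e2 e3 e4 e5.
have szl : size (clist L l) = L by exact: size_clist.
have szt : size (clist n t) = n by exact: size_clist.
have szi : size (clist n i) = n by exact: size_clist.
apply: (Pr_forn _ _ _ _ _ szl) => //; try by lk.
move=> l' ll; apply: (Pr_forn _ _ _ _ _ szt) => //; try by rewrite /split_at; lk.
move=> t' tt; apply: (Pr_forn _ _ _ _ _ szi) => //; try by rewrite /split_at; lk.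
move=> i' ii; apply: Pr_list => k.
set s2 := split_at _ _ _ _ _.
have -> : entw ro l t i l' t' i' k = wdA ro k (tops s2).
  rewrite /wdA !ffunE /s2 /split_at; lk; rewrite e4 e5 !ohead_take //=.
apply: Pr_word => tp tp' E; rewrite /wdA.
by rewrite (E bTT' isT) (E bPP' isT) (E bLV2' isT) (E bTT2' isT) (E bPP2' isT).
Qed.

Lemma Pr_const out s u : Pr out B (PRW out (fun _ => u)) s u.
Proof. by apply: (@Pr_word _ _ out B (fun _ => u) s). Qed.

Lemma Pr_INA s l t i : ready s -> l < L -> t < n -> i < n ->
  Pr R0 B INA (cellst s l t i) (flatten [seq colw ro l t i ++ [:: true; false] | ro <- enum rhoc]).
Proof.
move=> rd lL tn im; apply: Pr_marks => //; apply: Pr_list => ro.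
by apply: Pr_seq; [exact: Pr_cols | exact: Pr_const].
Qed.

Definition rhsw ro l t i :=
  eword (rhsc ro (telem n.-1 t) (pelem n.-1 nw x (th l) i)) ++ [:: true; false].

Lemma Pr_INB s l t i : ready s -> l < L -> t < n -> i < n ->
  Pr R0 B INB (cellst s l t i) (flatten [seq rhsw ro l t i | ro <- enum rhoc]).
Proof.
move=> rd lL tn im; apply: Pr_list => ro.
have -> : rhsw ro l t i = wdB ro (tops (cellst s l t i)).
  by rewrite /wdB !ffunE /cellst /split_at; lk; rewrite !ohead_take ?nn_pred.
by apply: Pr_word => tp tp' E; rewrite /wdB (E bTT' isT) (E bPP' isT).
Qed.

Lemma size_flatten_const (T : Type) (f : T -> bits) l q :
  (forall a, size (f a) = q) -> size (flatten [seq f a | a <- l]) = size l * q.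
Proof. by move=> h; elim: l => //= a l IH; rewrite size_cat h IH mulSn. Qed.

Lemma Pr_COUNT s q : ready s -> s bCT = [::] -> L * (n * (n * q)) <= B ->
  Pr R0 B (COUNT q) s (delimit (enc_nat (L * (n * (n * q))))).
Proof.
move=> rd ec mB o; set m := L * _ in mB *.
have rd0 : ready (upd s R0 o) by apply: (@ready_out true).
have := @Pr_grid false (upd s R0 o) (PRW bCT (fun _ => nseq q true)) (fun _ _ _ => nseq q true) rd0.
move=> /(_ (fun _ _ _ _ _ _ => Pr_const _ _ _)) /(_ [::]).
set W := flatten _.
have szW : size W = m.
  rewrite /W (@size_flatten_const _ _ _ (n * (n * q))) ?size_iota // => l.
  rewrite (@size_flatten_const _ _ _ (n * q)) ?size_iota // => t.
  by rewrite (@size_flatten_const _ _ _ q) ?size_iota // => i; rewrite size_nseq.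
have E q' : q' != R0 -> q' != bCT -> s q' = pre_st x r [::] true w vb q' := rd q'.
rewrite /outr -/bCT => h1.
have e0 : upd (upd s R0 o) bCT [::] = upd s R0 o by apply: upd_id; lk.
rewrite e0 in h1; apply: (bigS h1); rewrite catrevE cats0.
set C := rev _; have szC : size C = m by rewrite size_rev size_map.
eapply bigS.
  by apply: (@big_INCS B _ bCT bT4 bCN) => //; lk; rewrite ?szC // E.
lk; rewrite szC.
have esz : size (map sb (enc_nat m)) <= B by rewrite size_map (leq_trans (size_enc_nat m)).
set u := enc_nat m in esz *.
pose s1 := upd (upd s bCT C) bCN (map sb u).
have -> : upd (upd (upd s R0 o) bCT C) bCN (map sb u) = upd s1 R0 o by rewrite /s1; steq.
have P1 : Pr R0 B (FOR bCN bT4 (PRW R0 (fun tp => [:: true; odflt false (ubit (tp bT4))]))) s1 (dbl u).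
  have -> : dbl u = flatten [seq [:: true; nth false u i] | i <- iota 0 (size (map sb u))].
    rewrite /dbl; congr flatten; apply: (@eq_from_nth _ [::]); rewrite !size_map ?size_iota // => i im.
    by rewrite (nth_map false) // (nth_map 0) ?size_iota // nth_iota.
  apply: Pr_for => //; try by rewrite /s1; lk; rewrite ?E.
  move=> i; rewrite size_map => im; set s2 := split_at _ _ _ _ _.
  have -> : [:: true; nth false u i] = [:: true; odflt false (ubit (tops s2 bT4))].
    rewrite ffunE /s2 /split_at; lk.
    have h : i < size (map sb u) by rewrite size_map.
    by rewrite (take_nth gu h) rev_rcons /= (nth_map false).
  by apply: (@Pr_word _ _ R0 B (fun tp => [:: true; odflt false (ubit (tp bT4))]) s2) => tp tp' E';
     rewrite (E' bT4 isT).
apply: (bigS (P1 o)); eapply bigS; first exact: Pr_const.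
have {P1}: True by []. move=> _; set o' := catrev _ _.
have o'E : o' = catrev (map sb (delimit u)) o by rewrite /o' delimitE map_cat catrev_catl.
rewrite o'E /s1; eapply bigS; first by apply: big_clear; lk; rewrite szC.
apply: big_eq; first by apply: big_clear; lk.
have e1 : s bCN = [::] by rewrite E.
by steq.
Qed.

Definition matA := flatten [seq flatten [seq flatten [seq flatten
    [seq colw ro l t i ++ [:: true; false] | ro <- enum rhoc]
    | i <- iota 0 n] | t <- iota 0 n] | l <- iota 0 L].
Definition matB := flatten [seq flatten [seq flatten [seq flatten
    [seq rhsw ro l t i | ro <- enum rhoc] | i <- iota 0 n] | t <- iota 0 n] | l <- iota 0 L].

Definition polyword : bits :=
  delimit (enc_nat (L * (n * (n * #|rhoc|)))) ++ delimit (enc_nat (L * (n * (n * #|kdc|)))) ++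
  matA ++ [:: false] ++ matB ++ [:: false].

Lemma Pr_FOUT s : ready s -> s bCT = [::] ->
  L * (n * (n * #|rhoc|)) <= B -> L * (n * (n * #|kdc|)) <= B -> Pr R0 B FOUT s polyword.
Proof.
move=> rd ec h1 h2; apply: Pr_seq; first exact: Pr_COUNT.
apply: Pr_seq; first exact: Pr_COUNT.
apply: Pr_seq; first by apply: (@Pr_grid true) => // l t i *; exact: Pr_INA.
apply: Pr_seq; first exact: Pr_const.
apply: Pr_seq; first by apply: (@Pr_grid true) => // l t i *; exact: Pr_INB.
exact: Pr_const.
Qed.

End Grid.

Variable emptyword : bits.

Definition FPROG : prog :=
  Seq (MOVE R0 bX) (Seq (MOVE R1 bR) (Seq PRE
  (If (fun tp => tp bSV == Some (sb true)) FOUT (PRW R0 (fun _ => emptyword))))).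

Lemma input_stacksE (ws : seq bits) : size ws <= 3 ->
  @input_stacks hReg hS hK hix ws = upd (upd (upd S0 R0 (map sb (rev (nth [::] ws 0))))
    R1 (map sb (rev (nth [::] ws 1)))) R2 (map sb (rev (nth [::] ws 2))).
Proof.
move=> sz; apply: funext => q; rewrite /input_stacks.
case: q => [[[|[|[|i]]] hi]|q] //=.
by rewrite nth_default //; apply: leq_trans sz _; rewrite leq_addr.
Qed.

Lemma big_FPROG B D x r (valid : bool) v ts tv :
  tm_computes_in Ms ts [:: x; w_start x r] [:: valid] ->
  (valid -> tm_computes_in Mv tv [:: x; w_start x r] v) ->
  (size x + size (w_start x r)).+2 + ts <= D -> (size x + size (w_start x r)).+2 + tv <= D ->
  nn x r + (size x + size x) + 2 <= D -> D < B -> nwd x r <= B -> nlev r <= B -> m0 x r <= B ->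
  0 < nn x r -> size x <= nn x r -> nwd x r <= nn x r -> 
  (valid -> forall l, l < nlev r -> size (thw l r v) <= nn x r) ->
  nlev r * (nn x r * (nn x r * #|rhoc|)) <= B -> nlev r * (nn x r * (nn x r * #|kdc|)) <= B ->
  exists2 s', big B FPROG (@input_stacks hReg hS hK hix [:: x; r]) s' &
    s' R0 = map sb (rev (if valid then polyword x r v else emptyword)).
Proof.
move=> hs hv h1 h2 h3 DB nwB LB mB n0 xn nwn thn c1 c2.
rewrite input_stacksE //=.
have xB : size x <= B by lia.
have rB : size r <= B by move: mB; rewrite /m0; lia.
have pre := @big_PRE B D x r [::] valid v ts tv hs hv h1 h2 h3 DB nwB LB mB.
set W := (if valid then _ else _).
exists (upd (pre_st x r [::] valid (w_start x r) v) R0 (catrev (map sb W) [::])); last first.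
  by rewrite upd_same catrevE cats0 map_rev.
eapply bigS; first by apply: big_move => //; lk; rewrite size_map size_rev.
lk; eapply bigS; first by apply: big_move => //; lk; rewrite size_map size_rev.
lk; rewrite !map_rev !catrevE !revK !cats0.
set si := upd _ _ _; have -> : si = in_st x r [::] by rewrite /si /in_st; steq.
apply: (bigS pre); apply: big_if.
have -> : tops (pre_st x r [::] valid (w_start x r) v) bSV = Some (sb valid) by rewrite ffunE.
rewrite /W; case: valid hs hv {pre W} thn => hs hv thn /=; last first.
  have := @Pr_const B R0 (pre_st x r [::] false (w_start x r) v) emptyword [::].
  by congr big; apply: upd_id.
have vB : size v <= B by have := size_computes (hv isT); rewrite /= addn0; lia.
have := @Pr_FOUT B x r v (w_start x r) n0 _ LB vB rB xn nwn (thn isT)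
  (pre_st x r [::] true (w_start x r) v) (fun _ _ _ => erefl) erefl c1 c2 [::].
move=> h; have {}h : big B FOUT (upd (pre_st x r [::] true (w_start x r) v) R0 [::])
   (upd (pre_st x r [::] true (w_start x r) v) R0 (catrev [seq sb i | i <- polyword x r v] [::])).
  by apply: h; lia.
by move: h; congr big; apply: upd_id.
Qed.

(** * Recovering a solution from a pair of vertices *)

(* A coordinate [e] of a vertex occurs as [cword (enc_rat e)] in the encoding of a pair
   of vertices; the third bit of [enc_rat e] tells whether [e >= 0] is positive. *)
Definition cword (u : bits) : bits := dbl (delimit (delimit u)).

Definition bitw (b : bool) : bits := [:: true; true; true; true; true; true; true; b].

Lemma cwordE u : cword u = flatten [seq bitw b | b <- u] ++ [:: true; true; true; false; true; false].
Proof. by elim: u => // b u IH; rewrite -[cword (b :: u)]/(bitw b ++ cword u) IH. Qed.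

Definition Pop1 : prog := POP bY.

Fixpoint POPN k : prog := if k is k'.+1 then Seq Pop1 (POPN k') else nop.

Lemma big_POPN B s k : big B (POPN k) s (upd s bY (drop k (s bY))).
Proof.
elim: k s => [|k IH] s; first by rewrite drop0 upd_id.
run big_act1; apply: (big_eq (IH _)); rewrite upd_upd upd_same /=.
by rewrite -drop1 drop_drop addn1.
Qed.

(** After three symbols are removed, the next one tells whether a further group of eight follows;
    the payload is the eighth symbol of a group. The second move restores the order of the payload,
    whose third bit becomes the flag. *)
Definition PARSE : prog :=
  Seq (POPN 3)
  (Seq (While (fun tp => tp bY == Some (sb true))
    (Seq (POPN 4) (Seq (Do (fun tp r => if r == bY then Pop else
       if r == bT4 then (if tp bY is Some g then Push g else Keep) else Keep)) (POPN 3))))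
  (Seq (POPN 3) (Seq (MOVE bT4 bT5)
  (Seq (POP bT5) (Seq (POP bT5)
  (Seq (act1 bFL (fun tp => Push (sb (odflt false (ubit (tp bT5)))))) (CLEAR bT5))))))).

Lemma big_PARSE B s u rest : s bY = map sb (cword u ++ rest) -> s bT4 = [::] -> s bT5 = [::] ->
  size u <= B ->
  big B PARSE s (upd (upd s bY (map sb rest)) bFL (sb (nth false u 2) :: s bFL)).
Proof.
move=> eY e4 e5 uB; set tl := [:: true; true; true; false; true; false] ++ rest.
have Ey : s bY = map sb (flatten [seq bitw b | b <- u] ++ tl) by rewrite eY cwordE -catA.
pose R i := flatten [seq bitw b | b <- drop i u] ++ tl.
pose F i := upd (upd s bY (drop 3 (map sb (R i)))) bT4 (rev (map sb (take i u))).
apply: (bigS (s1 := F 0)).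
  apply: (big_eq (big_POPN _ _ _)); rewrite Ey /F /R drop0 take0.
  by steq.
apply: (bigS (s1 := F (size u))).
  apply: big_while => // [i iu|]; last first.
    by rewrite ffunE /F; lk; rewrite /R drop_size.
  have dE : drop i u = nth false u i :: drop i.+1 u by apply: drop_nth.
  have RE : R i = bitw (nth false u i) ++ R i.+1 by rewrite /R dE /= .
  split; first by rewrite ffunE /F; lk; rewrite RE /= eqxx.
  eapply bigS; first exact: big_POPN.
  rewrite /F; lk; rewrite upd_comm // upd_upd RE /= ?drop0.
  set s1 := upd _ _ _; set b := nth false u i.
  apply: (bigS (s1 := upd (upd s bY (map sb (R i.+1))) bT4 (rev (map sb (take i.+1 u))))).
    rewrite /big /=; apply: funext => q; rewrite /do_ops ffunE /s1; lk.
    rewrite (take_nth false iu) map_rcons rev_rcons /upd.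
    case: (q =P bT4) => [->|_]; first by [].
    by case: (q =P bY).
  apply: (big_eq (@big_POPN B _ 3)); lk.
  by steq.
rewrite /F /R drop_size take_size /=.
eapply bigS; first exact: (@big_POPN B _ 3).
lk; rewrite /= ?drop0.
run big_move; lk; first by rewrite size_rev size_map.
rewrite e5 catrevE revK cats0.
run big_act1; run big_act1; lk; rewrite /apply_op !behead_map.
run big_act1; lk; rewrite ffunE; lk.
apply: big_eq; first by apply: big_clear; lk; rewrite size_map !size_behead; lia.
have -> : odflt false (ubit (ohead (map sb (behead (behead u))))) = nth false u 2.
  by case: (u) => [|a [|b [|c v]]].
by steq.
Qed.

Definition READV : prog := Seq (While (fun tp => tp bY == Some (sb true)) PARSE) (POP bY).

Lemma big_READV B s (us : seq bits) rest :
  s bY = map sb (flatten [seq cword u | u <- us] ++ false :: rest) ->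
  s bT4 = [::] -> s bT5 = [::] -> size us <= B -> (forall u, u \in us -> size u <= B) ->
  big B READV s (upd (upd s bY (map sb rest)) bFL
    (catrev (map sb [seq nth false u 2 | u <- us]) (s bFL))).
Proof.
move=> eY e4 e5 usB uB.
pose F i := upd (upd s bY (map sb (flatten [seq cword u | u <- drop i us] ++ false :: rest))) bFL
    (catrev (map sb [seq nth false u 2 | u <- take i us]) (s bFL)).
apply: (bigS (s1 := F (size us))).
  have {1}-> : s = F 0 by rewrite /F drop0 take0; steq.
  apply: big_while => // [i iu|]; last first.
    by rewrite ffunE /F; lk; rewrite drop_size.
  have dE : drop i us = nth [::] us i :: drop i.+1 us by apply: drop_nth.
  split; first by rewrite ffunE /F; lk; rewrite dE /= cwordE; case: (nth _ _ _) => [|b v] /=; rewrite eqxx.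
  apply: big_eq.
    apply: (@big_PARSE B (F i) (nth [::] us i) (flatten [seq cword u | u <- drop i.+1 us] ++ false :: rest));
      rewrite /F; lk => //; first by rewrite dE /= catA.
    by apply: uB; rewrite mem_nth.
  rewrite /F; lk.
  rewrite (take_nth [::] iu) !map_rcons -cats1 catrev_catl /=.
  by steq.
runlast big_act1; rewrite /F; lk; rewrite drop_size take_size /=.
by steq.
Qed.

(** * Reading candidate words off the positivity flags *)

Section Extract.
Variables (kT : finType) (kN k1 : kT).

Definition STEPK (k : kT) : prog := Do (fun tp r =>
  if r == bYF then Pop else
  if r == bFN then (if (k == kN) && (tp bYF != None) then Push (odflt gu (tp bYF)) else Keep) else
  if r == bF1 then (if (k == k1) && (tp bYF != None) then Push (odflt gu (tp bYF)) else Keep) else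
  Keep).

Definition selk (k : kT) (l : seq kT) (fl : bits) : bits :=
  rev [seq p.2 | p <- zip l fl & p.1 == k].

Lemma selk_cons k' k l b fl :
  map sb (selk k' (k :: l) (b :: fl)) = map sb (selk k' l fl) ++ (if k == k' then [:: sb b] else [::]).
Proof.
rewrite /selk /=; case: ifP => _ /=; last by rewrite cats0.
by rewrite rev_cons map_rcons cats1.
Qed.

Lemma big_STEPKS B s l fl rest : size fl = size l -> s bYF = map sb (fl ++ rest) ->
  big B (PRL STEPK l) s (upd (upd (upd s bYF (map sb rest))
    bFN (map sb (selk kN l fl) ++ s bFN)) bF1 (map sb (selk k1 l fl) ++ s bF1)).
Proof.
elim: l fl s => [|k l IH] [|b fl] s //=; first by move=> _ eY; steq.
move=> [szf] eY.
pose s1 := upd (upd (upd s bYF (map sb (fl ++ rest)))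
  bFN ((if k == kN then [:: sb b] else [::]) ++ s bFN)) bF1 ((if k == k1 then [:: sb b] else [::]) ++ s bF1).
apply: (bigS (s1 := s1)).
  rewrite /big /=; apply: funext => q; rewrite /do_ops ffunE eY /s1 /upd /= !andbT.
  case: (q =P bF1) => [->|_]; first by case: ifP.
  case: (q =P bFN) => [->|_]; first by case: ifP.
  by case: (q =P bYF) => [->|_]; rewrite ?eY.
apply: (big_eq (IH fl s1 szf _)); first by rewrite /s1; lk.
rewrite /s1; lk.
by rewrite !catA -!selk_cons; steq.
Qed.

Lemma selk_enum k fl : size fl = #|kT| ->
  selk k (enum kT) fl = [:: nth false fl (index k (enum kT))].
Proof.
rewrite cardE => szf; have := mem_enum kT k; have := enum_uniq kT.
have E l f : k \notin l -> [seq p.2 | p <- zip l f & p.1 == k] = [::] :> bits.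
  elim: l f => [|a l IH] [|b f] //=; rewrite inE negb_or eq_sym => /andP[/negbTE -> h].
  exact: IH.
rewrite inE /selk; move: szf.
elim: (enum kT) fl => [|a l IH] [|b f] //= [szf] /andP[al ul].
rewrite inE; case: (k =P a) => [ka _|ne].
  by rewrite -ka eqxx /= E ?ka //; rewrite -ka in al.
move=> /= kl; have -> : (a == k) = false by apply/eqP => h; apply: ne.
exact: IH.
Qed.

(** A symbol on [bST] records that the end of the word has been met; from then on nothing is
    appended. This mirrors [guess]. *)
Definition FIX : prog := Do (fun tp r =>
  if (r == bFN) || (r == bF1) then Pop else
  if r == bST then (if (tp bST == None) && (tp bFN == Some (sb true)) then Push (gu : hG) else Keep) else
  if r == bT5 then (if (tp bST == None) && (tp bFN != Some (sb true)) then
                      Push (odflt gu (tp bF1)) else Keep) else Keep).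

Definition EXTRACT : prog := FOR bUN bT3 (Seq (PRL STEPK (enum kT)) FIX).

Definition flag (c : bits) i k := nth false c (i * #|kT| + index k (enum kT)).
Definition cflags (c : bits) i (o : option bool) := flag c i (if o is Some _ then k1 else kN).

Lemma big_EXTRACT B s N c rest : s bUN = gus N.+1 -> size c = N.+1 * #|kT| ->
  s bYF = map sb (c ++ rest) -> s bT3 = [::] -> s bT5 = [::] -> s bST = [::] ->
  s bFN = [::] -> s bF1 = [::] -> N < B ->
  big B EXTRACT s (upd (upd (upd s bYF (map sb rest))
    bST (if has (fun i => cflags c i None) (iota 0 N.+1) then [:: gu] else [::]))
    bT5 (rev (map sb (guess N (cflags c))))).
Proof.
move=> eU szc eY e3 e5 es en e1 NB; set P := fun i => cflags c i None.
set kk := #|kT| in szc *.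
pose F i := upd (upd (upd s bYF (map sb (drop (i * kk) c ++ rest)))
    bST (if has P (iota 0 i) then [:: gu] else [::]))
    bT5 (rev (map sb [seq cflags c j (Some true) | j <- iota 0 (find P (iota 0 i))])).
have -> : s = F 0 by rewrite /F drop0; steq.
have FE : F N.+1 = upd (upd (upd s bYF (map sb rest))
    bST (if has P (iota 0 N.+1) then [:: gu] else [::])) bT5 (rev (map sb (guess N (cflags c)))).
  by rewrite /F drop_oversize ?szc.
have F0 : upd (upd (upd (F 0) bYF (map sb rest))
    bST (if has P (iota 0 N.+1) then [:: gu] else [::])) bT5 (rev (map sb (guess N (cflags c)))) = F N.+1.
  by rewrite FE /F; steq.
rewrite F0; have := @big_forF _ _ B bUN bT3 (Seq (PRL STEPK (enum kT)) FIX) (gus N.+1) F isT.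
rewrite size_gus; apply=> // i im.
have dsz : (i * kk + kk <= size c) by rewrite szc -mulSnr leq_mul2r im orbT.
set f := take kk (drop (i * kk) c).
have szf : size f = kk by rewrite /f size_takel // size_drop; lia.
have dE : drop (i * kk) c = f ++ drop (i.+1 * kk) c.
  by rewrite /f -[LHS](cat_take_drop kk) drop_drop mulSn.
have fl k : nth false f (index k (enum kT)) = flag c i k.
  rewrite /f /flag nth_take ?nth_drop //.
  by rewrite /kk cardE index_mem mem_enum.
have hs : iota 0 i.+1 = rcons (iota 0 i) i by rewrite -(addn1 i) iotaD cats1.
have hasE : has P (iota 0 i.+1) = has P (iota 0 i) || P i.
  by rewrite hs has_rcons orbC.
have findE : find P (iota 0 i.+1) = if has P (iota 0 i) then find P (iota 0 i) else if P i then i else i.+1.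
  rewrite hs -cats1 find_cat size_iota; case: (has P _) => //=; case: (P i); lia.
have fi : ~~ has P (iota 0 i) -> find P (iota 0 i) = i.
  by move=> h; rewrite hasNfind // size_iota.
have PE : flag c i kN = P i by [].
have QE : flag c i k1 = cflags c i (Some true) by [].
rewrite /split_at /F hasE findE.
eapply bigS.
  apply: (@big_STEPKS B _ (enum kT) f (drop (i.+1 * kk) c ++ rest)); first by rewrite szf /kk cardE.
  by lk; rewrite dE catA.
rewrite !selk_enum // !fl; lk; rewrite en e1.
rewrite PE QE /big; apply: funext => q; rewrite /do_ops !ffunE; lk; rewrite /upd.
case: (q =P bT3) => [->|_] //.
case: (q =P bUN) => [->|_] //.
case: (q =P bF1) => [->|_]; first by rewrite /= e1.
case: (q =P bFN) => [->|_]; first by rewrite /= en.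
case: (boolP (has P (iota 0 i))) => hp /=.
  case: (q =P bT5) => [E|_]; first by rewrite ?E.
  by case: (q =P bST) => [E|_]; [rewrite ?E | case: (q =P bYF)].
rewrite (fi hp).
have tE b : [seq sb j | j <- [seq cflags c j (Some true) | j <- iota 0 (if b then i else i.+1)]] =
    let u := [seq sb j | j <- [seq cflags c j (Some true) | j <- iota 0 i]] in
    if b then u else rcons u (sb (cflags c i (Some true))).
  by case: b => //; rewrite hs !map_rcons.
rewrite tE; case: (P i) => /=.
  case: (q =P bT5) => [E|_]; first by rewrite ?E.
  by case: (q =P bST) => [E|_]; [rewrite ?E | case: (q =P bYF)].
case: (q =P bT5) => [->|_]; last by case: (q =P bST) => [E|_]; [rewrite ?E | case: (q =P bYF)].
by rewrite rev_rcons.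
Qed.

End Extract.

Ltac lic := repeat match goal with H : forall _ : _, _ |- _ => clear H end; lia.

Local Notation EXTR := (EXTRACT (KU CHECK bW None) (KU CHECK bW (Some (sb true)))).
Local Notation cfl := (cflags (KU CHECK bW None) (KU CHECK bW (Some (sb true)))).

Definition SAVE : prog :=
  Seq (CLEAR bBW) (Seq (CLEAR bBV) (Seq (COPY bW bBW bT1) (COPY bVAL bBV bT1))).

(** The comparison with the best value so far is a check with that value as threshold. *)
Definition TRY : prog :=
  Seq (COPY bBV bTH bT1) (Seq CHECK
  (Seq (If (fun tp => tp bVD == Some (sb true)) SAVE nop)
  (Seq (CLEAR bW) (Seq (CLEAR bTH) (Seq (CLEAR bVAL) (Seq (CLEAR bVD) (CLEAR bSV))))))).

Definition BODY : prog :=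
  Seq EXTR (Seq (CLEAR bST) (Seq (MOVE bT5 bW) TRY)).

Definition GPROG : prog :=
  Seq (MOVE R0 bX) (Seq (MOVE R1 bY) (Seq (MOVE R2 bR) (Seq PRE (Seq (CLEAR bSV)
  (Seq READV (Seq READV (Seq (MOVE bFL bYF) (Seq (While (nonempty bYF) BODY)
  (MOVE bBW R0))))))))).

Section Recover.
Variables (B D ts tv : nat) (x : bits) (N : nat) (vf : bits -> bool) (vv : bits -> bits).
Hypothesis hs : forall w, size w <= N.+1 -> tm_computes_in Ms ts [:: x; w] [:: vf w].
Hypothesis hv : forall w, size w <= N.+1 -> vf w -> tm_computes_in Mv tv [:: x; w] (vv w).
Hypotheses (tsD : (size x + N.+1).+2 + ts <= D) (tvD : (size x + N.+1).+2 + tv <= D) (DB : D < B).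

Let ND : N.+1 <= D. Proof. by lic. Qed.

Let vvD w : size w <= N.+1 -> vf w -> size (vv w) <= D.
Proof. by move=> wN h; have := size_computes (hv wN h); rewrite /= addn0; lic. Qed.

Definition best_step (b : bits * bits) (w : bits) : bits * bits :=
  if vf w && better mx (num (vv w)) (num b.2) then (w, vv w) else b.

Definition best_st s (b : bits * bits) : stacks := upd (upd s bBW (map sb b.1)) bBV (map sb b.2).

Definition idle s := [/\ s bX = map sb x, s bUN = gus N.+1, clean s &
  [/\ s bT1 = [::], s bT2 = [::], s bT3 = [::], s bT5 = [::] &
  [/\ s bW = [::], s bTH = [::], s bVAL = [::], s bVD = [::] &
  [/\ s bSV = [::], s bST = [::], s bFN = [::] & s bF1 = [::]]]]].

Lemma big_TRY s (b : bits * bits) (w : bits) : idle s -> size b.1 <= D -> size b.2 <= D -> size w <= N.+1 ->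
  big B TRY (upd (best_st s b) bW (map sb w)) (best_st s (best_step b w)).
Proof.
move=> [eX eU cl [e1 e2 e3 e5 [eW eT eVA eVD [eSV eST eFN eF1]]]] b1 b2 wN.
have wD : size w <= D by lic.
have vD : vf w -> size (vv w) <= D.
  by move=> h; have := size_computes (hv wN h); rewrite /= addn0; lic.
rewrite /best_st; eapply bigS.
  apply: big_copy; lk => //. by rewrite size_map; lic.
lk; rewrite eT cats0.
eapply bigS.
  by apply: (big_CHECK (x := x) (w := w) (th := b.2) (D := D) _ _ _ _ _ _ _ _ _ _ (hs wN) (hv wN));
    lk => //; try (by move=> m; lk; exact: cl); lic.
rewrite /checked.
set good := vf w && _.
set s1 := upd _ bVD _.
have VE : size (if vf w then map sb (vv w) else [::]) <= B.
  by case: (vf w) vD => // /(_ isT); rewrite size_map; lic.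
pose s2 := upd (upd (upd (upd (upd (best_st s (best_step b w)) bW (map sb w)) bTH (map sb b.2)) bSV [:: sb (vf w)])
   bVAL (if vf w then map sb (vv w) else [::])) bVD [:: sb good].
apply: (bigS (s1 := s2)).
  apply: big_if; have -> : tops s1 bVD = Some (sb good) by rewrite ffunE /s1; lk.
  rewrite /s2 /best_step -/good /s1; case E : good => /=; last first.
    by apply: (big_eq (big_nop _ _)); rewrite /best_st; steq.
  have vw : vf w by move: E; rewrite /good => /andP[].
  rewrite vw; eapply bigS; first by apply: big_clear; lk; rewrite size_map; lic.
  eapply bigS; first by apply: big_clear; lk; rewrite size_map; lic.
  eapply bigS; first by apply: big_copy => //; lk => //; rewrite size_map; lic.
  lk; rewrite cats0.
  apply: big_eq; first by apply: big_copy => //; lk => //; rewrite size_map; have := vD vw; lic.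
  by lk; rewrite cats0 /best_st /=; steq.
rewrite /s2 /best_st.
eapply bigS; first by apply: big_clear; lk; rewrite size_map; lic.
eapply bigS; first by apply: big_clear; lk; rewrite size_map; lic.
eapply bigS; first by apply: big_clear; lk.
eapply bigS; first by apply: big_clear; lk; rewrite /=; lic.
apply: big_eq; first by apply: big_clear; lk; rewrite /=; lic.
by steq.
Qed.

Lemma size_guess a : size (guess N a) <= N.+1.
Proof. by rewrite size_map size_iota (leq_trans (find_size _ _)) // size_iota. Qed.

Lemma big_BODY s (b : bits * bits) (c rest : bits) : idle s -> size b.1 <= D -> size b.2 <= D ->
  size c = N.+1 * #|kdc| ->
  big B BODY (upd (best_st s b) bYF (map sb (c ++ rest)))
    (upd (best_st s (best_step b (guess N (cfl c)))) bYF (map sb rest)).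
Proof.
move=> id b1 b2 szc; have [eX eU cl [e1 e2 e3 e5 [eW eT eVA eVD [eSV eST eFN eF1]]]] := id.
eapply bigS.
  by apply: (@big_EXTRACT _ _ _ B _ N c rest) => //; rewrite /best_st; lk => //; lic.
set u := guess N _; rewrite upd_upd.
eapply bigS; first by apply: big_clear; rewrite /best_st; lk; case: ifP => //= _; lic.
have uN : size u <= N.+1 by exact: size_guess.
eapply bigS; first by apply: big_move => //; rewrite /best_st; lk; rewrite size_rev size_map; lic.
have id' : idle (upd s bYF (map sb rest)).
  split; lk => //; by move=> m; lk; exact: cl.
have h := @big_TRY (upd s bYF (map sb rest)) b u id' b1 b2 uN.
rewrite /best_st; lk; rewrite eW catrevE revK cats0.
move: h; congr big; first by rewrite /best_st; steq.
by rewrite /best_st; steq.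
Qed.

Lemma big_LOOP s (b : bits * bits) (cs : seq bits) : idle s -> size b.1 <= D -> size b.2 <= D -> s bYF = [::] ->
  (forall c : bits, c \in cs -> size c = N.+1 * #|kdc|) -> size cs <= B ->
  big B (While (nonempty bYF) BODY) (upd (best_st s b) bYF (map sb (flatten cs)))
    (best_st s (foldl best_step b [seq guess N (cfl c) | c <- cs])).
Proof.
move=> id b1 b2 eYF szc csB.
pose bs i := foldl best_step b [seq guess N (cfl c) | c <- take i cs].
pose F i := upd (best_st s (bs i)) bYF (map sb (flatten (drop i cs))).
have k0 : 0 < #|kdc| by apply/card_gt0P; exists (KLam CHECK).
have -> : upd (best_st s b) bYF (map sb (flatten cs)) = F 0 by rewrite /F /bs take0 drop0.
have -> : best_st s (foldl best_step b [seq guess N (cfl c) | c <- cs]) = F (size cs).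
  rewrite /F /bs take_size drop_size; set b' := foldl _ _ _.
  by rewrite /best_st; steq.
have bsD i : size (bs i).1 <= D /\ size (bs i).2 <= D.
  rewrite /bs; elim: (take i cs) b b1 b2 {bs F} => [|c l IH] b' b1 b2 //=.
  apply: IH; rewrite /best_step; case: ifP => //= /andP[vw _].
    exact: leq_trans (size_guess _) ND.
  exact: vvD (size_guess _) vw.
apply: big_while => // [i im|]; last by rewrite nonempty_tops /F; lk; rewrite drop_size.
have cin : nth [::] cs i \in cs by rewrite mem_nth.
have dE : drop i cs = nth [::] cs i :: drop i.+1 cs by apply: drop_nth.
split.
  rewrite nonempty_tops /F; lk; rewrite dE /= -size_eq0 size_map size_cat szc //; lic.
have [d1 d2] := bsD i; rewrite /F dE; apply: (big_eq (big_BODY (flatten (drop i.+1 cs)) id d1 d2 (szc _ cin))).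
by congr upd; congr best_st; rewrite /bs (take_nth [::] im) map_rcons foldl_rcons.
Qed.

End Recover.

Lemma big_GPROG B D x r v ts tv (vf : bits -> bool) (vv : bits -> bits) (us1 us2 cs : seq bits) :
  let w0 := w_start x r in
  0 < nn x r -> size w0 <= nn x r -> vf w0 -> vv w0 = v ->
  (forall w, size w <= nn x r -> tm_computes_in Ms ts [:: x; w] [:: vf w]) ->
  (forall w, size w <= nn x r -> vf w -> tm_computes_in Mv tv [:: x; w] (vv w)) ->
  (size x + nn x r).+2 + ts <= D -> (size x + nn x r).+2 + tv <= D ->
  nn x r + (size x + size x) + 2 <= D -> D < B -> nwd x r <= B -> nlev r <= B -> m0 x r <= B ->
  let y := flatten [seq cword u | u <- us1] ++ false :: flatten [seq cword u | u <- us2] ++ [:: false] in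
  size y <= B -> (forall u : bits, u \in us1 ++ us2 -> size u <= B) -> size us1 + size us2 <= B ->
  [seq nth false u 2 | u <- us1 ++ us2] = flatten cs -> size cs <= B ->
  (forall c : bits, c \in cs -> size c = nn x r * #|kdc|) ->
  exists2 s', big B GPROG (@input_stacks hReg hS hK hix [:: x; y; r]) s' &
    s' R0 = map sb (rev (foldl (best_step vf vv) (w0, v)
      [seq guess (nn x r).-1 (cfl c) | c <- cs]).1).
Proof.
move=> w0 n0 w0n vw0 vE hs hv tsD tvD nD DB nwB LB mB y yB uB usB fE csB szc.
have nE : (nn x r).-1.+1 = nn x r by exact: prednK.
rewrite input_stacksE //=.
have xB : size x <= B by lic.
have rB : size r <= B by move: mB; rewrite /m0; lic.
have pre := @big_PRE B D x r (map sb y) true v ts tv.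
have {}pre : big B PRE (in_st x r (map sb y)) (pre_st x r (map sb y) true w0 v).
  have k1 : (size x + size w0).+2 + ts <= D by lic.
  have k2 : (size x + size w0).+2 + tv <= D by lic.
  by apply: pre => //; [rewrite -vw0; apply: hs | move=> _; rewrite -vE; apply: hv].
set bb := foldl _ _ _.
pose s0 := upd (upd (upd (pre_st x r (map sb y) true w0 v) bSV [::]) bY [::]) bFL [::].
exists (upd (upd (best_st s0 bb) bBW [::]) R0 (rev (map sb bb.1))); last by rewrite upd_same map_rev.
eapply bigS; first by apply: big_move => //; lk; rewrite size_map size_rev.
lk; eapply bigS; first by apply: big_move => //; lk; rewrite size_map size_rev.
lk; eapply bigS; first by apply: big_move => //; lk; rewrite size_map size_rev.
lk; rewrite !map_rev !catrevE !revK !cats0.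
set si := upd _ _ _; have -> : si = in_st x r (map sb y) by rewrite /si /in_st; steq.
apply: (bigS pre).
have v0B : size v <= D.
  by have := size_computes (hv _ w0n vw0); rewrite vE /= addn0; lic.
eapply bigS; first by apply: big_clear; rewrite /pre_st; lk; rewrite /=; lic.
pose s1 := upd (pre_st x r (map sb y) true w0 v) bSV [::].
eapply bigS.
  by apply: (@big_READV B _ us1 (flatten [seq cword u | u <- us2] ++ [:: false])) => //;
    [lic | move=> u hu; apply: uB; rewrite mem_cat hu].
eapply bigS.
  apply: (@big_READV B _ us2 [::]); lk => //; first by lic.
  by move=> u hu; apply: uB; rewrite mem_cat hu orbT.
lk.
set C := catrev _ (catrev _ _).
have CE : C = rev (map sb (flatten cs)).
  by rewrite /C -fE !map_cat !catrevE rev_cat; congr (_ ++ _); rewrite -[RHS]cats0.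
have szf : size (flatten cs) <= B by rewrite -fE size_map size_cat.
rewrite CE; eapply bigS; first by apply: big_move => //; lk; rewrite size_rev size_map.
lk; rewrite [catrev (rev _) _]catrevE revK -[pre_st _ _ _ _ _ _ bYF]/(@nil hG) cats0.
have id : idle x (nn x r).-1 s0.
  by rewrite /idle nE; split=> //; move=> m.
have loop := @big_LOOP B D ts tv x (nn x r).-1 vf vv.
rewrite nE in loop.
have w0D : size w0 <= D by lic.
have {}loop := loop hs hv tsD tvD DB s0 (w0, v) cs id w0D v0B erefl szc csB.
have bbD : size bb.1 <= D.
  have hg a : size (guess (nn x r).-1 a) <= nn x r by rewrite -{2}nE; exact: size_guess.
  have nD' : nn x r <= D by lic.
  suff H (l : seq bits) (b : bits * bits) : size b.1 <= D ->
      size (foldl (best_step vf vv) b [seq guess (nn x r).-1 (cfl c) | c <- l]).1 <= D by exact: H.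
  elim: l b => [|c l IH] b hb //=; apply: IH.
  by rewrite /best_step; case: ifP => //= _; exact: leq_trans (hg _) nD'.
apply: (bigS (s1 := best_st s0 bb)).
  move: loop; congr big.
  by rewrite /best_st /s0 /pre_st; steq.
apply: big_eq.
  by apply: big_move => //; rewrite /best_st; lk; rewrite size_map; lic.
by rewrite /best_st; lk; rewrite catrevE cats0; steq.
Qed.

End Host.

(** * Polynomial bounds *)

(** Bounds are pure powers because this is what [POW] computes in unary; for bases from 2 on they
    are closed under the operations below. *)
Definition polyb (f : nat -> nat) := exists K, forall m, 2 <= m -> f m <= m ^ K.

Lemma polyb_le f g : (forall m, 2 <= m -> f m <= g m) -> polyb g -> polyb f.
Proof. by move=> h [K H]; exists K => m m2; apply: leq_trans (h m m2) (H m m2). Qed.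

Lemma polyb_const c : polyb (fun _ => c).
Proof.
exists c => m m2; apply: leq_trans (ltnW (ltn_expl c (ltnSn 1))) _.
by case: c => // c; rewrite leq_exp2r.
Qed.

Lemma polyb_id : polyb id.
Proof. by exists 1 => m _; rewrite expn1. Qed.

Lemma polyb_mul f g : polyb f -> polyb g -> polyb (fun m => f m * g m).
Proof.
move=> [a ha] [b hb]; exists (a + b) => m m2; rewrite expnD leq_mul //; [exact: ha | exact: hb].
Qed.

Lemma polyb_add f g : polyb f -> polyb g -> polyb (fun m => f m + g m).
Proof.
move=> [a ha] [b hb]; exists (a + b).+1 => m m2.
have m0 : 0 < m by lia.
have h1 : f m <= m ^ (a + b) by apply: leq_trans (ha m m2) _; rewrite leq_pexp2l ?leq_addr.
have h2 : g m <= m ^ (a + b) by apply: leq_trans (hb m m2) _; rewrite leq_pexp2l ?leq_addl.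
by rewrite expnS; nia.
Qed.

Lemma polyb_exp f k : polyb f -> polyb (fun m => f m ^ k).
Proof.
move=> pf; elim: k => [|k IH]; first exact: (polyb_const 1).
by apply: polyb_le (polyb_mul pf IH) => m _; rewrite expnS.
Qed.

Lemma polyb_poly f k : polyb f -> polyb (fun m => poly_bound k (f m)).
Proof.
move=> pf; apply: polyb_add; last exact: polyb_const.
by apply: polyb_mul; [exact: polyb_const | exact: polyb_exp].
Qed.

Lemma leq_poly_bound k a b : a <= b -> poly_bound k a <= poly_bound k b.
Proof. by move=> ab; rewrite /poly_bound leq_add2r leq_mul2l; case: k => // k; rewrite leq_exp2r ?ab ?orbT. Qed.

Lemma polyb_cost (Reg G : finType) (p : prog Reg G) f : polyb f -> polyb (fun m => cost (f m) p).
Proof.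
move=> pf; have [C [h H]] := cost_poly p.
apply: (@polyb_le _ (fun m => C * (f m + 1) ^ h)); first by move=> m _; rewrite addn1.
by apply: polyb_mul; [exact: polyb_const | apply: polyb_exp; apply: polyb_add => //; exact: polyb_const].
Qed.

(** For positive [S] the base [S + 2] is at most [3 * S]; the case [S = 0] is absorbed by the
    additive constant. *)
Lemma polyb_bound f : polyb f -> exists k, forall S, f (S + 2) <= poly_bound k S.
Proof.
move=> [K H]; exists (3 ^ K + K) => S; apply: leq_trans (H _ _) _; first by rewrite addn2.
rewrite /poly_bound; have [->|S0] := posnP S.
  rewrite add0n; apply: (@leq_trans (3 ^ K)); last by lia.
  by case: (K) => // k; rewrite leq_exp2r.
apply: (@leq_trans ((3 * S) ^ K)).
  by case: (K) => // k; rewrite leq_exp2r //; lia.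
rewrite expnMn; apply: leq_trans (leq_addr _ _); rewrite leq_mul ?leq_addr //.
by rewrite leq_pexp2l // leq_addl.
Qed.

Lemma size_mrun (Reg G : finType) (p : prog Reg G) k c r :
  size ((@mrun _ _ p k c).2 r) <= size (c.2 r) + k.
Proof.
elim: k c => [|k IH] c; first by rewrite addn0.
rewrite mrunS; apply: leq_trans (IH _) _; rewrite addnS -addSn leq_add2r /mstep.
case: c => [[q|] s] /=; last exact: leqnSn.
by rewrite /do_ops; case: ((next q (tops s)).2 r) => [||a|a] //=; rewrite ?size_behead; lia.
Qed.

Lemma size_big (Reg G : finType) (p : prog Reg G) B s s' r : big B p s s' ->
  size (s' r) <= size (s r) + cost B p.
Proof.
move=> /big_run[k kc E]; have := size_mrun k (Some (start p), s) r; rewrite E /=.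
by move=> h; apply: leq_trans h _; rewrite leq_add2l.
Qed.

(** * Enumerations and encodings *)

Lemma enum_prodE (A B : finType) : enum {: A * B} = [seq (a, b) | a <- enum A, b <- enum B].
Proof. by rewrite [LHS]enumT [in LHS]unlock. Qed.

Lemma flatten_flatten (T : Type) (sss : seq (seq (seq T))) :
  flatten (flatten sss) = flatten [seq flatten ss | ss <- sss].
Proof. by elim: sss => //= ss sss <-; rewrite flatten_cat. Qed.

Lemma flatten_prod (A B : finType) (T : Type) (F : A * B -> seq T) :
  flatten [seq F p | p <- enum {: A * B}] =
  flatten [seq flatten [seq F (a, b) | b <- enum B] | a <- enum A].
Proof. by rewrite enum_prodE map_allpairs /allpairs flatten_flatten -map_comp. Qed.

Lemma flatten_ord (T : Type) n (F : nat -> seq T) :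
  flatten [seq F (val i) | i <- enum 'I_n] = flatten [seq F i | i <- iota 0 n].
Proof. by rewrite -val_enum_ord -map_comp. Qed.

Lemma flatten_ordE (T : Type) n m (F : nat -> seq T) : n = m ->
  flatten [seq F (val i) | i <- enum 'I_n] = flatten [seq F i | i <- iota 0 m].
Proof. by move=> <-; exact: flatten_ord. Qed.

Lemma map_enum_val (T : finType) (U : Type) (F : T -> U) (x0 : T) :
  [seq F (enum_val i) | i <- enum 'I_#|T|] = [seq F a | a <- enum T].
Proof.
transitivity [seq F (nth x0 (enum T) (val i)) | i <- enum 'I_#|T|].
  by apply: eq_map => i; rewrite (enum_val_nth x0).
rewrite (map_comp (fun k => F (nth x0 (enum T) k)) val) val_enum_ord.
by rewrite (map_comp F (nth x0 (enum T))) cardE -/(mkseq _ _) mkseq_nth.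
Qed.

Lemma enc_mx_fin (T U : finType) (G : T -> U -> rat) (x0 : T) (y0 : U) :
  enc_mx (\matrix_(i < #|T|, j < #|U|) G (enum_val i) (enum_val j))%R =
  flatten [seq delimit (flatten [seq delimit (enc_rat (G a b)) | b <- enum U]) | a <- enum T].
Proof.
rewrite /enc_mx /enc_seq -map_comp; congr flatten.
rewrite -(map_enum_val (fun a => delimit (flatten [seq delimit (enc_rat (G a b)) | b <- enum U])) x0).
apply: eq_map => i /=; congr delimit; congr flatten; rewrite -map_comp.
rewrite -(map_enum_val (fun b => delimit (enc_rat (G (enum_val i) b))) y0).
by apply: eq_map => j /=; rewrite mxE.
Qed.

Lemma enum_ord1 : enum 'I_1 = [:: ord0].
Proof. by apply: (inj_map val_inj); rewrite val_enum_ord. Qed.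

Lemma enc_mx_col d (u : 'cV[rat]_d) :
  enc_mx u = flatten [seq delimit (delimit (enc_rat (u i 0%R))) | i <- enum 'I_d].
Proof.
rewrite /enc_mx /enc_seq -map_comp; congr flatten; apply: eq_map => i /=.
by rewrite enum_ord1 /= cats0.
Qed.

Lemma delimit_flatten (ss : seq bits) : delimit (flatten ss) = flatten [seq dbl u | u <- ss] ++ [:: false].
Proof. by rewrite delimitE dbl_flatten. Qed.

Lemma dbl_delimit_flatten (ss : seq bits) :
  dbl (delimit (flatten ss)) = flatten [seq dbl (dbl u) | u <- ss] ++ [:: true; false].
Proof. by rewrite delimitE dbl_cat !dbl_flatten -map_comp. Qed.

Lemma enc_polytopeE (R : realType) (P : polytope R) : enc_polytope P =
  delimit (enc_nat (pt_ineqs P)) ++ delimit (enc_nat (pt_dim P)) ++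
  delimit (enc_mx (pt_A P)) ++ delimit (enc_mx (pt_b P)).
Proof. by rewrite /enc_polytope /enc_seq /= cats0. Qed.

(* Prevents the unfolding of the large finite types indexed by [CHECK]. *)
Local Opaque CHECK.

Section EncodeSystem.
Variables (Ms Mv Ma : tm) (mx : bool) (cL K1 K : nat) (x r vb : bits) (R : realType).
Local Notation n := (nn K x r).
Local Notation nw := (nwd K1 x r).
Local Notation L := (nlev cL r).
Local Notation CHK := (CHECK Ms Mv Ma mx).
Local Notation sb := (@sbit (hS Ms Mv Ma)).

Definition tab_polytope : polytope R :=
  sys_polytope CHK (bX Ms Mv Ma) (bW Ms Mv Ma) (bTH Ms Mv Ma) (bVD Ms Mv Ma) sb (sb false)
    n.-1 nw x (fun l : 'I_L => thw l r vb) R.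

(** The enumeration of a product type is lexicographic, so the encoding unfolds into the same nested
    concatenations as the loops print. *)
Lemma enc_tab_polytope : 0 < n ->
  enc_polytope tab_polytope = polyword Ms Mv Ma mx cL K1 K x r vb.
Proof.
move=> n0; have nE : n.-1.+1 = n by exact: prednK.
have L0 : 0 < L by rewrite /nlev expn_gt0.
have x0 : rowt CHK n.-1 L := (Ordinal L0, (ord0, (ord0, inl (true, KLam CHK)))).
have y0 : vart CHK n.-1 L := (Ordinal L0, (ord0, (ord0, KLam CHK))).
rewrite enc_polytopeE /polyword; congr (_ ++ _).
  congr (delimit (enc_nat _)); rewrite -[LHS]/#|rowt CHK n.-1 L| /rowt.
  by rewrite !card_prod !card_ord nE.
congr (_ ++ _).
  congr (delimit (enc_nat _)); rewrite -[LHS]/#|vart CHK n.-1 L| /vart /prod_ft /var.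
  by rewrite !card_prod !card_ord nE.
rewrite catA; congr (_ ++ _).
  have -> : enc_mx (pt_A tab_polytope) = _ := enc_mx_fin (fun (a : rowt CHK n.-1 L) (b : vart CHK n.-1 L) =>
    (coef (bX Ms Mv Ma) (bW Ms Mv Ma) (bTH Ms Mv Ma) (bVD Ms Mv Ma) sb (sb false) nw x
      (fun l : 'I_L => thw l r vb) a b)%:~R%R) x0 y0.
  rewrite delimit_flatten -map_comp; congr (_ ++ _).
  rewrite /matA flatten_prod -flatten_ord; congr flatten; apply: eq_map => l.
  rewrite flatten_prod -(flatten_ordE _ nE); congr flatten; apply: eq_map => t.
  rewrite flatten_prod -(flatten_ordE _ nE); congr flatten; apply: eq_map => i.
  congr flatten; apply: eq_map => ro.
  rewrite dbl_delimit_flatten -map_comp; congr (_ ++ _).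
  rewrite /colw flatten_prod -flatten_ord; congr flatten; apply: eq_map => l'.
  rewrite flatten_prod -(flatten_ordE _ nE); congr flatten; apply: eq_map => t'.
  rewrite flatten_prod -(flatten_ordE _ nE); congr flatten; apply: eq_map => i'.
rewrite enc_mx_col delimit_flatten -map_comp; congr (_ ++ _).
rewrite -[LHS]/(flatten [seq dbl (delimit (delimit (enc_rat (sysb CHK n.-1 nw x (fun l : 'I_L => thw l r vb) i 0%R)))) | i <- enum _]).
transitivity (flatten [seq dbl (delimit (delimit (enc_rat (bound nw x (fun l : 'I_L => thw l r vb) a)%:~R%R))) | a <- enum (rowt CHK n.-1 L)]).
  congr flatten; rewrite -(map_enum_val (fun a => dbl (delimit (delimit (enc_rat (bound nw x (fun l : 'I_L => thw l r vb) a)%:~R%R)))) x0).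
  by apply: eq_map => i; rewrite mxE.
rewrite flatten_prod /matB -flatten_ord; congr flatten; apply: eq_map => l.
rewrite flatten_prod -(flatten_ordE _ nE); congr flatten; apply: eq_map => t.
rewrite flatten_prod -(flatten_ordE _ nE); congr flatten; apply: eq_map => i.
congr flatten; apply: eq_map => ro.
by rewrite /rhsw /eword; rewrite [delimit (delimit _)]delimitE dbl_cat.
Qed.
End EncodeSystem.

Lemma enc_vertex_pairE (R : realType) (P : polytope R) (y : vertex_pair P) :
  let us u := [seq enc_rat ((u : 'cV[rat]_(pt_dim P)) i 0%R) | i <- enum 'I_(pt_dim P)] in
  enc_vertex_pair y = flatten [seq cword c | c <- us (vp_fst y)] ++
    false :: flatten [seq cword c | c <- us (vp_snd y)] ++ [:: false].
Proof.
move=> us; rewrite /enc_vertex_pair /enc_seq /= cats0 !enc_mx_col !delimit_flatten -!map_comp -catA /=.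
by [].
Qed.

(** The code begins with the delimited sign bit of the numerator, which takes two places. The third
    bit is [true] if a digit follows and ends the code of the numerator otherwise, that is, for
    0. *)
Lemma enc_rat_pos (e : rat) : (0 <= e)%R -> nth false (enc_rat e) 2 = (0 < e)%R.
Proof.
move=> e0; rewrite /enc_rat /enc_seq /=; rewrite -numq_gt0.
have : (0 <= numq e)%R by rewrite numq_ge0.
case: (numq e) => [[|k]|//] _ //=.
case E : (enc_nat k.+1) => [|b u] //; have := num_enc_nat k.+1; by rewrite E.
Qed.

Lemma size_cword u : size u < size (cword u).
Proof. by rewrite cwordE size_cat /=; elim: u => //= b u IH; lia. Qed.

Lemma nth_grid (T1 T2 : Type) (F : T1 -> T2 -> bool) (s : seq T1) (t : seq T2) a0 b0 i j :
  i < size s -> j < size t ->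
  nth false (flatten [seq [seq F a b | b <- t] | a <- s]) (i * size t + j) =
  F (nth a0 s i) (nth b0 t j).
Proof.
elim: s i => //= a s IH [|i] im jm; rewrite nth_cat size_map.
  by rewrite mul0n add0n jm (nth_map b0).
have -> : (i.+1 * size t + j < size t) = false by apply/negbTE; rewrite -leqNgt mulSn -addnA leq_addr.
by rewrite mulSn -addnA addKn IH.
Qed.

(** If an interval from [p] to [q] contains [c] multiples of [E], its length is at most [(c + 1) E].
    The hypothesis ensures that no multiple beyond the [L] counted ones is below [q]. *)
Lemma window E p q L : (q <= L.+1 * E)%N ->
  (q <= p + E + E * \sum_(l < L) ((p <= l.+1 * E) && (l.+1 * E < q)))%N.
Proof.
move=> qL; suff H k : minn q (k.+1 * E) <= p + E + E * \sum_(l < k) ((p <= l.+1 * E) && (l.+1 * E < q)).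
  by have := H L; rewrite (minn_idPl qL).
elim: k => [|k IH]; first by rewrite big_ord0 muln0; lia.
rewrite big_ord_recr /=; set S := \sum_(_ < _) _ in IH *.
have e1 : k.+2 * E = k.+1 * E + E by rewrite mulSn addnC.
rewrite e1 mulnDr; move: (k.+1 * E) IH => m IH.
case: (leqP p m) => h1; case: (ltnP m q) => h2 /=; rewrite ?muln1 ?muln0; lia.
Qed.

Lemma map_prod (A B : finType) (T : Type) (F : A * B -> T) :
  [seq F p | p <- enum {: A * B}] = flatten [seq [seq F (a, b) | b <- enum B] | a <- enum A].
Proof. by rewrite enum_prodE map_allpairs. Qed.

Lemma guess_ext N a b :
  (forall i, i < N.+1 -> a i None = b i None /\ a i (Some true) = b i (Some true)) ->
  guess N a = guess N b.
Proof.
move=> h; rewrite /guess.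
have -> : find (fun i => a i None) (iota 0 N.+1) = find (fun i => b i None) (iota 0 N.+1).
  by apply: eq_in_find => i; rewrite mem_iota => /h[].
apply/eq_in_map => i; rewrite mem_iota add0n => im; apply: (h i _).2.
by apply: leq_trans im _; rewrite (leq_trans (find_size _ _)) // size_iota.
Qed.

Lemma better_trans mx a b c : better mx a b -> ~~ better mx a c -> better mx c b.
Proof. by rewrite /better; case: mx; lia. Qed.

Section Best.
Variables (mx : bool) (vf : bits -> bool) (vv : bits -> bits).

Lemma foldl_best (b : bits * bits) ws : vf b.1 -> b.2 = vv b.1 ->
  let b' := foldl (best_step mx vf vv) b ws in
  [/\ vf b'.1, b'.2 = vv b'.1, ~~ better mx (num b.2) (num b'.2) &
      forall w, w \in ws -> vf w -> ~~ better mx (num (vv w)) (num b'.2)].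
Proof.
elim: ws b => [|w ws IH] b b1 b2 /=; first by split=> //; rewrite /better; case: mx; rewrite ltnn.
set c := best_step mx vf vv b w.
have [c1 c2] : vf c.1 /\ c.2 = vv c.1 by rewrite /c /best_step; case: ifP => // /andP[].
have [h1 h2 h3 h4] := IH c c1 c2.
have k a : ~~ better mx a (num c.2) ->
   ~~ better mx a (num (foldl (best_step mx vf vv) c ws).2).
  by move: h3; rewrite /better; case: (mx); lia.
split=> // [|w']; first apply: k.
  rewrite /c /best_step; case: ifP => [/andP[_]|_] /=; rewrite /better; case: (mx); lia.
rewrite inE => /predU1P[->|/h4 //] vw; apply: k.
rewrite /c /best_step vw /=; case: ifP => [_|/negbT //] /=.
by rewrite /better; case: (mx); rewrite ltnn.
Qed.
End Best.

Lemma vertex_in (R : realType) d (P : set 'cV[R]_d) v : is_vertex P v -> P v.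
Proof. by move=> [c [e [_ E]]]; have : [set v]%classic v by []; rewrite E => -[]. Qed.

Lemma size_grid (T1 T2 T : Type) (F : T1 -> T2 -> T) (s : seq T1) (t : seq T2) :
  size (flatten [seq [seq F a b | b <- t] | a <- s]) = size s * size t.
Proof. by elim: s => //= a s IH; rewrite size_cat size_map IH. Qed.

(** * The empty polytope *)

Section EmptyPolytope.
Variable R : realType.

Lemma empty_bounded :
  bounded (rat_polyhedron R (0 : 'M[rat]_(1, 0))%R (const_mx (-1) : 'cV[rat]_1)%R).
Proof.
exists 0%R => v /(_ 0%R) h; exfalso; move: h; rewrite map_mx0 mul0mx !mxE.
by rewrite -[(-1)%R]/((-1)%:~R)%R ratr_int; lra.
Qed.

Definition empty_polytope : polytope R := Polytope empty_bounded.

Lemma empty_no_vertex (y : vertex_pair empty_polytope) : False.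
Proof.
have /(_ 0%R) := vertex_in (vp_fstP y); rewrite /= map_mx0 mul0mx !mxE.
by rewrite -[(-1)%R]/((-1)%:~R)%R ratr_int; lra.
Qed.
End EmptyPolytope.

(** * The reduction from a problem in APX *)

Section Reduction.
Variables (R : realType) (A : opt_problem) (Ms Mv Ma : tm) (ks kv kz ka : nat) (r0 : rat).
Hypothesis Hs : forall (x : inst A) (w : bits), tm_computes_poly Ms ks [:: enc_inst x; w]
  [:: `[< exists y : sol x, w = enc_sol y >]].
Hypothesis Hv : forall (x : inst A) (y : sol x),
  tm_computes_poly Mv kv [:: enc_inst x; enc_sol y] (enc_nat (value y)).
Hypothesis Hz : forall (x : inst A) (y : sol x),
  size (enc_sol y) <= poly_bound kz (size (enc_inst x)).
Hypothesis Ha : forall x : inst A, inhabited (sol x) -> exists2 y : sol x, ratio_le r0 y &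
  tm_computes_poly Ma ka [:: enc_inst x] (enc_sol y).

Definition mx : bool := if opt_goal A is Maximize then true else false.

Local Notation CHK := (CHECK Ms Mv Ma mx).
Local Notation sb := (@sbit (hS Ms Mv Ma)).
Local Notation bX := (bX Ms Mv Ma).
Local Notation bW := (bW Ms Mv Ma).
Local Notation bTH := (bTH Ms Mv Ma).
Local Notation bVD := (bVD Ms Mv Ma).
Local Notation kN := (KU CHK bW None).
Local Notation k1 := (KU CHK bW (Some (sb true))).
Local Notation cfl := (cflags kN k1).

Variables (cL K1 K : nat).
Hypothesis r0L : (r0 <= (2 ^ cL)%:R)%R.

(** In terms of [m], the bounds are for the length of a solution, the input length of the verifier,
    the length of a threshold, the resources of [CHECK], and the number of rows that the tableau
    needs. *)
Definition wbound m := m ^ K1.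
Definition tbound m := m + wbound m.
Definition thbound m := tbound m + poly_bound kv (tbound m) + 2 + (cL + m).+1.
Definition dbound m :=
  (tbound m).+2 + poly_bound ks (tbound m) + poly_bound kv (tbound m) + thbound m.
Definition nbound m :=
  (cost (dbound m).+1 CHK).+1 + wbound m + m + poly_bound ka m + 2 + thbound m.
Hypothesis HK1 : forall m, 2 <= m -> poly_bound kz m <= m ^ K1.
Hypothesis HK : forall m, 2 <= m -> nbound m <= m ^ K.

Section Instance.
Variables (x : inst A) (r : rat).
Local Notation xb := (enc_inst x).
Local Notation rb := (enc_rat r).
Local Notation m := (m0 xb rb).
Local Notation n := (nn K xb rb).
Local Notation nw := (nwd K1 xb rb).
Local Notation L := (nlev cL rb).
Local Notation w0 := (w_start Ma K xb rb).
Local Notation N := n.-1.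

Definition vf (w : bits) : bool := `[< exists y : sol x, w = enc_sol y >].
Definition vv (w : bits) : bits :=
  match pselect (exists y : sol x, w = enc_sol y) with
  | left h => enc_nat (value (projT1 (cid h)))
  | right _ => [::]
  end.
Definition vb : bits := vv w0.
Local Notation th l := (thw l rb vb).

Lemma vv_sol (y : sol x) : vv (enc_sol y) = enc_nat (value y).
Proof.
rewrite /vv; case: pselect => [h|[]]; last by exists y.
by case: (cid h) => y' /= /enc_sol_inj ->.
Qed.

Lemma vf_sol (y : sol x) : vf (enc_sol y).
Proof. by apply/asboolP; exists y. Qed.

Lemma vfP w : vf w -> exists2 y : sol x, w = enc_sol y & vv w = enc_nat (value y).
Proof. by move=> /asboolP[y ->]; exists y => //; rewrite vv_sol. Qed.

Lemma m2 : 2 <= m. Proof. by rewrite /m0 addn2. Qed.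
Lemma xm : size xb <= m. Proof. by rewrite /m0; lia. Qed.
Lemma nbn : nbound m <= n. Proof. exact: HK m2. Qed.
Lemma n0 : 0 < n. Proof. by have := nbn; rewrite /nbound; lia. Qed.
Lemma nE : N.+1 = n. Proof. by rewrite prednK // n0. Qed.
Lemma nwN : nw <= N. Proof. by have := nbn; rewrite /nbound /wbound /nwd; lia. Qed.
Lemma xn : size xb <= n. Proof. by have := nbn; have := xm; rewrite /nbound; lia. Qed.

Lemma sol_nw (y : sol x) : size (enc_sol y) <= nw.
Proof.
apply: leq_trans (Hz y) _; apply: leq_trans (HK1 m2); exact: leq_poly_bound xm.
Qed.

Lemma Hs_in w t : size xb + size w <= t -> tm_computes_in Ms (poly_bound ks t) [:: xb; w] [:: vf w].
Proof.
move=> h; apply: tm_computes_mono (Hs x w) _; apply: leq_poly_bound.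
by rewrite /= addn0.
Qed.

Lemma Hv_in w t : vf w -> size xb + size w <= t ->
  tm_computes_in Mv (poly_bound kv t) [:: xb; w] (vv w).
Proof.
move=> /vfP[y -> ->] h; apply: tm_computes_mono (Hv y) _; apply: leq_poly_bound.
by rewrite /= addn0.
Qed.

(** [CHECK] halts within [N] steps and a halted program idles, so its verdict is still present in
    row [N]. *)
Lemma conf_check w t : size w <= nw -> size t <= thbound m ->
  (conf CHK bX bW bTH sb xb t w N).2 bVD =
    [:: sb (vf w && better mx (num (vv w)) (num t))].
Proof.
move=> wn tn; set s := init_st bX bW bTH sb xb t w.
have wt : size xb + size w <= tbound m by have := xm; rewrite /tbound /wbound -/nw; lia.
have h : big (dbound m).+1 CHK s (checked mx s (vf w) (vv w) t).
  apply: (@big_CHECK Ms Mv Ma mx _ (dbound m) s xb w t (vf w) (vv w)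
    (poly_bound ks (tbound m)) (poly_bound kv (tbound m))) => //.
  - exact: Hs_in.
  - by move=> v; apply: Hv_in.
  - by rewrite /dbound; lia.
  - by rewrite /dbound; lia.
  - by rewrite /dbound; lia.
have [k kc E] := big_run h.
have kN : k <= N by have := nbn; rewrite /nbound; lia.
by rewrite /conf -/s -(subnKC kN) mrunD E mrun_halt.
Qed.

Section Inhabited.
Variables (y0 : sol x).
Hypotheses (y0r : ratio_le r0 y0) (y0c : tm_computes_poly Ma ka [:: xb] (enc_sol y0)).

(** The clock [n] exceeds the running time of the approximation algorithm on [x], so the clocked run
    ends with its output. *)
Lemma w0E : w0 = enc_sol y0.
Proof.
have [|_ h] // := @tm_computes_mono _ _ n _ _ y0c.
rewrite /= addn0; apply: leq_trans (leq_poly_bound ka xm) _.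
by have := nbn; rewrite /nbound; lia.
Qed.

Lemma vbE : vb = enc_nat (value y0).
Proof. by rewrite /vb w0E vv_sol. Qed.

Lemma size_th l : l < L -> size (th l) <= thbound m.
Proof.
move=> lL; rewrite /thw size_drop size_cat size_nseq.
have : size vb <= tbound m + poly_bound kv (tbound m) + 2.
  have wt : size xb + size w0 <= tbound m.
    by rewrite w0E; have := sol_nw y0; have := xm; rewrite /tbound /wbound -/nw; lia.
  have := size_computes (@Hv_in w0 (tbound m) _ wt); rewrite {1}w0E vf_sol => /(_ isT).
  by rewrite /= addn0 -/vb; lia.
have : size (enc_nat l.+1) <= (cL + size rb).+1.
  have h := @enc_nat_gt l.+1 isT; rewrite -(leq_exp2l _ _ (ltnSn 1)).
  by apply: leq_trans h _; rewrite expnS mul2n leq_double.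
by rewrite /thbound /m0; lia.
Qed.

Lemma thn l : l < L -> size (th l) <= n.
Proof. by move=> /size_th h; have := nbn; rewrite /nbound; lia. Qed.

Lemma num_th l : num (th l) = l.+1 * 2 ^ size vb %/ 2 ^ size rb.
Proof. by rewrite /thw num_drop num_nseq0 num_enc_nat mulnC. Qed.

Local Notation P := (tab_polytope Ms Mv Ma mx cL K1 K xb rb vb R).
Local Notation V := (var CHK N).
Local Notation lam := (lamv CHK N).
Local Notation z := (zv CHK N).
Local Notation dm := (dummyv CHK N).
Local Notation cls := (fun l : 'I_L => clauses CHK bX bW bTH bVD sb (sb false) N nw xb (th l)).
Local Notation PE := (sysP bX bW bTH bVD sb (sb false) nw xb (fun l : 'I_L => th l) (R := R)).

Lemma cls_var : forall (l : 'I_L) c, c \in cls l -> forall k, k \in c -> (k.2 != lam) && (k.2 != z).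
Proof.
move=> l c cc k kc; have [k' E] := clause_kind cc kc; case: k E {kc} => b [t [i kk]] /= ->.
by rewrite !xpair_eqE /= !andbF.
Qed.

Lemma dm_cls : forall (l : 'I_L) c, c \in cls l -> forall k, k \in c -> forall j, k.2 != dm j.
Proof.
move=> l c cc k kc j; have [k' E] := clause_kind cc kc; case: k E {kc} => b [t [i kk]] /= ->.
by rewrite !xpair_eqE /= !andbF.
Qed.

Lemma dm_inj : injective dm.
Proof. by move=> i j []. Qed.

Definition blk (U : 'cV[rat]_#|vart CHK N L|) (l : 'I_L) (v : V) : rat := U (enum_rank (l, v)) 0%R.

(* Candidates are read off at every time, although only time 0 is needed. *)
Definition chunk (U : 'cV[rat]_#|vart CHK N L|) (p : 'I_L * 'I_N.+1) : bits :=
  flatten [seq [seq nth false (enc_rat (blk U p.1 (p.2, (i, k)))) 2 | k <- enum (kd CHK)]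
    | i <- enum 'I_N.+1].

Lemma size_chunk U p : size (chunk U p) = n * #|kd CHK|.
Proof.
by rewrite /chunk size_grid size_enum_ord -cardE nE.
Qed.

Lemma flags_chunks (U : 'cV[rat]_#|vart CHK N L|) :
  [seq nth false (enc_rat (U j 0%R)) 2 | j <- enum 'I_#|vart CHK N L|] =
  flatten [seq chunk U p | p <- enum {: 'I_L * 'I_N.+1}].
Proof.
have L0 : 0 < L by rewrite /nlev expn_gt0.
transitivity [seq nth false (enc_rat (U (enum_rank a) 0%R)) 2 | a <- enum (vart CHK N L)].
  have y1 : vart CHK N L := (Ordinal L0, (ord0, (ord0, KLam CHK))).
  rewrite -(map_enum_val _ y1).
  by apply: eq_map => j; rewrite enum_valK.
rewrite map_prod flatten_prod; congr flatten; apply: eq_map => l.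
rewrite map_prod; congr flatten; apply: eq_map => t.
by rewrite map_prod.
Qed.

Lemma vertex_nonneg U l v : is_vertex (pt_set P) (map_mx ratr U) -> v != lam -> v != z ->
  (0 <= blk U l v)%R.
Proof.
move=> /vertex_in h vl vz.
have : polyhedron (map_mx ratr (sysA CHK bX bW bTH bVD sb (sb false) N nw xb (fun l : 'I_L => th l)))
  (map_mx ratr (sysb CHK N nw xb (fun l : 'I_L => th l))) (@vec R (vart CHK N L) (coords (map_mx ratr U))).
  by rewrite coordK.
move=> /PE /(_ l) [/(_ v vl vz) /andP[+ _] _ _ _].
by rewrite /coords mxE ler0q.
Qed.

(** A good block is a satisfying assignment, and its word at time 0 passes the check by
    [tableau_sound]. Off [lam] and [z] coordinates are nonnegative, so the third bit of their code
    reads them correctly. *)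
Lemma good_chunk U (l : 'I_L) : is_vertex (pt_set P) (map_mx ratr U) ->
  good lam (cls l) (block (map_mx ratr U : 'cV[R]_#|prod_ft 'I_L V|) l) ->
  let w := guess N (cfl (chunk U (l, ord0))) in
  vf w && better mx (num (vv w)) (num (th l)).
Proof.
move=> uV gd /=.
have ext := (vertex_blocks PE (map_mx ratr U)).1 uV l.
have sat := good_sat (@cls_var l) ext gd.
pose a (v : V) := (0 < block (map_mx ratr U : 'cV[R]_#|prod_ft 'I_L V|) l v)%R.
have := @tableau_sound _ _ CHK bX bW bTH bVD sb (sb false) isT isT isT N nw xb (th l) a sat.
rewrite /=; have -> : guess N (guessv bW sb a) = guess N (cfl (chunk U (l, ord0))).
  apply: guess_ext => i im.
  have H k : k != KLam CHK -> k != KZ CHK -> a (ord0, (inord i, k)) = flag (chunk U (l, ord0)) i k.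
    move=> kl kz'; rewrite /flag /chunk cardE.
    rewrite (nth_grid (fun (i : 'I_N.+1) (k : kd CHK) => nth false (enc_rat (blk U l (ord0, (i, k)))) 2) ord0 k).
    - have -> : nth ord0 (enum 'I_N.+1) i = inord i by apply: val_inj; rewrite /= nth_enum_ord // inordK.
      rewrite nth_index ?mem_enum // enc_rat_pos.
        by rewrite /a /block /coords mxE ltr0q.
      apply: vertex_nonneg uV _ _; by rewrite !xpair_eqE /= ?(negbTE kl) ?(negbTE kz') !andbF.
    - by rewrite size_enum_ord.
    - by rewrite index_mem mem_enum.
  by rewrite /guessv /cflags !H.
set w := guess N _ => /andP[wn]; rewrite conf_check //; last exact: size_th.
by case: (_ && _).
Qed.

(** The two vertices carry the same computations and opposite dummies. A block without a witness is
    filled with a constant assignment, which still contributes 2. *)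
Lemma sat_dist (sat : 'I_L -> bool) (wit : 'I_L -> sol x) :
  (forall l, sat l -> better mx (value (wit l)) (num (th l))) ->
  exists y : vertex_pair P, \sum_l (2 + 2 * sat l) <= vp_dist y.
Proof.
move=> hsat.
pose a (dv : bool) (l : 'I_L) : V -> bool :=
  if sat l then tableau bX bW bTH sb xb (th l) (enc_sol (wit l)) dv else fun _ => dv.
pose U dv : 'cV[rat]_#|vart CHK N L| := (\col_j (let lv := enum_val j in
  if lv.2 == z then 0 else if lv.2 == lam then 1 else (a dv lv.1 lv.2)%:R))%R.
have UE dv : map_mx ratr (U dv) = assign_vec R lam z (a dv).
  apply/matrixP => i j; rewrite !mxE /assign.
  case: (_ == z); first by rewrite rmorph0.
  by case: (_ == lam); rewrite ?rmorph1 // ratr_nat.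
have uV dv : is_vertex (pt_set P) (map_mx ratr (U dv)).
  by rewrite UE; apply: (vertex_assign _ cls_var PE).
exists (VertexPair (uV false) (uV true)).
rewrite -[vp_dist _]/(skeleton_dist (pt_set P) (map_mx ratr (U false)) (map_mx ratr (U true))) !UE.
have dml j : dm j != lam by [].
have dmz j : dm j != z by [].
have am dv l j : a dv l (dm j) = dv by rewrite /a; case: (sat l).
have lz : lam != z by [].
apply: leq_trans (dist_ge_assign (w0 := dm ord0) lz isT isT cls_var
  (fun l => clauses_nil _ _ _ _ _ _ _ _ _ _ _) dm_inj dml dmz dm_cls PE (am false) (am true)).
apply: leq_sum => l _; rewrite leq_add2l leq_mul2l /=.
case S : (sat l); rewrite ?leq0n // lt0b; apply/asboolP.
have gd dv : good lam (cls l) (assign R lam z (a dv l)).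
  apply: (good_assign R lz (@cls_var l)) => c cc.
  rewrite /a S; apply: (@tableau_complete _ _ CHK bX bW bTH bVD sb (sb false) isT isT isT N nw) cc => //.
  - exact: sol_nw.
  - exact: nwN.
  - rewrite conf_check ?sol_nw ?size_th // vf_sol vv_sol num_enc_nat /=.
    by rewrite hsat.
by split; exact: gd.
Qed.

Lemma dist_good (y : vertex_pair P) : vp_dist y <= \sum_(l < L) (2 + 2 *
  has (fun c => let w := guess N (cfl c) in vf w && better mx (num (vv w)) (num (th l)))
   ([seq chunk (vp_fst y) p | p <- enum {: 'I_L * 'I_N.+1}] ++
    [seq chunk (vp_snd y) p | p <- enum {: 'I_L * 'I_N.+1}])).
Proof.
have lz : lam != z by [].
apply: leq_trans (dist_le_good (w0 := dm ord0) lz isT isT cls_var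
  (fun l => clauses_nil _ _ _ _ _ _ _ _ _ _ _) PE (vp_fstP y) (vp_sndP y)) _.
apply: leq_sum => l _; rewrite leq_add2l leq_mul2l; apply/orP; right.
have mem U : chunk U (l, ord0) \in [seq chunk U p | p <- enum {: 'I_L * 'I_N.+1}].
  by apply: map_f; rewrite mem_enum.
case: asboolP => [h|_]; last exact: leq0n.
case E : (has _ _); first exact: leqnn.
exfalso; move/negbT: E; rewrite has_cat negb_or => /andP[/hasPn n1 /hasPn n2].
case: h => g.
  by have /negP[] := n1 _ (mem (vp_fst y)); exact: good_chunk (vp_fstP y) g.
by have /negP[] := n2 _ (mem (vp_snd y)); exact: good_chunk (vp_sndP y) g.
Qed.

Lemma arith_gap (Q E c rho t a b : rat) : (0 < Q -> 0 <= E -> 1 <= Q * t ->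
  c <= 2 * (rho * Q) * t -> a * Q <= b * Q + E + E * c -> a <= b + E * (t * (1 + 2 * rho)))%R.
Proof.
move=> Q0 E0 Qt hc h; rewrite -(ler_pM2r Q0).
have h1 : (E * (1 + c) <= E * (Q * t + 2 * (rho * Q) * t))%R by apply: ler_wpM2l => //; lra.
apply: le_trans h _; have -> : ((b + E * (t * (1 + 2 * rho))) * Q = b * Q + E * (Q * t + 2 * (rho * Q) * t))%R by ring.
by move: h1; rewrite mulrDr mulr1; lra.
Qed.

(** [r - 1] is a positive multiple of the inverse of the denominator, and the code of [r] is at
    least as long as that of the denominator. *)
Lemma rat_gap : (1 < r)%R -> (1 <= (2 ^ size rb)%:R * (r - 1))%R.
Proof.
move=> r1; have d0 := denq_gt0 r.
have nd : (denq r < numq r)%R.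
  by rewrite -(ltr_int rat) numqE -[ltLHS]mul1r ltr_pM2r // ltr0z.
have [d dE] : exists d : nat, denq r = d by case: (denq r) d0 => // d _; exists d.
have dQ : d <= 2 ^ size rb.
  apply: ltnW; apply: leq_trans (enc_nat_lt d) _; rewrite leq_exp2l //.
  by rewrite /enc_rat /enc_seq /= dE !size_cat !delimitE !size_cat /=; elim: (enc_nat d) => //=; lia.
have d0' : (0 < d%:R :> rat)%R by move: d0; rewrite dE ltz_nat ltr0n.
have h : ((d%:R + 1 : rat) <= r * d%:R)%R.
  have <- : ((numq r)%:~R = r * d%:R :> rat)%R by rewrite numqE dE.
  by rewrite -[(d%:R)%R]/((d%:Z)%:~R)%R -(rmorphD (intr : int -> rat) _ 1%R) ler_int -dE lezD1.
have : ((1 : rat) <= d%:R * (r - 1))%R by lra.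
move=> h'; apply: le_trans h' _; apply: ler_wpM2r; first by lra.
by rewrite ler_nat.
Qed.

Definition chunks (y : vertex_pair P) :=
  [seq chunk (vp_fst y) p | p <- enum {: 'I_L * 'I_N.+1}] ++
  [seq chunk (vp_snd y) p | p <- enum {: 'I_L * 'I_N.+1}].

(** Let [S2] and [S1] be the sums of [2 + 2 [beaten]] over the thresholds for the optimum and for
    [s]. Then [S2 = S1 + 2 cc], the diameter is at least [S2] and the given distance at most [S1],
    so [2 cc <= (r - 1) S1 <= 4 L (r - 1)]. *)
Lemma count_missing (y : vertex_pair P) (s : sol x) (o : nat) : is_opt x o ->
  @ratio_le (polytope_diameter R) r P y ->
  enc_sol s = (foldl (best_step mx vf vv) (w0, vb) [seq guess N (cfl c) | c <- chunks y]).1 ->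
  (1 < r)%R ->
  ~~ better mx (value y0) (value s) /\
  ((\sum_(l < L) (better mx o (num (th l)) && ~~ better mx (value s) (num (th l))))%:R <=
     2 * L%:R * (r - 1) :> rat)%R.
Proof.
move=> [[yo yoE] oopt] [nB [_ optB] [hB _]] sE r1.
have vw0 : vf w0 by rewrite w0E vf_sol.
have [b1 b2 b3 b4] := @foldl_best mx vf vv (w0, vb) [seq guess N (cfl c) | c <- chunks y] vw0 erefl.
move: b1 b2 b3 b4 sE; set b' := foldl _ _ _ => b1 b2 b3 b4 sE.
have nb' : num b'.2 = value s by rewrite b2 -sE vv_sol num_enc_nat.
rewrite nb' in b3 b4; rewrite /= {1}vbE num_enc_nat in b3; split=> //.
have hd : vp_dist y <= \sum_(l < L) (2 + 2 * better mx (value s) (num (th l))).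
  apply: leq_trans (dist_good y) _; apply: leq_sum => l _; rewrite leq_add2l leq_mul2l; apply/orP; right.
  case E : (has _ _) => //; have /hasP[c cc /andP[vc bc]] := E.
  rewrite (better_trans bc) //; apply: b4 vc.
  exact: (map_f (fun c => guess N (cfl c)) cc).
(* One optimal solution witnesses all thresholds beaten by the optimum. *)
have [y' hy'] := @sat_dist (fun l => better mx o (num (th l))) (fun _ => yo)
  (fun l h => etrans (congr1 (fun v => better mx v (num (th l))) yoE) h).
have {}hy' : \sum_(l < L) (2 + 2 * better mx o (num (th l))) <= nB := leq_trans hy' (optB y').
have impl l : better mx (value s) (num (th l)) -> better mx o (num (th l)).
  by have := oopt s; rewrite /better /mx; case: (opt_goal A); lia.
set cc := (\sum_(l < L) (_ && _))%N.
have eqS : (\sum_(l < L) (2 + 2 * better mx o (num (th l))) =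
   \sum_(l < L) (2 + 2 * better mx (value s) (num (th l))) + 2 * cc)%N.
  rewrite /cc big_distrr -big_split /=; apply: eq_bigr => l _.
  by have := impl l; case: (better mx o _); case: (better mx _ _) => // /(_ isT).
have leS : \sum_(l < L) (2 + 2 * better mx (value s) (num (th l))) <= 4 * L.
  rewrite -[X in _ <= 4 * X]card_ord mulnC -sum_nat_const; apply: leq_sum => l _.
  by case: (better mx _ _).
move: eqS leS hd hy'; set S1 := (\sum_(l < L) (2 + 2 * better mx (value s) _))%N.
set S2 := (\sum_(l < L) (2 + 2 * better mx o _))%N => eqS leS hd hy'.
have h1 : ((S1%:R + 2 * cc%:R : rat) <= r * S1%:R)%R.
  have -> : (S1%:R + 2 * cc%:R = S2%:R :> rat)%R by rewrite eqS natrD natrM.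
  apply: (@le_trans _ _ (nB%:R)%R); first by rewrite ler_nat.
  apply: le_trans hB _; apply: ler_wpM2l; first by lra.
  by rewrite ler_nat.
have h2 : ((S1%:R : rat) <= 4 * L%:R)%R by rewrite -natrM ler_nat.
have h3 : ((r - 1) * S1%:R <= (r - 1) * (4 * L%:R) :> rat)%R by apply: ler_wpM2l => //; lra.
by lra.
Qed.

(** With [rho = 2 ^ cL], the factor [1 + 2 rho] comes from the spacing and the missed thresholds,
    and [2 rho] from comparing the scale [E] with the smaller of the two values in the ratio. *)
Definition ratio_const : rat := (2 * 2 ^ cL * (1 + 2 * 2 ^ cL))%:R%R.

Lemma ratio_transfer (y : vertex_pair P) (s : sol x) : (1 < r)%R ->
  @ratio_le (polytope_diameter R) r P y ->
  enc_sol s = (foldl (best_step mx vf vv) (w0, vb) [seq guess N (cfl c) | c <- chunks y]).1 ->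
  @ratio_le A (1 + ratio_const * (r - 1))%R x s.
Proof.
move=> r1 ry sE; have [o oo [ho1 ho2]] := y0r; exists o => //.
have [b3 cc] := count_missing oo ry sE r1.
set v := value s in b3 cc *; set v0 := value y0 in b3 ho1 ho2 *.
set c := (\sum_(l < L) _)%N in cc.
pose rho := 2 ^ cL; pose Q := 2 ^ size rb; pose E := 2 ^ size vb.
have Q0 : 0 < Q by rewrite expn_gt0.
have rho0 : 0 < rho by rewrite expn_gt0.
have LE : L = rho * Q by rewrite /nlev expnD.
have Ev0 : v0 < E by rewrite /E vbE; exact: enc_nat_lt.
have [[yo yoE] oopt] := oo.
have nlr (a b : nat) : (a%:R <= r0 * b%:R)%R -> a <= rho * b.
  move=> h; rewrite -(ler_nat rat) natrM; apply: le_trans h _.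
  by apply: ler_wpM2r => //; exact: ler0n.
have k1 := nlr _ _ ho1; have k2 := nlr _ _ ho2.
have t1 : (0 < r - 1)%R by lra.
have al1 : (0 <= ratio_const)%R by exact: ler0n.
have gap := rat_gap r1.
have win (a b : nat) : a * Q <= b * Q + E + E * c ->
    (a%:R <= b%:R + E%:R * ((r - 1) * (1 + 2 * rho%:R)) :> rat)%R.
  move=> h; apply: (@arith_gap Q%:R E%:R c%:R rho%:R (r - 1) a%:R b%:R) => //.
  - by rewrite ltr0n.
  - by rewrite -natrM -LE.
  - by rewrite -!natrM -!natrD ler_nat.
have E2 : 0 < v0 -> E <= 2 * v0 by move=> h; rewrite /E vbE mul2n; exact: enc_nat_gt.
(* [v1] separates [v0] from [rho * b], which turns [E <= 2 * v0] into a bound by a multiple of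
   [b]. *)
have fin (a b v1 : nat) : a * Q <= b * Q + E + E * c -> v1 <= rho * b -> v0 <= v1 ->
   (v0 = 0 -> a = 0) -> (a%:R <= (1 + ratio_const * (r - 1)) * b%:R :> rat)%R.
  move=> h hb v01 z; have [v00|v0p] := posnP v0.
    rewrite (z v00); apply: mulr_ge0; last exact: ler0n.
    by apply: addr_ge0 => //; apply: mulr_ge0 => //; lra.
  have h1 := win _ _ h.
  have h2 : E <= 2 * (rho * b).
    by apply: leq_trans (E2 v0p) _; rewrite leq_mul2l /=; exact: leq_trans v01 hb.
  have h3 : ((E%:R : rat) <= 2 * (rho%:R * b%:R))%R by rewrite -!natrM ler_nat.
  have h4 : (0 <= (r - 1) * (1 + 2 * rho%:R) :> rat)%R.
    by apply: mulr_ge0; [lra | apply: addr_ge0 => //; apply: mulr_ge0 => //; exact: ler0n].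
  have h5 := ler_wpM2r h4 h3.
  apply: le_trans h1 _.
  have -> : ratio_const = (2 * rho%:R * (1 + 2 * rho%:R))%R.
    by rewrite /ratio_const !(natrM, natrD).
  by apply: le_trans (lerD (lexx _) h5) _; lra.
have triv (a b : nat) : a <= b -> (a%:R <= (1 + ratio_const * (r - 1)) * b%:R :> rat)%R.
  move=> ab; apply: (@le_trans _ _ b%:R%R); first by rewrite ler_nat.
  rewrite mulrDl mul1r lerDl; apply: mulr_ge0; last exact: ler0n.
  by apply: mulr_ge0 => //; lra.
have os := oopt s; have oy := oopt y0.
rewrite -/v in os; rewrite -/v0 in oy.
have QL : Q * E <= L.+1 * E.
  rewrite leq_mul2r LE; apply/orP; right; apply: leqW.
  by rewrite -{1}(mul1n Q) leq_mul2r rho0 orbT.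
move: b3 os oy; rewrite /c /better /mx; case G : (opt_goal A) => b3 os oy.
- split; first exact: triv.
  (* A missed threshold satisfies [o < th <= v]. As [th] is the floor of [(l + 1) E / Q], this means
     that [(l + 1) E] lies between [(o + 1) Q] and [(v + 1) Q], upper end excluded; hence the
     successors. *)
  have W : v.+1 * Q <= o.+1 * Q + E + E * c.
    have -> : c = (\sum_(l < L) ((o.+1 * Q <= l.+1 * E) && (l.+1 * E < v.+1 * Q)))%N.
      rewrite /c /better /mx G; apply: eq_bigr => l _; rewrite num_th -/Q -/E -leqNgt.
      by rewrite leq_divRL // -ltn_divLR // ltnS.
    by apply: window; apply: leq_trans QL; rewrite mulnC leq_mul2l; apply/orP; right; lia.
  have W' : v * Q <= o * Q + E + E * c by move: W; rewrite !mulSn; lia.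
  by apply: (fin v o v0 W' k2 (leqnn _)) => z; lia.
- split; last exact: triv.
  (* Here a missed threshold satisfies [v <= th < o], and the thresholds reach far enough because
     [o <= rho * v0] and [v0 < E]. *)
  have W : o * Q <= v * Q + E + E * c.
    have -> : c = (\sum_(l < L) ((v * Q <= l.+1 * E) && (l.+1 * E < o * Q)))%N.
      rewrite /c /better /mx G; apply: eq_bigr => l _; rewrite num_th -/Q -/E -leqNgt andbC.
      by rewrite leq_divRL // ltn_divLR.
    apply: window; apply: (@leq_trans (rho * E * Q)); first by rewrite leq_mul2r; nia.
    by rewrite LE; nia.
  have v0v : v0 <= v by lia.
  have rv : v <= rho * v by rewrite -{1}(mul1n v) leq_mul2r rho0 orbT.
  by apply: (fin o v v W rv v0v) => z; move: k1; rewrite z muln0; lia.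
Qed.

End Inhabited.
End Instance.

Local Notation nlv r := (nlev cL (enc_rat r)).
Local Notation nI x r := (nn K (enc_inst x) (enc_rat r)).
Local Notation wst x r := (w_start Ma K (enc_inst x) (enc_rat r)).

(** * The two maps of the reduction *)

Definition f_red (r : rat) (x : inst A) : polytope R :=
  if `[< inhabited (sol x) >]
  then tab_polytope Ms Mv Ma mx cL K1 K (enc_inst x) (enc_rat r) (vb x r) R
  else empty_polytope R.

Definition flags (P : polytope R) (y : vertex_pair P) : bits :=
  [seq nth false (enc_rat (vp_fst y j 0%R)) 2 | j <- enum 'I_(pt_dim P)] ++
  [seq nth false (enc_rat (vp_snd y j 0%R)) 2 | j <- enum 'I_(pt_dim P)].

(** Cutting the flags by length alone makes sense for every polytope, so the output can be defined
    without resolving the case distinction in the type of [f_red]. *)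
Definition gcs (x : inst A) (r : rat) (P : polytope R) (y : vertex_pair P) : seq bits :=
  reshape (nseq (nlv r * nI x r + nlv r * nI x r) (nI x r * #|kd CHK|)) (flags y).

Definition gout (x : inst A) (r : rat) (P : polytope R) (y : vertex_pair P) : bits :=
  (foldl (best_step mx (vf x) (vv x)) (wst x r, vb x r)
    [seq guess (nI x r).-1 (cfl c) | c <- gcs x r y]).1.

Lemma gcsE x r (y : vertex_pair (tab_polytope Ms Mv Ma mx cL K1 K (enc_inst x) (enc_rat r) (vb x r) R)) :
  gcs x r y = chunks y /\ flags y = flatten (chunks y).
Proof.
have fE : flags y = flatten (chunks y).
  by rewrite /flags /chunks flatten_cat; congr (_ ++ _); exact: flags_chunks.
split=> //; rewrite /gcs fE.
have -> : nseq (nlv r * nI x r + nlv r * nI x r) (nI x r * #|kd CHK|) = shape (chunks y).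
  have h U : shape [seq chunk U p | p <- enum {: 'I_(nlv r) * 'I_(nI x r).-1.+1}] =
      nseq (nlv r * nI x r) (nI x r * #|kd CHK|).
    rewrite /shape -map_comp.
    have -> : nlv r * nI x r = size (enum {: 'I_(nlv r) * 'I_(nI x r).-1.+1}).
      by rewrite -cardE card_prod !card_ord nE.
    by elim: (enum _) => //= p l ->; rewrite size_chunk.
  by rewrite /chunks /shape map_cat -!/(shape _) !h -nseqD.
exact: flattenK.
Qed.

(** The approximation algorithm finds a solution whenever there is one; testing its clocked output
    therefore decides the case distinction of [f_red] in polynomial time. *)
Lemma valid_start x r : vf x (wst x r) = `[< inhabited (sol x) >].
Proof.
apply/idP/idP => [/asboolP[y _]|/asboolP/Ha[y0 _ y0c]]; first by apply/asboolP; exists.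
by rewrite (w0E r y0c) vf_sol.
Qed.

Lemma gout_sol x r (y : vertex_pair (f_red r x)) : exists s : sol x, enc_sol s = gout x r y.
Proof.
have : `[< inhabited (sol x) >].
  by move: y; rewrite /f_red; case: ifP => // _ /empty_no_vertex.
rewrite -(valid_start x r) => vw.
have [b1 _ _ _] := @foldl_best mx (vf x) (vv x) (wst x r, vb x r)
  [seq guess (nI x r).-1 (cfl c) | c <- gcs x r y] vw erefl.
by have [s E _] := vfP b1; exists s; rewrite /gout -E.
Qed.

Definition g_red (r : rat) (x : inst A) (y : vertex_pair (f_red r x)) : sol x :=
  projT1 (cid (gout_sol y)).

Lemma g_redE r x (y : vertex_pair (f_red r x)) : enc_sol (g_red y) = gout x r y.
Proof. exact: (projT2 (cid (gout_sol y))). Qed.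

Lemma red_ratio r x (y : vertex_pair (f_red r x)) : (1 < r)%R ->
  @ratio_le (polytope_diameter R) r (f_red r x) y ->
  @ratio_le A (1 + ratio_const * (r - 1))%R x (g_red y).
Proof.
move=> r1; move: (g_redE y); move: (g_red y) => s; move: y; rewrite /f_red.
case: ifP => [/asboolP/Ha[y0 y0r y0c]|_] y; last by case: (empty_no_vertex y).
by rewrite /gout (gcsE y).1 => sE ry; exact: (ratio_transfer y0r y0c r1 ry sE).
Qed.

Lemma red_inhabited r x : inhabited (sol x) -> inhabited (vertex_pair (f_red r x)).
Proof.
move=> ix; rewrite /f_red; case: asboolP => // _; have [y0 y0r y0c] := Ha ix.
(* With no block claimed satisfiable, [sat_dist] still provides a pair of vertices. *)
by have [//|y _] := @sat_dist x r y0 y0c (fun _ => false) (fun _ => y0); exists.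
Qed.

Lemma hrx0 : hrx ord0 = R0 Ms Mv Ma.
Proof. by rewrite -[RHS]hixK; congr hrx; apply: val_inj. Qed.

Lemma compile_time (p : prog (hReg Ms Mv Ma) (hG Ms Mv Ma)) B (ws : seq bits) s' out T :
  size ws <= 3 -> big B p (@input_stacks _ (hS Ms Mv Ma) _ (@hix Ms Mv Ma) ws) s' ->
  s' (R0 Ms Mv Ma) = map sb (rev out) ->
  3 * cost B p + 2 * sumn [seq size w | w <- ws] + 4 <= T ->
  tm_computes_in (compile (@hix Ms Mv Ma) (@hrx Ms Mv Ma) p) T ws out.
Proof.
move=> sz h ho hT.
have sz' : size ws <= (hK Ms Mv Ma).+1 by rewrite (leq_trans sz) // /hK addSn ltnS leq_addr.
have := size_big (R0 Ms Mv Ma) h; rewrite ho size_map size_rev input_stacksE //.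
rewrite -[upd _ _ _ _]/(map sb (rev (nth [::] ws 0))) size_map size_rev => h1.
have h2 : size (nth [::] ws 0) <= sumn [seq size w | w <- ws] by case: (ws) => //= a l; rewrite leq_addr.
rewrite -hrx0 in ho.
have h3 : 2 * cost B p + sumn [seq size w | w <- ws] + size out + 4 <= T by lia.
exact: tm_computes_mono (compile_correct (@hixK Ms Mv Ma) (@hrxK Ms Mv Ma) sz' h ho) h3.
Qed.

(** * Running times *)

Local Notation FP := (FPROG Ms Mv Ma mx cL K1 K (enc_polytope (empty_polytope R))).
Local Notation GP := (GPROG Ms Mv Ma mx cL K1 K).

(** Bounds the start word by the clock rather than by the length of solutions, since without
    solutions the output of the clocked run is arbitrary. *)
Definition qb m := m + (m + m ^ K + 2).
Definition db m := m ^ K + (m + m) + 2 + (qb m + 2) + poly_bound ks (qb m) + poly_bound kv (qb m).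
Definition fb L m := db m + 1 + m ^ K1 + L + m +
  L * (m ^ K * (m ^ K * (#|rho CHK| + #|kd CHK|))).

Lemma polyb_fb L : polyb (fb L).
Proof.
have pk k : polyb (fun m => m ^ k) by apply: polyb_exp; exact: polyb_id.
have pc c : polyb (fun _ => c) := polyb_const c.
have pi : polyb (fun m => m) := polyb_id.
have pq : polyb qb := polyb_add pi (polyb_add (polyb_add pi (pk K)) (pc 2)).
have pd : polyb db := polyb_add (polyb_add (polyb_add (polyb_add (polyb_add (pk K)
  (polyb_add pi pi)) (pc 2)) (polyb_add pq (pc 2))) (polyb_poly ks pq)) (polyb_poly kv pq).
exact: (polyb_add (polyb_add (polyb_add (polyb_add (polyb_add pd (pc 1)) (pk K1)) (pc L)) pi)
  (polyb_mul (pc L) (polyb_mul (pk K) (polyb_mul (pk K) (pc _))))).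
Qed.

(** The number [L] of levels is a constant of the polynomial, as it depends on the ratio only. *)
Lemma time_bound (p : prog (hReg Ms Mv Ma) (hG Ms Mv Ma)) L : exists k, forall S,
  3 * cost (fb L (S + 2)) p + 2 * S + 4 <= poly_bound k S.
Proof.
have [|k H] := @polyb_bound (fun m => 3 * cost (fb L m) p + 2 * m + 4).
  apply: polyb_add; last exact: polyb_const.
  apply: polyb_add; apply: polyb_mul; try exact: polyb_const; last exact: polyb_id.
  by apply: polyb_cost; exact: polyb_fb.
by exists k => S; apply: leq_trans (H S); lia.
Qed.

Lemma f_time r : exists k, forall x : inst A,
  tm_computes_poly (compile (@hix Ms Mv Ma) (@hrx Ms Mv Ma) FP) k [:: enc_inst x; enc_rat r]
    (enc_polytope (f_red r x)).
Proof.
have [k H] := time_bound FP (nlv r); exists k => x; rewrite /tm_computes_poly.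
set S := sumn _; have SE : S + 2 = m0 (enc_inst x) (enc_rat r) by rewrite /S /= /m0; lia.
set m := S + 2 in SE; set B := fb (nlv r) m.
have nmE : nI x r = m ^ K by rewrite /nn -SE.
have xm' : size (enc_inst x) <= m by rewrite SE; exact: xm.
have wq : size (enc_inst x) + size (wst x r) <= qb m.
  by have := @size_tape_output Ma (nI x r) [:: enc_inst x]; rewrite -/(wst x r) /= addn0 nmE /qb; lia.
have nwB : nwd K1 (enc_inst x) (enc_rat r) = m ^ K1 by rewrite /nwd -SE.
have := @big_FPROG Ms Mv Ma mx cL K1 K (enc_polytope (empty_polytope R)) B (db m) (enc_inst x)
  (enc_rat r) (vf x (wst x r)) (vb x r) (poly_bound ks (qb m)) (poly_bound kv (qb m)).
move=> F.
have [|||||||||||||||s' h ho] := F.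
- exact: Hs_in.
- by move=> v; apply: Hv_in.
- by rewrite /db; lia.
- by rewrite /db; lia.
- by rewrite nmE /db; lia.
- by rewrite /B /fb; lia.
- by rewrite nwB /B /fb; lia.
- by rewrite /B /fb; lia.
- by rewrite -SE /B /fb; lia.
- exact: n0.
- exact: xn.
- by apply: leq_trans (nwN _ _) _; exact: leq_pred.
- rewrite valid_start => /asboolP/Ha[y0 _ y0c] l lL.
  by have t := thn y0c lL.
- rewrite nmE; apply: (@leq_trans (nlv r * (m ^ K * (m ^ K * (#|rho CHK| + #|kd CHK|))))).
    by rewrite !leq_mul // leq_addr.
  by rewrite /B /fb leq_addl.
- rewrite nmE; apply: (@leq_trans (nlv r * (m ^ K * (m ^ K * (#|rho CHK| + #|kd CHK|))))).
    by rewrite !leq_mul // leq_addl.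
  by rewrite /B /fb leq_addl.
have oE : (if vf x (wst x r) then polyword Ms Mv Ma mx cL K1 K (enc_inst x) (enc_rat r) (vb x r)
   else enc_polytope (empty_polytope R)) = enc_polytope (f_red r x).
  by rewrite valid_start /f_red; case: ifP => // _; rewrite enc_tab_polytope // n0.
rewrite oE in ho; exact: (compile_time _ h ho (H S)).
Qed.

Lemma size_flatten_ge (cs : seq bits) : (forall c : bits, c \in cs -> 0 < size c) ->
  size cs <= size (flatten cs).
Proof.
elim: cs => //= c cs IH h; rewrite size_cat -add1n leq_add //; first by apply: h; rewrite mem_head.
by apply: IH => c' cc; apply: h; rewrite inE cc orbT.
Qed.

Lemma size_cwords (us : seq bits) : size us <= size (flatten [seq cword c | c <- us]) /\
  forall u : bits, u \in us -> size u <= size (flatten [seq cword c | c <- us]).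
Proof.
split.
  rewrite -(size_map cword); apply: size_flatten_ge => c /mapP[u _ ->].
  exact: leq_ltn_trans (leq0n _) (size_cword u).
elim: us => //= c us IH u; rewrite inE size_cat => /predU1P[->|/IH h].
  exact: leq_trans (ltnW (size_cword c)) (leq_addr _ _).
exact: leq_trans h (leq_addl _ _).
Qed.

Lemma g_time r : exists k, forall (x : inst A) (y : vertex_pair (f_red r x)),
  tm_computes_poly (compile (@hix Ms Mv Ma) (@hrx Ms Mv Ma) GP) k
    [:: enc_inst x; enc_vertex_pair y; enc_rat r] (enc_sol (g_red y)).
Proof.
have [k H] := time_bound GP (nlv r); exists k => x y; rewrite /tm_computes_poly g_redE.
move: y; rewrite /f_red; case: ifP => [/asboolP/Ha[y0 y0r y0c]|_] y; last by case: (empty_no_vertex y).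
set S := sumn _; set m := S + 2; set B := fb (nlv r) m.
have SE : S = size (enc_inst x) + (size (enc_vertex_pair y) + size (enc_rat r)) by rewrite /S /= addn0.
have mm : m0 (enc_inst x) (enc_rat r) <= m by rewrite /m SE /m0; lia.
have pw j : m0 (enc_inst x) (enc_rat r) ^ j <= m ^ j by case: j => // j; rewrite leq_exp2r.
have nm : nI x r <= m ^ K by exact: pw.
have xm' : size (enc_inst x) <= m by rewrite /m SE; lia.
have vw0 : vf x (wst x r) by rewrite (w0E r y0c) vf_sol.
have w0n : size (wst x r) <= nI x r.
  rewrite (w0E r y0c); apply: leq_trans (sol_nw r y0) _; apply: leq_trans (nwN _ _) _; exact: leq_pred.
have [gE flE] := gcsE y.
pose us (U : 'cV[rat]_(pt_dim (tab_polytope Ms Mv Ma mx cL K1 K (enc_inst x) (enc_rat r) (vb x r) R))) :=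
  [seq enc_rat (U i 0%R) | i <- enum 'I_(pt_dim (tab_polytope Ms Mv Ma mx cL K1 K (enc_inst x) (enc_rat r) (vb x r) R))].
have yE := enc_vertex_pairE y; rewrite -/(us (vp_fst y)) -/(us (vp_snd y)) in yE.
have [u1 v1] := size_cwords (us (vp_fst y)); have [u2 v2] := size_cwords (us (vp_snd y)).
have szy : size (enc_vertex_pair y) = size (flatten [seq cword c | c <- us (vp_fst y)]) +
    (size (flatten [seq cword c | c <- us (vp_snd y)])).+2.
  have szE (a b : bits) : size (a ++ false :: b ++ [:: false]) = size a + (size b).+2.
    by rewrite size_cat /= size_cat addn1.
  by rewrite yE; exact: szE.
have yB : size (enc_vertex_pair y) <= B by rewrite /B /fb /m SE; lia.
have chP (c : bits) : c \in chunks y -> size c = nI x r * #|kd CHK|.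
  by rewrite mem_cat => /orP[] /mapP[p _ ->]; exact: size_chunk.
have k0 : 0 < #|kd CHK| by apply/card_gt0P; exists (KLam CHK).
have csB : size (chunks y) <= B.
  apply: (@leq_trans (size (flatten (chunks y)))).
    by apply: size_flatten_ge => c /chP ->; rewrite muln_gt0 n0.
  rewrite -flE /flags size_cat !size_map; move: u1 u2; rewrite !size_map; lia.
have := @big_GPROG Ms Mv Ma mx cL K1 K B (db m) (enc_inst x) (enc_rat r) (vb x r)
  (poly_bound ks (qb m)) (poly_bound kv (qb m)) (vf x) (vv x) (us (vp_fst y)) (us (vp_snd y)) (chunks y).
move=> F.
have a5 (w : bits) : size w <= nI x r -> tm_computes_in Ms (poly_bound ks (qb m)) [:: enc_inst x; w] [:: vf x w].
  by move=> wn; apply: Hs_in; rewrite /qb; lia.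
have a6 (w : bits) : size w <= nI x r -> vf x w ->
    tm_computes_in Mv (poly_bound kv (qb m)) [:: enc_inst x; w] (vv x w).
  by move=> wn vw; apply: Hv_in => //; rewrite /qb; lia.
have a7 : (size (enc_inst x) + nI x r).+2 + poly_bound ks (qb m) <= db m by rewrite /db /qb; lia.
have a8 : (size (enc_inst x) + nI x r).+2 + poly_bound kv (qb m) <= db m by rewrite /db /qb; lia.
have a9 : nI x r + (size (enc_inst x) + size (enc_inst x)) + 2 <= db m by rewrite /db; lia.
have a10 : db m < B by rewrite /B /fb; lia.
have a11 : nwd K1 (enc_inst x) (enc_rat r) <= B by apply: leq_trans (pw K1) _; rewrite /B /fb; lia.
have a12 : nlv r <= B by rewrite /B /fb; lia.
have a13 : m0 (enc_inst x) (enc_rat r) <= B by apply: leq_trans mm _; rewrite /B /fb; lia.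
have a15 (u : bits) : u \in us (vp_fst y) ++ us (vp_snd y) -> size u <= B.
  by rewrite mem_cat => /orP[/v1|/v2] hu; apply: leq_trans hu _; lia.
have a16 : size (us (vp_fst y)) + size (us (vp_snd y)) <= B by lia.
have a17 : [seq nth false u 2 | u <- us (vp_fst y) ++ us (vp_snd y)] = flatten (chunks y).
  by rewrite -flE /flags map_cat /us -!map_comp.
rewrite yE in yB.
have [s' h ho] := F (n0 x r) w0n vw0 erefl a5 a6 a7 a8 a9 a10 a11 a12 a13 yB a15 a16 a17 csB chP.
rewrite -yE in h.
rewrite -gE -/(gout x r y) in ho; exact: (compile_time _ h ho (H S)).
Qed.

Lemma AP_red : AP_reducible A (polytope_diameter R).
Proof.
exists ratio_const, f_red, (fun r x y => @g_red r x y); split.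
- by rewrite /ratio_const ler1n muln_gt0 /= muln_gt0 expn_gt0.
- exists (compile (@hix Ms Mv Ma) (@hrx Ms Mv Ma) FP) => r _; exact: f_time.
- exists (compile (@hix Ms Mv Ma) (@hrx Ms Mv Ma) GP) => r _; exact: g_time.
- by move=> r x _; exact: red_inhabited.
- by move=> r x y r1; exact: red_ratio.
Qed.

End Reduction.

Theorem theorem3 (R : realType) : APX_hard (polytope_diameter R).
Proof.
move=> A [[_ [kz Hz] [Ms [ks Hs]] [Mv [kv Hv]]] [r0 [Ma [ka [r01 Ha]]]]].
have [cL r0L] : exists cL, (r0 <= (2 ^ cL)%:R)%R.
  (* A rational number above 1 is at most its numerator, which is below 2 to its own power. *)
  exists (`|numq r0|)%N; apply: (@le_trans _ _ (`|numq r0|%N%:R)%R); last by rewrite ler_nat ltnW // ltn_expl.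
  have n0 : (0 < numq r0)%R by rewrite numq_gt0; lra.
  rewrite -[X in (_ <= X)%R]/((`|numq r0|%N%:Z)%:~R)%R gez0_abs; last exact: ltW.
  rewrite numqE ler_peMr //; first by lra.
  by rewrite -[1%R]/(1%:~R)%R ler_int -gtz0_ge1 denq_gt0.
have [K1 HK1] : polyb (poly_bound kz) by apply: polyb_poly; exact: polyb_id.
have pW : polyb (wbound K1) by apply: polyb_exp; exact: polyb_id.
have pT : polyb (tbound K1) by apply: polyb_add => //; exact: polyb_id.
have pth : polyb (thbound kv cL K1).
  apply: (@polyb_le _ (fun m => tbound K1 m + poly_bound kv (tbound K1 m) + 2 + (cL + m + 1))).
    by move=> m _; rewrite /thbound addn1.
  exact: (polyb_add (polyb_add (polyb_add pT (polyb_poly kv pT)) (polyb_const 2))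
    (polyb_add (polyb_add (polyb_const cL) polyb_id) (polyb_const 1))).
have pd : polyb (dbound ks kv cL K1).
  apply: (@polyb_le _ (fun m => tbound K1 m + 2 + poly_bound ks (tbound K1 m) +
    poly_bound kv (tbound K1 m) + thbound kv cL K1 m)).
    by move=> m _; rewrite /dbound addn2.
  exact: (polyb_add (polyb_add (polyb_add (polyb_add pT (polyb_const 2)) (polyb_poly ks pT))
    (polyb_poly kv pT)) pth).
(* There is no circularity: [CHECK] does not depend on [K], so its running time is bounded before
   the number of rows is chosen. *)
have [K HK] : polyb (nbound A Ms Mv Ma ks kv ka cL K1).
  apply: (@polyb_le _ (fun m => cost (dbound ks kv cL K1 m + 1) (CHECK Ms Mv Ma (mx A)) + 1 + wbound K1 m + m +
    poly_bound ka m + 2 + thbound kv cL K1 m)).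
    by move=> m _; rewrite /nbound !addn1.
  exact: (polyb_add (polyb_add (polyb_add (polyb_add (polyb_add (polyb_add
    (polyb_cost _ (polyb_add pd (polyb_const 1))) (polyb_const 1)) pW) polyb_id)
    (polyb_poly ka polyb_id)) (polyb_const 2)) pth).
exact: (AP_red R Hs Hv Hz Ha r0L HK1 HK).
Qed.
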